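(* Let $K$ be a number field and $d\ge1$. For each nonzero prime ideal $\mathfrak p$ of the ring of integers of $K$ let $\alpha_{\mathfrak p,1},\dots,\alpha_{\mathfrak p,d}\in\mathbf C$ with $|\alpha_{\mathfrak p,j}|\le 1$, and let \[ L(s) = \prod_{\mathfrak p}\frac{1}{(1-\alpha_{\mathfrak p,1}\mathrm N\mathfrak p^{-s})\cdots(1-\alpha_{\mathfrak p,d}\mathrm N\mathfrak p^{-s})}, \qquad \mathrm{Re}(s)>1. \] Suppose $L(s)$ admits an analytic continuation to $\mathrm{Re}(s)\ge 1$ which is nonvanishing on $\mathrm{Re}(s)=1$. Then for every $s$ with $\mathrm{Re}(s)=1$, \[ L(s) = \lim_{x\to\infty}\prod_{\mathrm N\mathfrak p\le x}\frac{1}{(1-\alpha_{\mathfrak p,1}\mathrm N\mathfrak p^{-s})\cdots(1-\alpha_{\mathfrak p,d}\mathrm N\mathfrak p^{-s})}. \]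
   Context: $\mathrm N\mathfrak p$ denotes the absolute norm of the prime ideal $\mathfrak p$. The Euler product converges absolutely and is nonvanishing for $\mathrm{Re}(s)>1$. *)

(* Defs.v *)
From HB Require Import structures.
From mathcomp Require Import all_boot all_order all_algebra all_field.
From mathcomp Require Import finmap complex.
From mathcomp Require Import all_classical all_reals all_analysis.
From mathcomp Require Import summability.

Set Implicit Arguments.
Unset Strict Implicit.
Unset Printing Implicit Defensive.

Import Order.TTheory GRing.Theory Num.Theory.
Import numFieldNormedType.Exports.

Local Open Scope classical_set_scope.
Local Open Scope ring_scope.
Local Open Scope complex_scope.

(* A number field is a K : fieldExtType rat, i.e. a finite extension of Q. *)
Section RingOfIntegers.
Variable K : fieldExtType rat.

Definition algebraicInteger : pred K :=
  fun x => `[< integralOver (intr : int -> K) x >].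

Lemma algebraicInteger_subring : subring_closed algebraicInteger.
Proof.
split.
- by apply/asboolP; apply: integral1.
- by move=> x y /asboolP hx /asboolP hy; apply/asboolP; apply: integral_sub.
- by move=> x y /asboolP hx /asboolP hy; apply/asboolP; apply: integral_mul.
Qed.

HB.instance Definition _ :=
  GRing.isSubringClosed.Build K algebraicInteger algebraicInteger_subring.

Definition integers : Type := {x : K | algebraicInteger x}.

HB.instance Definition _ := SubChoice.on integers.
HB.instance Definition _ := [SubChoice_isSubComNzRing of integers by <:].

(* [idealr_closed] requires 1 \notin P, so these are proper ideals. *)
Definition nonzeroPrimes : set (set integers) :=
  [set P : set integers | [/\ idealr_closed (mem P), prime_idealr_closed (mem P)
             & P != [set 0]]].

Definition idealCoset (P : set integers) (x : integers) : set integers :=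
  [set x + y | y in P].

(* The number of cosets of P.  For infinite index [fset_set] would return the
   empty set and the norm would be 0; nonzero ideals have finite index. *)
Definition absNorm (P : set integers) : nat :=
  #|` fset_set (range (idealCoset P))|%fset.

End RingOfIntegers.

Arguments nonzeroPrimes K : clear implicits.

(* The usual topology and complex differentiation on R[i]: the library provides
   them on R[i]^o. *)
HB.instance Definition _ (R : realType) := NormedModule.copy R[i] R[i]^o.

Section EulerProduct.
Variable R : realType.

Definition expC (z : R[i]) : R[i] :=
  (expR (complex.Re z))%:C * (cos (complex.Im z) +i* sin (complex.Im z)).

(* n ^ s := exp (s log n), for n > 0. *)
Definition natpowC (n : nat) (s : R[i]) : R[i] := expC (s * (ln n%:R)%:C).

(* Analytic on an arbitrary set D: complex differentiable on some open set
   containing D. *)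
Definition analyticOn (D : set R[i]) (f : R[i] -> R[i]) : Prop :=
  exists2 U : set R[i], open U /\ D `<=` U & forall z, U z -> derivable f z 1.

Variables (K : fieldExtType rat) (d : nat).
Variable alpha : nonzeroPrimes K -> 'I_d -> R[i].

Definition eulerFactor (s : R[i]) (P : nonzeroPrimes K) : R[i] :=
  (\prod_(j < d) (1 - alpha P j * natpowC (absNorm (val P)) (- s)))^-1.

(* The product over all primes, as the limit along the directed set of finite
   sets of primes; it exists for Re s > 1, by absolute convergence. *)
Definition eulerProduct (s : R[i]) : R[i] :=
  lim ((fun A : {fset nonzeroPrimes K} => \prod_(P <- A) eulerFactor s P)
         @ totally).

(* Finitely many primes have norm <= x, so [fset_set] is that set of primes. *)
Definition partialEulerProduct (s : R[i]) (x : R) : R[i] :=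
  \prod_(P <- fset_set [set P : nonzeroPrimes K | (absNorm (val P))%:R <= x])
    eulerFactor s P.

End EulerProduct.

(* Main.v *)
(** Write log L as the Dirichlet series sum a_n n^-s plus the contribution of the
    proper prime powers, which converges absolutely for Re s > 1/2.  At most
    [K : Q] primes have a given norm (the residues modulo g primes of norm N
    account for N^g of the at most N^[K : Q] classes modulo N), so the a_n are
    bounded.  Since L is nonvanishing and differentiable on Re s = 1, the series
    sum a_n n^-s extends continuously to that line and the extension is Lipschitz
    at each point of it.

    It remains to prove a Tauberian theorem: under these conditions the series
    converges at a boundary point s to its boundary value.  Subtracting the value
    from the first coefficient, one may assume that it is 0.  Only boundary values
    are used, hence no contour integration: the sharp partial sums are compared
    with partial sums smoothed by a band-limited step function W(l u), whose error
    is O(1 / (1 + l^2 u^2)), so that the comparison costs O(1 / l).  The smoothed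
    sum is a Fourier integral over [0, 1] of bounded functions, because division
    by the frequency t is absorbed by the Lipschitz bound at t = 0, and therefore
    tends to 0 by the Riemann-Lebesgue lemma. *)

Require Import Defs.
From mathcomp Require Import all_boot all_order all_algebra all_field.
From mathcomp Require Import finmap complex.
From mathcomp Require Import all_classical all_reals all_analysis.
From mathcomp Require Import summability measurable_realfun.
From mathcomp Require Import ring lra zify.

Set Implicit Arguments.
Unset Strict Implicit.
Unset Printing Implicit Defensive.

Import Order.TTheory GRing.Theory Num.Theory.
Import numFieldNormedType.Exports.

Local Open Scope classical_set_scope.
Local Open Scope ring_scope.
Local Open Scope complex_scope.

(** * Integration on the unit interval *)

Section Integral01.
Variable R : realType.
Implicit Types f g : R -> R.
Notation mu := (@lebesgue_measure R).

Definition I01 f : R := \int[mu]_(x in `]0, 1[) f x.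

Definition reg f :=
  {in `]0, 1[, continuous f} /\ exists M, {in `]0, 1[, forall t, `|f t| <= M}.

Lemma reg_integrable f : reg f -> mu.-integrable `]0, 1[ (EFin \o f).
Proof.
move=> [cf [M fM]]; apply: measurable_bounded_integrable => //=.
- by rewrite lebesgue_measure_itv /= lte_fin ltr01 -EFinB ltry.
- by apply: open_continuous_measurable_fun => // x; rewrite inE => /cf.
- exists M; split; first exact: num_real.
  by move=> x Mx y /= y01; rewrite (le_trans _ (ltW Mx))// fM.
Qed.

Lemma reg_cont f M : continuous f -> {in `]0, 1[, forall t, `|f t| <= M} ->
  reg f.
Proof. by move=> cf fM; split; [move=> x _; exact: cf|exists M]. Qed.

Lemma reg_cst c : reg (fun=> c).
Proof. by apply: (@reg_cont _ `|c|) => //; exact: cst_continuous. Qed.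

Lemma regD f g : reg f -> reg g -> reg (fun t => f t + g t).
Proof.
move=> [cf [M fM]] [cg [N gN]]; split.
  by move=> x x01; apply: cvgD; [exact: cf|exact: cg].
exists (M + N) => t t01; rewrite (le_trans (ler_normD _ _))//.
by rewrite lerD// ?fM ?gN.
Qed.

Lemma regM f g : reg f -> reg g -> reg (fun t => f t * g t).
Proof.
move=> [cf [M fM]] [cg [N gN]]; split.
  by move=> x x01; apply: cvgM; [exact: cf|exact: cg].
exists (M * N) => t t01; rewrite normrM.
by rewrite ler_pM// ?fM ?gN.
Qed.

Lemma regZ c f : reg f -> reg (fun t => c * f t).
Proof. exact/regM/reg_cst. Qed.

Lemma regB f g : reg f -> reg g -> reg (fun t => f t - g t).
Proof.
move=> rf rg; have := regD rf (regZ (-1) rg).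
by congr reg; apply/funext => t; rewrite mulN1r.
Qed.

Lemma I01D f g : reg f -> reg g -> I01 (fun t => f t + g t) = I01 f + I01 g.
Proof. by move=> rf rg; rewrite /I01 RintegralD//; exact: reg_integrable. Qed.

Lemma I01B f g : reg f -> reg g -> I01 (fun t => f t - g t) = I01 f - I01 g.
Proof. by move=> rf rg; rewrite /I01 RintegralB//; exact: reg_integrable. Qed.

Lemma I01Z c f : reg f -> I01 (fun t => c * f t) = c * I01 f.
Proof. by move=> rf; rewrite /I01 RintegralZl//; exact: reg_integrable. Qed.

Lemma eq_I01 f g : {in `]0, 1[, f =1 g} -> I01 f = I01 g.
Proof. by move=> fg; apply: eq_Rintegral => x; rewrite inE => /fg. Qed.

Lemma eq_reg f g : {in `]0, 1[, f =1 g} -> reg f -> reg g.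
Proof.
move=> fg [cf [M fM]]; split; last by exists M => t t01; rewrite -fg// fM.
move=> x x01; have := cf _ x01; rewrite /continuous_at -fg// => cfx.
apply: cvg_trans cfx; apply: near_eq_cvg.
have : \forall y \near x, y \in `]0, 1[.
  by apply: near_in_itvoo.
by apply: filterS => y /fg ->.
Qed.

Lemma I01_le M f : reg f -> {in `]0, 1[, forall t, `|f t| <= M} ->
  `|I01 f| <= M.
Proof.
move=> rf fM; rewrite /I01.
apply: le_trans.
  by apply: le_normr_Rintegral => //; exact: reg_integrable.
have rn : mu.-integrable `]0, 1[ (EFin \o (fun t => `|f t|)).
  by have := integrable_abse (reg_integrable rf).
have rM : mu.-integrable `]0, 1[ (EFin \o (fun=> M)).
  by apply: reg_integrable; exact: reg_cst.
apply: (@le_trans _ _ (\int[mu]_(x in `]0, 1[) M)).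
  by apply: le_Rintegral => // x xI; exact: fM.
rewrite Rintegral_cst//. rewrite [X in fine X]lebesgue_measure_itv /= lte_fin ltr01.
by rewrite -EFinB /= subr0 mulr1.
Qed.

Lemma I01_FTC (f F : R -> R) : (forall x : R, is_derive x (1 : R) F (f x)) ->
  continuous f -> I01 f = F 1 - F 0.
Proof.
move=> dF cf.
have cF : continuous F.
  by move=> x; apply/differentiable_continuous/derivable1_diffP/ex_derive.
rewrite /I01 Rintegral_itv_bndo_bndc; last first.
  apply: (@integrableS _ _ _ mu `[0, 1]%classic) => //.
    by apply: subset_itv; rewrite bnd_simp.
  apply: continuous_compact_integrable; first exact: segment_compact.
  exact: continuous_subspaceT.
rewrite Rintegral_itv_obnd_cbnd; last first.
  apply: (@integrableS _ _ _ mu `[0, 1]%classic) => //.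
    by apply: subset_itv; rewrite bnd_simp.
  apply: continuous_compact_integrable; first exact: segment_compact.
  exact: continuous_subspaceT.
rewrite /Rintegral (@continuous_FTC2 _ f F)//.
- exact: continuous_subspaceT.
- split; last 2 first.
  + exact/cvg_at_right_filter/cF.
  + exact/cvg_at_left_filter/cF.
  by move=> x _; apply: ex_derive.
- by move=> x _; rewrite derive1E; apply: derive_val.
Qed.

End Integral01.

Section RealDerivatives.
Variable R : realType.
Implicit Types (f g : R -> R) (x a b c : R).
Notation D1 f x a := (is_derive x (1 : R) f a).

Lemma derD f g x a b : D1 f x a -> D1 g x b -> D1 (fun t => f t + g t) x (a + b).
Proof. by move=> fa gb; exact: is_deriveD. Qed.

Lemma derB f g x a b : D1 f x a -> D1 g x b -> D1 (fun t => f t - g t) x (a - b).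
Proof. by move=> fa gb; exact: is_deriveB. Qed.

Lemma derM f g x a b : D1 f x a -> D1 g x b ->
  D1 (fun t => f t * g t) x (f x * b + g x * a).
Proof. by move=> fa gb; exact: is_deriveM. Qed.

Lemma der_cst c x : D1 (fun=> c) x 0.
Proof. exact: (@is_derive_cst _ R^o R^o). Qed.

Lemma der_id x : D1 (fun t => t) x 1.
Proof. exact: (@is_derive_id _ R^o). Qed.

Lemma der_comp f g x a b : D1 g x b -> D1 f (g x) a ->
  D1 (fun t => f (g t)) x (a * b).
Proof. by move=> gb fa; exact: is_derive1_comp. Qed.

Lemma der_sin g x b : D1 g x b -> D1 (fun t => sin (g t)) x (cos (g x) * b).
Proof. by move=> gb; apply: (@der_comp sin). Qed.

Lemma der_cos g x b : D1 g x b -> D1 (fun t => cos (g t)) x (- sin (g x) * b).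
Proof. by move=> gb; apply: (@der_comp cos). Qed.

Lemma der_eq f x a b : D1 f x a -> a = b -> D1 f x b.
Proof. by move=> fa <-. Qed.

Lemma der_continuous f x a : D1 f x a -> {for x, continuous f}.
Proof.
by move=> fa; apply/differentiable_continuous/derivable1_diffP/ex_derive.
Qed.

Lemma der_quadratic f x c M :
  (forall h, `|f (x + h) - f x - h * c| <= M * h ^+ 2) -> D1 f x c.
Proof.
move=> fM.
have M0 : 0 <= M.
  have := fM 1; rewrite expr1n mulr1; exact: le_trans.
have fc : h^-1 *: (f (h *: 1 + x) - f x) @[h --> 0^'] --> c.
  apply/cvgrPdist_le => e e0; near=> h.
  have h0 : h != 0 by near: h; exact: nbhs_dnbhs_neq.
  rewrite -(ler_pM2r (_ : 0 < `|h|)) ?normr_gt0// -normrM.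
  rewrite mulrBl /GRing.scale /= mulr1 (mulrC h^-1) mulfVK//.
  rewrite distrC addrC [c * _]mulrC addrC (addrC h x).
  apply: (le_trans (fM h)).
  rewrite -real_normK ?num_real// expr2 mulrA ler_wpM2r//.
  have hM : `|h| < e / (M + 1).
    near: h; apply: dnbhs0_lt; rewrite divr_gt0// ltr_wpDl//.
  apply: (@le_trans _ _ ((M + 1) * `|h|)); first by rewrite ler_wpM2r// lerDl.
  by rewrite mulrC -ler_pdivlMr ?ltr_wpDl// ltW.
apply: DeriveDef; first by apply/cvg_ex; exists c.
exact: cvg_lim.
Unshelve. all: by end_near.
Qed.

Lemma MVT_all f (f' : R -> R) x y : (forall z, D1 f z (f' z)) -> x < y ->
  exists2 z, x < z < y & f y - f x = f' z * (y - x).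
Proof.
move=> df xy; have [|z zxy ->] := MVT xy (fun z _ => df z).
  by apply: continuous_subspaceT => z; exact: der_continuous (df z).
by exists z => //; move: zxy; rewrite in_itv.
Qed.

Lemma der_lipschitz f (f' : R -> R) M : (forall z, D1 f z (f' z)) ->
  (forall z, `|f' z| <= M) -> forall x y, `|f x - f y| <= M * `|x - y|.
Proof.
move=> df f'M; suff H x y : x < y -> `|f y - f x| <= M * `|y - x|.
  move=> x y; have [xy|yx|->] := ltgtP x y; last by rewrite !subrr normr0 mulr0.
    by rewrite distrC (distrC x) H.
  exact: H.
by move=> xy; have [z _ ->] := MVT_all df xy; rewrite normrM ler_wpM2r.
Qed.

Lemma sin_lipschitz x y : `|sin x - sin y| <= `|x - y|.
Proof.
rewrite -[leRHS]mul1r; apply: (@der_lipschitz sin cos) => z.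
exact: cos_max.
Qed.

Lemma cos_lipschitz x y : `|cos x - cos y| <= `|x - y|.
Proof.
rewrite -[leRHS]mul1r; apply: (@der_lipschitz cos (fun z => - sin z)) => z.
by rewrite normrN sin_max.
Qed.

Lemma sin_le_norm x : `|sin x| <= `|x|.
Proof. by have := sin_lipschitz x 0; rewrite sin0 !subr0. Qed.

Lemma sin_taylor1 x h : `|sin (x + h) - sin x - h * cos x| <= h ^+ 2.
Proof.
pose f t := sin (x + t) - t * cos x.
have df z : D1 f z (cos (x + z) - cos x).
  apply: (der_eq (derB (der_sin (derD (der_cst x z) (der_id z)))
    (derM (der_id z) (der_cst (cos x) z)))).
  by rewrite /=; ring.
have b z : `|cos (x + z) - cos x| <= `|z|.
  by rewrite (le_trans (cos_lipschitz _ _))// addrAC subrr add0r.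
have -> : sin (x + h) - sin x - h * cos x = f h - f 0.
  by rewrite /f addr0; ring.
have [h0|h0|->] := ltgtP h 0; last by rewrite subrr normr0 expr0n.
- have [z /andP[hz z0]] := MVT_all df h0; rewrite distrC => ->.
  rewrite normrM -real_normK ?num_real// expr2 sub0r normrN ler_wpM2r//.
  by rewrite (le_trans (b z))// !ltr0_norm// lerN2 ltW.
- have [z /andP[z0 zh] ->] := MVT_all df h0.
  rewrite normrM -real_normK ?num_real// expr2 subr0 ler_wpM2r//.
  by rewrite (le_trans (b z))// !gtr0_norm// ltW.
Qed.

End RealDerivatives.

(** * The Bohman kernel and a band-limited smoothed step *)

Section BohmanKernel.
Variable R : realType.
Implicit Types (f g : R -> R) (u x y t : R).
Notation D1 f x a := (is_derive x (1 : R) f a).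

Lemma continuous_sinM u : continuous (fun t : R => sin (u * t)).
Proof.
by move=> t; apply: (der_continuous (der_sin (derM (der_cst u t) (der_id t)))).
Qed.

Lemma continuous_cosM u : continuous (fun t : R => cos (u * t)).
Proof.
by move=> t; apply: (der_continuous (der_cos (derM (der_cst u t) (der_id t)))).
Qed.

Lemma reg_sin u : reg (fun t : R => sin (u * t)).
Proof.
by apply: (@reg_cont _ _ 1) => [|t _]; [exact: continuous_sinM|exact: sin_max].
Qed.

Lemma reg_cos u : reg (fun t : R => cos (u * t)).
Proof.
by apply: (@reg_cont _ _ 1) => [|t _]; [exact: continuous_cosM|exact: cos_max].
Qed.

Lemma reg_div f M : {in `]0, 1[, continuous f} ->
  {in `]0, 1[, forall t, `|f t| <= M * t} -> reg (fun t => f t / t).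
Proof.
move=> cf fM; split=> [t t01|].
  have t0 : t != 0 by rewrite gt_eqF// (itvP t01).
  by apply: cvgM; [exact: cf|apply: cvgV => //; exact: cvg_id].
exists M => t t01; have t0 : 0 < t by rewrite (itvP t01).
by rewrite normrM normfV (gtr0_norm t0) ler_pdivrMr// fM.
Qed.

Lemma norm_divr_le (M a t : R) : 0 < t -> `|a| <= M * t -> `|a / t| <= M.
Proof. by move=> t0 aM; rewrite normrM normfV (gtr0_norm t0) ler_pdivrMr. Qed.

Lemma reg_sin_div u : reg (fun t : R => sin (u * t) / t).
Proof.
apply: (@reg_div _ `|u|) => [t _|t t01]; first exact: continuous_sinM.
rewrite (le_trans (sin_le_norm _))// normrM (ger0_norm (_ : 0 <= t))//.
by rewrite ltW// (itvP t01).
Qed.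

(* Bohman's window.  It is the autocorrelation of a half-period cosine, so its
   cosine transform bohmanK is nonnegative, and it is smooth enough for bohmanK
   to decay like u^-4. *)
Definition bohman t : R := (1 - t) * cos (pi * t) + sin (pi * t) / pi.

Lemma continuous_bohman : continuous bohman.
Proof.
move=> t; apply: cvgD.
  apply: cvgM; last exact: continuous_cosM.
  by apply: cvgB; [exact: cvg_cst|exact: cvg_id].
by apply: cvgM; [exact: continuous_sinM|exact: cvg_cst].
Qed.

Lemma bohman_le2 : {in `]0, 1[, forall t, `|bohman t| <= 2}.
Proof.
move=> t /[!in_itv]/= /andP[t0 t1].
rewrite /bohman (le_trans (ler_normD _ _))// (_ : 2 = 1 * 1 + 1 * 1)//; last ring.
rewrite lerD// normrM ler_pM// ?cos_max ?sin_max//.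
  by rewrite ger0_norm; lra.
by rewrite normfV gtr0_norm ?pi_gt0// invf_le1 ?pi_gt0// (le_trans _ (@pi_ge2 R))// ler1n.
Qed.

Lemma reg_bohman : reg bohman.
Proof. exact: reg_cont continuous_bohman bohman_le2. Qed.

Definition bohmanW u : R := 2 * I01 (fun t => bohman t * (sin (u * t) / t)).
Definition bohmanK u : R := 2 * I01 (fun t => bohman t * cos (u * t)).

Lemma der_bohmanW u : D1 bohmanW u (bohmanK u).
Proof.
apply: (@der_quadratic _ _ _ _ 4) => h.
have r1 := regM reg_bohman (reg_sin_div (u + h)).
have r2 := regM reg_bohman (reg_sin_div u).
have r3 := regM reg_bohman (reg_cos u).
rewrite /bohmanW /bohmanK mulrCA -!mulrBr -I01Z// -!I01B//; last 2 first.
- exact: regB.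
- exact: regZ.
rewrite normrM ger0_norm// (_ : 4 * _ = 2 * (2 * h ^+ 2)); last ring.
rewrite ler_wpM2l//; apply: I01_le.
  by apply: regB; [exact: regB|exact: regZ].
move=> t t01; have t0 : 0 < t by rewrite (itvP t01).
have -> : bohman t * (sin ((u + h) * t) / t) - bohman t * (sin (u * t) / t) -
    h * (bohman t * cos (u * t)) = bohman t *
    ((sin (u * t + h * t) - sin (u * t) - h * t * cos (u * t)) / t).
  by rewrite (mulrDl u h t); field; rewrite gt_eqF.
rewrite normrM ler_pM ?bohman_le2//.
apply: norm_divr_le => //; rewrite (le_trans (sin_taylor1 _ _))//.
rewrite exprMn ler_wpM2l ?sqr_ge0// expr2 ger_pMl// ltW// (itvP t01)//.
Qed.

Lemma bohmanKE u : u != 0 -> u ^+ 2 != pi ^+ 2 ->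
  bohmanK u = 4 * pi ^+ 2 * (1 + cos u) / (u ^+ 2 - pi ^+ 2) ^+ 2.
Proof.
move=> u0 upi.
have [a0 b0] : u - pi != 0 /\ u + pi != 0.
  by apply/andP; rewrite -negb_or -mulf_eq0 -subr_sqr subr_eq0.
pose F t := bohman t * sin (u * t) / u + (pi / (2 * u)) *
   ((1 - t) * sin ((u - pi) * t) / (u - pi) - cos ((u - pi) * t) / (u - pi) ^+ 2
   - ((1 - t) * sin ((u + pi) * t) / (u + pi) - cos ((u + pi) * t) / (u + pi) ^+ 2)).
have pi0 : pi != 0 :> R by rewrite gt_eqF// pi_gt0.
have dlin c t : D1 (fun t => c * t) t c.
  by apply: (der_eq (derM (der_cst c t) (der_id t))); rewrite /=; ring.
have dB t : D1 (fun t => 1 - t) t (-1).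
  by apply: (der_eq (derB (der_cst 1 t) (der_id t))); rewrite /=; ring.
have dF t : D1 F t (bohman t * cos (u * t)).
  have dk : D1 bohman t (- pi * (1 - t) * sin (pi * t)).
    apply: (der_eq (derD (derM (dB t) (der_cos (dlin pi t)))
      (derM (der_sin (dlin pi t)) (der_cst pi^-1 t)))).
    by rewrite /=; move: pi0; move: (pi : R) => p p0; field.
  have d1 c : D1 (fun t => (1 - t) * sin (c * t) / c - cos (c * t) / c ^+ 2) t
     ((1 - t) * cos (c * t) * (c / c) + sin (c * t) * (c / c ^+2 - 1 / c)).
    apply: (der_eq (derB (derM (derM (dB t) (der_sin (dlin c t))) (der_cst c^-1 t))
      (derM (der_cos (dlin c t)) (der_cst (c ^+ 2)^-1 t)))).
    by rewrite /=; ring.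
  apply: (der_eq (derD (derM (derM dk (der_sin (dlin u t))) (der_cst u^-1 t))
    (derM (der_cst (pi / (2 * u)) t) (derB (d1 (u - pi)) (d1 (u + pi)))))).
  have -> : (u - pi) * t = u * t - pi * t by ring.
  have -> : (u + pi) * t = u * t + pi * t by ring.
  rewrite /= cosB cosD.
  move: a0 b0; move: (pi : R) (bohman t) => p k a0 b0; field.
  by rewrite u0 a0 b0.
rewrite /bohmanK (I01_FTC dF); last first.
  by move=> t; apply: cvgM; [exact: continuous_bohman|exact: continuous_cosM].
rewrite /F /bohman !mulr1 !mulr0 sin0 cos0 subrr subr0 cospi sinpi.
rewrite cosB cosD cospi sinpi.
move: a0 b0 upi pi0; move: (pi : R) => p a0 b0 upi p0; field.
by rewrite u0 b0 a0 p0 subr_eq0 upi.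
Qed.

Lemma bohmanW_odd u : bohmanW (- u) = - bohmanW u.
Proof.
rewrite /bohmanW -mulrN -[X in _ = 2 * X]mulN1r -(I01Z (-1)); last first.
  exact: regM reg_bohman (reg_sin_div u).
by congr (_ * _); apply: eq_I01 => t _; rewrite mulNr sinN; ring.
Qed.

End BohmanKernel.

Section SmoothedStep.
Variable R : realType.
Implicit Types (f g : R -> R) (u x y t : R).
Notation D1 f x a := (is_derive x (1 : R) f a).

Lemma nondecreasing_MVT f (f' : R -> R) x y : x <= y ->
  (forall z, x <= z <= y -> D1 f z (f' z)) ->
  (forall z, x < z < y -> 0 <= f' z) -> f x <= f y.
Proof.
move=> xy df f'0; rewrite -subr_ge0.
have [xy'|yx] := ltrP x y; last first.
  by rewrite (le_anti (_ : y <= x <= y)) ?subrr// yx.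
have d z : z \in `]x, y[ -> D1 f z (f' z).
  by rewrite in_itv/= => /andP[xz zy]; apply: df; rewrite !ltW.
have [|z zxy ->] := MVT xy' d.
  apply: derivable_within_continuous => z /[!in_itv]/= zxy.
  have dz := df z zxy; exact: ex_derive.
by rewrite mulr_ge0 ?subr_ge0// f'0//; move: zxy; rewrite in_itv.
Qed.

Local Notation W := (@bohmanW R).
Local Notation K := (@bohmanK R).

Lemma pi_lt4 : pi < 4 :> R.
Proof. by have := @pihalf_lt2 R; lra. Qed.

Lemma bohmanW0 : W 0 = 0.
Proof. by have := bohmanW_odd (0 : R); rewrite oppr0; lra. Qed.

Lemma bohmanK_le4 u : `|K u| <= 4.
Proof.
rewrite /bohmanK normrM ger0_norm// (_ : 4 = 2 * 2)//; last ring.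
rewrite ler_wpM2l//; apply: I01_le; first exact: (regM (reg_bohman R) (reg_cos u)).
move=> t t01; rewrite normrM -[2]mulr1 ler_pM// ?cos_max//.
exact: bohman_le2.
Qed.

Lemma bohmanK_gt0 u : 0 < u -> u != pi -> 0 <= K u.
Proof.
move=> u0 upi; have un0 : u != 0 by rewrite gt_eqF.
rewrite bohmanKE//; last by rewrite eqrXn2// ?pi_ge0// ltW.
apply: divr_ge0; last exact: sqr_ge0.
apply: mulr_ge0; last by have := cos_geN1 u; lra.
by apply: mulr_ge0; last exact: sqr_ge0.
Qed.

Lemma bohmanW_gt0 : 0 < W pi.
Proof.
apply: (@lt_le_trans _ _ (W 1)).
  rewrite -subr_gt0 -[X in W 1 - X]bohmanW0 in |- *.
  have [z /andP[z0 z1] ] := MVT_all (@der_bohmanW R) ltr01.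
  rewrite bohmanW0 !subr0 mulr1 => ->.
  have pi2 := @pi_ge2 R.
  have c1 : 0 < cos z.
    by apply: cos_gt0_pihalf; apply/andP; split; lra.
  have zn0 : z != 0 by rewrite gt_eqF.
  have zpi : z ^+ 2 != pi ^+ 2.
    by rewrite eqrXn2// ?pi_ge0 ?(ltW z0)// lt_eqF//; lra.
  rewrite bohmanKE// divr_gt0 ?exprn_even_gt0// ?subr_eq0//.
  by rewrite mulr_gt0 ?mulr_gt0 ?exprn_gt0 ?pi_gt0// addr_gt0.
have pi2 := @pi_ge2 R.
apply: (nondecreasing_MVT (f' := K)); first lra.
  by move=> *; exact: der_bohmanW.
move=> z /andP[z1 zpi]; apply: bohmanK_gt0; first lra.
by rewrite lt_eqF.
Qed.

Lemma bohmanW_nondecreasing x y : pi <= x -> x <= y -> W x <= W y.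
Proof.
move=> pix xy; have pi2 := @pi_ge2 R.
apply: (nondecreasing_MVT (f' := K)) => //.
  by move=> *; exact: der_bohmanW.
move=> z /andP[z1 zpi]; apply: bohmanK_gt0; first lra.
by rewrite gt_eqF//; lra.
Qed.

Lemma bohmanK_decay u : 8 <= u -> K u <= 256 / u ^+ 3.
Proof.
move=> u8; have := pi_lt4; have pi2 := @pi_ge2 R => pi4.
have p16 : pi ^+ 2 <= 16 :> R.
  by rewrite (_ : 16 = 4 ^+ 2); [rewrite lerXn2r// ?nnegrE; lra|ring].
have u64 : 64 <= u ^+ 2.
  by rewrite (_ : 64 = 8 ^+ 2); [rewrite lerXn2r// ?nnegrE; lra|ring].
have u0 : 0 < u by lra.
have du : u ^+ 2 / 2 <= u ^+ 2 - pi ^+ 2 by lra.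
have d0 : 0 < u ^+ 2 - pi ^+ 2 by lra.
have un0 : u != 0 by rewrite gt_eqF.
rewrite bohmanKE//; last by rewrite gt_eqF//; lra.
apply: (@le_trans _ _ (128 / (u ^+ 2 / 2) ^+ 2)).
  apply: ler_pM.
  - apply: mulr_ge0; last by have := cos_geN1 u; lra.
    by apply: mulr_ge0; last exact: sqr_ge0.
  - by rewrite invr_ge0 sqr_ge0.
  - rewrite (_ : 128 = 4 * 16 * 2); last ring.
    have c1 := cos_geN1 u; have c2 := cos_le1 u.
    apply: ler_pM; [|by lra| |by lra].
      by apply: mulr_ge0; last exact: sqr_ge0.
    by rewrite ler_wpM2l.
  - by rewrite lef_pV2 ?posrE ?exprn_gt0//; [rewrite lerXn2r ?nnegrE//; lra|lra].
rewrite (_ : 128 / _ = 512 / u * u ^- 3); last first.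
  by field; rewrite gt_eqF.
rewrite ler_wpM2r//; first by rewrite invr_ge0 exprn_ge0// ltW.
by rewrite ler_pdivrMr//; lra.
Qed.

Lemma bohmanW_decay x y : 8 <= x -> x <= y -> W y + 128 / y ^+ 2 <= W x + 128 / x ^+ 2.
Proof.
move=> x8 xy.
rewrite -lerN2.
pose f t := - (W t + 128 / t ^+ 2).
apply: (@nondecreasing_MVT f (fun t => - (K t - 256 / t ^+ 3))) => //.
  move=> z /andP[xz zy]; have z0 : z != 0 by rewrite gt_eqF//; lra.
  have d2 : D1 (fun t => t ^+ 2) z (2 * z).
    by apply: (der_eq (derM (der_id z) (der_id z))) => /=; ring.
  have dV : D1 (fun t => (t ^+ 2)^-1) z (- (z ^+ 2) ^- 2 * (2 * z)).
    by apply: is_deriveV; rewrite ?expf_neq0.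
  have := derM (der_cst (-1) z) (derD (der_bohmanW z) (derM (der_cst 128 z) dV)).
  rewrite (_ : (fun _ => _) = f); last first.
    by apply/funext => t; rewrite /f mulN1r.
  by move=> /der_eq; apply => /=; field.
move=> z /andP[xz zy]; rewrite oppr_ge0 subr_le0 bohmanK_decay//; lra.
Qed.

Lemma bohmanW_limit : exists2 w : R, 0 < w &
  forall u, 8 <= u -> w - 128 / u ^+ 2 <= W u <= w.
Proof.
pose E := [set W y | y in [set y | 8 <= y]].
have E8 : E (W 8) by exists 8 => /=.
have pi4 := pi_lt4.
have uE : has_ubound E.
  exists (W 8 + 128 / 8 ^+ 2) => _ [y /= y8 <-].
  have := bohmanW_decay (lexx 8) y8; apply: le_trans.
  by rewrite lerDl divr_ge0// sqr_ge0.
exists (sup E).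
  apply: (@lt_le_trans _ _ (W 8)); last exact: ub_le_sup.
  by apply: (lt_le_trans bohmanW_gt0); apply: bohmanW_nondecreasing => //; lra.
move=> u u8; apply/andP; split; last by apply: ub_le_sup => //; exists u.
rewrite lerBlDr; apply: ge_sup; first by exists (W 8).
move=> _ [y /= y8 <-].
have u2 : 0 <= 128 / u ^+ 2 by rewrite divr_ge0// sqr_ge0.
have [uy|yu] := leP u y.
  apply: le_trans (bohmanW_decay u8 uy).
  by rewrite lerDl divr_ge0// sqr_ge0.
apply: (@le_trans _ _ (W u)); last by rewrite lerDl.
by apply: bohmanW_nondecreasing; lra.
Qed.

Lemma smoothed_step : exists (k W : R -> R) (B : R),
  [/\ reg k, forall x y, W y - W x =
        I01 (fun t => k t * ((sin (y * t) - sin (x * t)) / t))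
    & forall u, `|W u - (0 <= u)%R%:R| <= B / (1 + u ^+ 2)].
Proof.
have [w w0 wW] := bohmanW_limit.
pose V u := (W u + w) / (2 * w).
have wn0 : w != 0 by rewrite gt_eqF.
have lipW u : `|W u| <= 4 * `|u|.
  have := der_lipschitz (@der_bohmanW R) bohmanK_le4 u 0.
  by rewrite bohmanW0 !subr0.
exists (fun t => w^-1 * bohman t), V, (65 * (2 + 16 / w) + 128 / w); split.
- exact/regZ/reg_bohman.
- move=> x y; rewrite (_ : V y - V x = w^-1 * ((W y - W x) / 2)); last first.
    by rewrite /V; field.
  have r u := regM (reg_bohman R) (reg_sin_div u).
  rewrite /bohmanW -mulrBr mulrAC divff ?mul1r ?pnatr_eq0// -I01B// -I01Z; last first.
    exact: (regB (r y) (r x)).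
  by apply: eq_I01 => t _; ring.
have far u : 8 <= `|u| -> 64 / w / u ^+ 2 <= (65 * (2 + 16 / w) + 128 / w) / (1 + u ^+ 2).
  move=> u8; have u64 : 64 <= u ^+ 2.
    rewrite -real_normK ?num_real//.
    by rewrite (_ : 64 = 8 ^+ 2); [rewrite lerXn2r// ?nnegrE; lra|ring].
  rewrite ler_pdivrMr; last lra.
  rewrite mulrAC ler_pdivlMr; last lra.
  have w1 : 0 < w^-1 by rewrite invr_gt0.
  have w2 : 0 < w^-1 * u ^+ 2 by rewrite mulr_gt0//; lra.
  have : w^-1 <= w^-1 * u ^+ 2 by rewrite ler_pMr//; lra.
  have : 0 <= 65 * (2 + 16 / w) * u ^+ 2.
    by rewrite mulr_ge0 ?sqr_ge0//; lra.
  nra.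
move=> u; have [u8|u8] := leP 8 `|u|.
  apply: le_trans (far u u8).
  have [u0|u0] := leP 0 u.
    rewrite ger0_norm// in u8; have /andP[h1 h2] := wW u u8.
    rewrite (_ : V u - _ = - ((w - W u) / (2 * w))); last by rewrite /V/=; field.
    rewrite normrN ger0_norm; last by rewrite divr_ge0 ?subr_ge0// mulr_ge0// ltW.
    rewrite ler_pdivrMr ?mulr_gt0// (_ : _ * (2 * w) = 128 / u ^+ 2); last first.
      by field; rewrite wn0 gt_eqF//; lra.
    by lra.
  rewrite ltr0_norm// in u8; have /andP[h1 h2] := wW (- u) u8.
  rewrite bohmanW_odd sqrrN in h1 h2.
  rewrite (_ : V u - _ = (w + W u) / (2 * w)); last by rewrite /V/=; field.
  rewrite ger0_norm; last by apply: divr_ge0; lra.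
  rewrite ler_pdivrMr ?mulr_gt0// (_ : _ * (2 * w) = 128 / u ^+ 2); last first.
    by field; rewrite wn0 lt_eqF//; lra.
  by lra.
have u64 : u ^+ 2 <= 64.
  rewrite -real_normK ?num_real//.
  by rewrite (_ : 64 = 8 ^+ 2); [rewrite lerXn2r// ?nnegrE; lra|ring].
have w1 : 0 < w^-1 by rewrite invr_gt0.
rewrite ler_pdivlMr; last by have := sqr_ge0 u; lra.
apply: (@le_trans _ _ ((2 + 16 / w) * 65)); last by lra.
apply: ler_pM => //; [by have := sqr_ge0 u; lra| |by lra].
have -> : V u - (0 <= u)%R%:R = W u / (2 * w) + (1 / 2 - (0 <= u)%R%:R).
  by rewrite /V; field.
rewrite (le_trans (ler_normD _ _))// addrC lerD//.
  by case: (0 <= u)%R => /=; rewrite ?subr0 ler_norml; apply/andP; split; lra.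
rewrite normrM normfV (gtr0_norm (_ : 0 < 2 * w)) ?mulr_gt0//.
rewrite ler_pdivrMr ?mulr_gt0// (_ : _ * (2 * w) = 32); last by field.
by rewrite (le_trans (lipW u))//; lra.
Qed.

End SmoothedStep.

(** * The Riemann-Lebesgue lemma *)

Section RiemannLebesgue.
Variable R : realType.
Implicit Types (f g e E : R -> R) (x y t a b : R).
Notation D1 f x a := (is_derive x (1 : R) f a).
Notation mu := (@lebesgue_measure R).

Lemma compact_unif_cont f (K : set R) : compact K ->
  (forall x, K x -> {for x, continuous f}) -> forall eps, 0 < eps ->
  exists2 r, 0 < r & forall x y, K x -> `|y - x| < r -> `|f y - f x| <= eps.
Proof.
move=> /compact_near_coveringP cK cf eps eps0.
have /= H := cK R (0^'+) (fun r x => forall y, `|y - x| < r -> `|f y - f x| <= eps).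
have {}H : \forall r \near 0^'+, K `<=`
    (fun x => forall y, `|y - x| < r -> `|f y - f x| <= eps).
  apply: H => x Kx.
  have e2 : 0 < eps / 2 by rewrite divr_gt0.
  have /cvgrPdist_le/(_ _ e2) := cf x Kx.
  rewrite -nbhs_nearE => /nbhs_ballP[r /= r0 rf].
  near=> z d => y yz.
  have zx : `|x - z| < r / 2.
    near: z; by apply: nbhsx_ballx; exact: divr_gt0.
  have dr : d < r / 2.
    near: d; apply: nbhs_right_lt; exact: divr_gt0.
  have h1 : `|f x - f z| <= eps / 2.
    by apply: rf; rewrite /ball/= (lt_trans zx)// ltr_pdivrMr// ltr_pMr// ltr1n.
  have h2 : `|f x - f y| <= eps / 2.
    apply: rf; rewrite /ball/= -(subrKA z) (le_lt_trans (ler_normD _ _))//.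
    by rewrite distrC in yz; rewrite (splitr r) ltrD// (lt_trans yz).
  rewrite -(subrKA (f x)) (le_trans (ler_normD _ _))// (splitr eps) lerD//.
  by rewrite distrC.
near (0:R)^'+ => r; exists r => //.
move=> x y Kx; have : K `<=` (fun x => forall y, `|y - x| < r -> `|f y - f x| <= eps).
  by near: r.
by apply.
Unshelve. all: by end_near. Qed.

Lemma reg_itv_integrable f (i j : itv_bound R) : reg f ->
  (BRight 0 <= i)%O -> (j <= BLeft 1)%O -> mu.-integrable [set` Interval i j] (EFin \o f).
Proof.
move=> rf i0 j1; apply: integrableS (reg_integrable rf) => //.
exact: subset_itv.
Qed.

Lemma reg_itv_le f M a b (i j : bool) : reg f -> a <= b ->
  (BRight 0 <= BSide i a)%O -> (BSide j b <= BLeft 1)%O ->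
  (forall t, a <= t <= b -> 0 < t < 1 -> `|f t| <= M) ->
  `|\int[mu]_(x in [set` Interval (BSide i a) (BSide j b)]) f x| <= M * (b - a).
Proof.
move=> rf ab a0 b1 fM.
have fI := reg_itv_integrable rf a0 b1.
apply: le_trans.
  by apply: le_normr_Rintegral.
have bd t : [set` Interval (BSide i a) (BSide j b)] t -> `|f t| <= M.
  move=> tI; apply: fM.
    move: tI; rewrite /= itv_boundlr => /andP[h1 h2]; apply/andP; split.
      by move: h1; case: i {a0 fI} => //; rewrite bnd_simp// => /ltW.
    by move: h2; case: j {b1 fI} => //; rewrite bnd_simp// => /ltW.
  move: tI; rewrite /= itv_boundlr => /andP[h1 h2]; apply/andP; split.
    by have := le_trans a0 h1; rewrite bnd_simp.
  by have := le_trans h2 b1; rewrite bnd_simp.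
have icst : mu.-integrable [set` Interval (BSide i a) (BSide j b)] (EFin \o (fun=> M)).
  exact: reg_itv_integrable (reg_cst M) a0 b1.
apply: (@le_trans _ _ (\int[mu]_(x in [set` Interval (BSide i a) (BSide j b)]) M)).
  by apply: le_Rintegral => //; have := integrable_abse fI.
rewrite Rintegral_cst// [X in fine X]lebesgue_measure_itv /= lte_fin.
case: ltP => ab' //=.
by rewrite (le_anti (_ : b <= a <= b)) ?subrr// ab ab'.
Qed.

Lemma reg_itv_split f (i j : itv_bound R) x : reg f ->
  (BRight 0 <= i)%O -> (j <= BLeft 1)%O -> (i <= BRight x)%O -> (BRight x <= j)%O ->
  \int[mu]_(t in [set` Interval i j]) f t =
  \int[mu]_(t in [set` Interval i (BRight x)]) f t +
  \int[mu]_(t in [set` Interval (BRight x) j]) f t.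
Proof.
move=> rf i0 j1 ix xj; apply/eqP; rewrite addrC -subr_eq; apply/eqP.
by apply: Rintegral_itvB => //; exact: reg_itv_integrable.
Qed.

Lemma itv_FTC e E a b : (forall x, D1 E x (e x)) -> continuous e -> a <= b ->
  \int[mu]_(t in `]a, b]) e t = E b - E a.
Proof.
move=> dE ce; rewrite le_eqVlt => /predU1P[->|ab].
  by rewrite set_itvoc0 Rintegral_set0 subrr.
have cE : continuous E by move=> x; exact: der_continuous (dE x).
rewrite Rintegral_itv_obnd_cbnd; last first.
  apply: (@integrableS _ _ _ mu `[a, b]%classic) => //.
    by apply: subset_itv; rewrite bnd_simp.
  apply: continuous_compact_integrable; first exact: segment_compact.
  exact: continuous_subspaceT.
rewrite /Rintegral (@continuous_FTC2 _ e E)//.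
- exact: continuous_subspaceT.
- split; last 2 first.
  + exact/cvg_at_right_filter/cE.
  + exact/cvg_at_left_filter/cE.
  by move=> x _; apply: ex_derive.
- by move=> x _; rewrite derive1E; apply: derive_val.
Qed.

Definition oscillating (d : R) e E :=
  [/\ forall x, D1 E x (e x), continuous e, forall t, `|e t| <= 1
    & forall t, `|E t| <= d].

Lemma oscillating_piece f e E d eps M a b : reg f -> oscillating d e E ->
  0 < a -> a <= b -> b < 1 -> `|f a| <= M -> 
  (forall t, a <= t <= b -> `|f t - f a| <= eps) ->
  `|\int[mu]_(t in `]a, b]) (f t * e t)| <= eps * (b - a) + 2 * M * d.
Proof.
move=> rf [dE ce e1 Ed] a0 ab b1 faM feps.
have re : reg e by exact: reg_cont ce (fun t _ => e1 t).
have rg : reg (fun t => (f t - f a) * e t) by exact/regM/re/regB/reg_cst.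
have i0 : (BRight 0 <= BRight a)%O by rewrite bnd_simp ltW.
have j1 : (BRight b <= BLeft 1)%O by rewrite bnd_simp.
have -> : \int[mu]_(t in `]a, b]) (f t * e t) =
   \int[mu]_(t in `]a, b]) ((f t - f a) * e t) + f a * \int[mu]_(t in `]a, b]) e t.
  rewrite -RintegralZl//; last exact: reg_itv_integrable.
  rewrite -RintegralD//; try exact: reg_itv_integrable.
    by apply: eq_Rintegral => t _; ring.
  by apply: reg_itv_integrable => //; exact: regZ.
rewrite (le_trans (ler_normD _ _))// lerD//.
  apply: reg_itv_le => // t tab _.
  by rewrite normrM -[eps]mulr1 ler_pM// feps.
rewrite (itv_FTC dE)// normrM mulrAC (mulrC _ M) ler_pM//.
by rewrite (le_trans (ler_normB _ _))// mulr_natl mulr2n lerD.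
Qed.

Lemma riemann_lebesgue f eps : reg f -> 0 < eps ->
  exists2 d, 0 < d & forall e E, oscillating d e E ->
    `|I01 (fun t => f t * e t)| <= eps.
Proof.
move=> rf eps0; have [cf [M0 fM0]] := rf.
pose M := Num.max M0 1.
have M1 : 1 <= M by rewrite le_max lexx orbT.
have fM : {in `]0, 1[, forall t, `|f t| <= M}.
  by move=> t t01; rewrite (le_trans (fM0 t t01))// le_max lexx.
have M00 : 0 < M by lra.
pose eta := Num.min (eps / (8 * M)) (1 / 4).
have eta0 : 0 < eta by rewrite lt_min !divr_gt0// mulr_gt0.
have eta4 : eta <= 1 / 4 by rewrite ge_min lexx orbT.
have etaM : M * eta <= eps / 8.
  rewrite mulrC -ler_pdivlMr//; apply: (@le_trans _ _ (eps / (8 * M))).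
    by rewrite ge_min lexx.
  by rewrite invfM mulrA.
have [|r r0 rf'] := @compact_unif_cont f `[eta, 1 - eta]%classic
     (@segment_compact _ _ _) _ (eps / 4) (divr_gt0 eps0 (@ltr0n _ 4)).
  by move=> x /=; rewrite in_itv/= => /andP[x1 x2]; apply: cf; rewrite in_itv/=; lra.
pose N := (Num.truncn (r^-1)).+1.
have N0 : 0 < N%:R :> R by rewrite ltr0n.
pose h := (1 - 2 * eta) / N%:R.
have h0 : 0 < h by rewrite divr_gt0//; lra.
have hr : h < r.
  rewrite ltr_pdivrMr//; apply: (@le_lt_trans _ _ 1); first by lra.
  by rewrite -ltr_pdivrMl// mulr1 truncnS_gt.
pose d := eps / (8 * M * N%:R).
have d0 : 0 < d by rewrite divr_gt0// !mulr_gt0.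
exists d => // e E osc; have [dE ce e1 Ed] := osc.
have re : reg e by exact: reg_cont ce (fun t _ => e1 t).
have rg : reg (fun t => f t * e t) by exact: regM.
have hN : h * N%:R = 1 - 2 * eta by rewrite /h divfK// gt_eqF.
have jN (j : nat) : (j <= N)%N -> 0 <= j%:R * h <= 1 - 2 * eta.
  move=> jN; rewrite mulr_ge0 ?(ltW h0)//= -hN mulrC ler_wpM2l ?(ltW h0)//.
  by rewrite ler_nat.
have mid (j : nat) : (j <= N)%N ->
   `|\int[mu]_(t in `]eta, eta + j%:R * h]) (f t * e t)| <= j%:R * (eps / 4 * h + 2 * M * d).
  elim: j => [|j IH] jN'.
    by rewrite mul0r addr0 set_itvoc0 Rintegral_set0 normr0 mul0r.
  have /andP[j1 j2] := jN j.+1 jN'; have /andP[j3 j4] := jN j (ltnW jN').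
  have jS : j.+1%:R * h = j%:R * h + h by rewrite -natr1 mulrDl mul1r.
  rewrite (@reg_itv_split _ _ _ (eta + j%:R * h))//; last 4 first.
  - by rewrite bnd_simp ltW.
  - by rewrite bnd_simp; lra.
  - by rewrite bnd_simp; lra.
  - by rewrite bnd_simp; lra.
  have -> : j.+1%:R * (eps / 4 * h + 2 * M * d) =
      j%:R * (eps / 4 * h + 2 * M * d) + (eps / 4 * h + 2 * M * d).
    by rewrite -natr1 mulrDl mul1r.
  rewrite (le_trans (ler_normD _ _))//; apply: lerD; first exact/IH/ltnW.
  have hE : h = eta + j.+1%:R * h - (eta + j%:R * h) by rewrite jS; ring.
  rewrite [X in eps / 4 * X]hE.
  apply: (@oscillating_piece _ _ E) => //; try lra.
    by apply: fM; rewrite in_itv/=; lra.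
  move=> t /andP[t1 t2]; apply: rf'; first by rewrite /= in_itv/=; lra.
  by rewrite ger0_norm; lra.
have midN : `|\int[mu]_(t in `]eta, 1 - eta]) (f t * e t)| <= eps / 2.
  have := mid N (leqnn _); rewrite (mulrC N%:R h) hN.
  have -> : eta + (1 - 2 * eta) = 1 - eta by ring.
  move=> /le_trans; apply; rewrite mulrDr mulrCA (mulrC N%:R h) hN.
  have -> : N%:R * (2 * M * d) = eps / 4 by rewrite /d; field; rewrite !gt_eqF.
  have : eps / 4 * (1 - 2 * eta) <= eps / 4 by rewrite ger_pMr ?divr_gt0//; lra.
  by lra.
have fe t : 0 < t < 1 -> `|f t * e t| <= M.
  by move=> t01; rewrite normrM -[M]mulr1 ler_pM// fM// in_itv.
have left : `|\int[mu]_(t in `]0, eta]) (f t * e t)| <= eps / 8.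
  apply: (le_trans _ etaM); rewrite -[X in _ <= M * X]subr0.
  apply: reg_itv_le => //; [exact: ltW|by rewrite bnd_simp; lra|].
  by move=> t _; exact: fe.
have right : `|\int[mu]_(t in `]1 - eta, 1[) (f t * e t)| <= eps / 8.
  apply: (le_trans _ etaM); have -> : M * eta = M * (1 - (1 - eta)) by ring.
  apply: reg_itv_le => //; rewrite ?bnd_simp//; try lra.
  by move=> t _; exact: fe.
have -> : I01 (fun t => f t * e t) = \int[mu]_(t in `]0, eta]) (f t * e t) +
    (\int[mu]_(t in `]eta, 1 - eta]) (f t * e t) +
     \int[mu]_(t in `]1 - eta, 1[) (f t * e t)).
  transitivity (\int[mu]_(t in `]0, eta]) (f t * e t) +
      \int[mu]_(t in `]eta, 1[) (f t * e t)).
    by apply: reg_itv_split; rewrite ?bnd_simp//; lra.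
  by congr (_ + _); apply: reg_itv_split; rewrite ?bnd_simp//; lra.
rewrite (le_trans (ler_normD _ _))//.
have := ler_normD (\int[mu]_(t in `]eta, 1 - eta]) (f t * e t))
  (\int[mu]_(t in `]1 - eta, 1[) (f t * e t)).
by lra.
Qed.

Lemma oscillating_sin y : 0 < `|y| -> oscillating `|y|^-1
  (fun t => sin (y * t)) (fun t => -1 * cos (y * t) / y).
Proof.
move=> y0; have yn0 : y != 0 by rewrite -normr_gt0.
split; [move=> x|move=> t|move=> t|move=> t]; last 2 first.
- exact: sin_max.
- by rewrite normrM mulN1r normrN normfV ler_piMl// cos_max.
- have d := der_cos (derM (der_cst y x) (der_id x)).
  by apply: (der_eq (derM (derM (der_cst (-1) x) d) (der_cst y^-1 x))) => /=; field.
- by apply: (der_continuous (der_sin (derM (der_cst y t) (der_id t)))).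
Qed.

Lemma oscillating_cos y : 0 < `|y| -> oscillating `|y|^-1
  (fun t => cos (y * t)) (fun t => sin (y * t) / y).
Proof.
move=> y0; have yn0 : y != 0 by rewrite -normr_gt0.
split; [move=> x|move=> t|move=> t|move=> t]; last 2 first.
- exact: cos_max.
- by rewrite normrM normfV ler_piMl// sin_max.
- have d := der_sin (derM (der_cst y x) (der_id x)).
  by apply: (der_eq (derM d (der_cst y^-1 x))) => /=; field.
- by apply: (der_continuous (der_cos (derM (der_cst y t) (der_id t)))).
Qed.

Lemma riemann_lebesgue_sin_cos f eps : reg f -> 0 < eps ->
  exists2 Y, 0 < Y & forall y, Y <= `|y| ->
    `|I01 (fun t => f t * sin (y * t))| <= eps /\
    `|I01 (fun t => f t * cos (y * t))| <= eps.
Proof.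
move=> rf eps0; have [d d0 H] := riemann_lebesgue rf eps0.
exists d^-1; first by rewrite invr_gt0.
move=> y yd; have y0 : 0 < `|y| by rewrite (lt_le_trans _ yd)// invr_gt0.
have yd' : `|y|^-1 <= d by rewrite -[leRHS]invrK lef_pV2// posrE ?invr_gt0.
split.
  have [h1 h2 h3 h4] := oscillating_sin y0.
  by apply: H; split; [exact: h1|exact: h2|exact: h3|move=> t; exact: le_trans (h4 t) yd'].
have [h1 h2 h3 h4] := oscillating_cos y0.
by apply: H; split; [exact: h1|exact: h2|exact: h3|move=> t; exact: le_trans (h4 t) yd'].
Qed.

End RiemannLebesgue.

(** * Series *)

Section AbsolutelySummable.
Variable R : realType.
Implicit Types (u v w : R^nat).

Definition abs_summable u :=
  exists B, forall N, \sum_(0 <= i < N) `|u i| <= B.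

Lemma abs_summable_normed u : abs_summable u -> cvgn (series (fun i => `|u i|)).
Proof.
move=> [B uB]; apply: nondecreasing_is_cvgn.
  by apply: nondecreasing_series => *; exact: normr_ge0.
by exists B => _ [n _ <-]; rewrite /series/=.
Qed.

Lemma abs_summable_cvg u : abs_summable u -> cvgn (series u).
Proof. by move=> /abs_summable_normed; exact: normed_cvg. Qed.

Lemma abs_summable_le u v : (forall i, `|u i| <= `|v i|) -> abs_summable v ->
  abs_summable u.
Proof.
move=> uv [B vB]; exists B => N; apply: le_trans (vB N).
by apply: ler_sum => i _.
Qed.

Lemma abs_summable_eventually u v (N0 : nat) :
  (forall i, (N0 <= i)%N -> `|u i| <= `|v i|) -> abs_summable v -> abs_summable u.
Proof.
move=> uv [B vB]; exists (\sum_(0 <= i < N0) `|u i| + B) => N.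
apply: (@le_trans _ _ (\sum_(0 <= i < N0) `|u i| + \sum_(0 <= i < N) `|v i|)); last first.
  by rewrite lerD2l.
have [NN|NN] := leqP N N0.
  rewrite (big_cat_nat (leq0n _) NN)//= -addrA lerDl addr_ge0 ?sumr_ge0//.
rewrite (big_cat_nat (leq0n _) (ltnW NN))//= lerD2l.
rewrite [leRHS](big_cat_nat (leq0n _) (ltnW NN))//= -[leLHS]add0r lerD ?sumr_ge0//.
by apply: ler_sum_nat => i /andP[iN _]; exact: uv.
Qed.

Lemma abs_summableZ c u : abs_summable u -> abs_summable (fun i => c * u i).
Proof.
move=> [B uB]; exists (`|c| * B) => N.
under eq_bigr do rewrite normrM.
by rewrite -mulr_sumr ler_wpM2l.
Qed.

Lemma abs_summableD u v : abs_summable u -> abs_summable v ->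
  abs_summable (fun i => u i + v i).
Proof.
move=> [B uB] [D vD]; exists (B + D) => N.
apply: le_trans (lerD (uB N) (vD N)); rewrite -big_split.
by apply: ler_sum => i _; exact: ler_normD.
Qed.

Lemma abs_summable_lim_le u B : cvgn (series u) ->
  (\forall N \near \oo, `|series u N| <= B) -> `|limn (series u)| <= B.
Proof.
move=> cu uB; rewrite ler_norml; apply/andP; split.
  by apply: limr_ge => //; apply: filterS uB => N; rewrite ler_norml => /andP[].
by apply: limr_le => //; apply: filterS uB => N; rewrite ler_norml => /andP[].
Qed.

Lemma abs_summable_tail u eps : abs_summable u -> 0 < eps ->
  exists M : nat, forall N, (M <= N)%N -> \sum_(M <= i < N) `|u i| <= eps.
Proof.
move=> su e0; have cu := abs_summable_normed su.
have /cvgrPdist_le/(_ _ e0)[M _ MP] := cu.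
exists M => N MN.
have ndu : nondecreasing_seq (series (fun i => `|u i|)).
  by apply: nondecreasing_series => *; exact: normr_ge0.
have := nondecreasing_cvgn_le ndu cu N.
have := MP M (leqnn M); rewrite ler_norml => /andP[_].
rewrite /series/= (big_cat_nat (leq0n _) MN)//= => h1 h2; lra.
Qed.

Lemma abs_summable_remainder u eps : abs_summable u -> 0 < eps ->
  exists M : nat, forall N, (M <= N)%N -> `|limn (series u) - series u N| <= eps.
Proof.
move=> su e0; have /cvgrPdist_le/(_ _ e0)[M _ MP] := abs_summable_cvg su.
by exists M => N /MP.
Qed.

Lemma lim_seriesB_le u v B : abs_summable u -> abs_summable v ->
  (forall N, \sum_(0 <= i < N) `|u i - v i| <= B) ->
  `|limn (series u) - limn (series v)| <= B.
Proof.
move=> su sv uvB; have cu := abs_summable_cvg su; have cv := abs_summable_cvg sv.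
have h N : `|series u N - series v N| <= B.
  by rewrite /series /= -sumrB; exact: le_trans (ler_norm_sum _ _ _) (uvB N).
rewrite -limB// ler_norml; apply/andP; split.
  apply: limr_ge; first exact: is_cvgB.
  by apply: nearW => N; have := h N; rewrite ler_norml => /andP[].
apply: limr_le; first exact: is_cvgB.
by apply: nearW => N; have := h N; rewrite ler_norml => /andP[].
Qed.

(* All series are indexed from 0: the term of index n belongs to the integer
   n + 1. *)
Definition lnS (n : nat) : R := ln n.+1%:R.

Lemma lnS_ge0 n : 0 <= lnS n.
Proof. by rewrite ln_ge0// ler1n. Qed.

Lemma expR_lnS n : expR (lnS n) = n.+1%:R.
Proof. by rewrite lnK// posrE ltr0n. Qed.

Lemma lnS_diff n : n.+2%:R^-1 <= lnS n.+1 - lnS n <= n.+1%:R^-1.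
Proof.
have lnE : expR (lnS n.+1 - lnS n) = n.+2%:R / n.+1%:R.
  by rewrite expRB !expR_lnS.
have n1 : n.+1%:R != 0 :> R by rewrite pnatr_eq0.
have n2 : n.+2%:R != 0 :> R by rewrite pnatr_eq0.
have e2 : n.+2%:R = n.+1%:R + 1 :> R by rewrite natr1.
apply/andP; split.
  have := expR_ge1Dx (- (lnS n.+1 - lnS n)); rewrite expRN lnE invf_div.
  have -> : n.+1%:R / n.+2%:R = 1 - n.+2%:R^-1 :> R.
    by move: n2; rewrite e2; move: n.+1%:R => x n2; field.
  by rewrite lerD2l lerN2.
have := expR_ge1Dx (lnS n.+1 - lnS n); rewrite lnE.
have -> : n.+2%:R / n.+1%:R = 1 + n.+1%:R^-1 :> R.
  by move: n1; rewrite e2; move: n.+1%:R => x n1; field.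
by rewrite lerD2l.
Qed.

Lemma abs_summable_dirichlet (d : R) : 0 < d ->
  abs_summable (fun n => n.+1%:R^-1 * expR (- d * lnS n)).
Proof.
move=> d0; exists (1 + d^-1) => N.
suff H n : \sum_(0 <= i < n.+1) `|i.+1%:R^-1 * expR (- d * lnS i)|
    <= 1 + d^-1 * (1 - expR (- d * lnS n)).
  case: N => [|n]; first by rewrite big_geq// addr_ge0// invr_ge0 ltW.
  apply: le_trans (H n) _; rewrite lerD2l; apply: ler_piMr.
    by rewrite invr_ge0 ltW.
  by rewrite gerBl expR_ge0.
elim: n => [|n IH].
  by rewrite big_nat1 /lnS ln1 mulr0 expR0 invr1 subrr mulr0 addr0 mulr1 normr1.
rewrite big_nat_recr//= (le_trans (lerD IH (lexx _)))//.
rewrite ger0_norm; last by rewrite mulr_ge0 ?invr_ge0 ?expR_ge0.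
have /andP[h _] := lnS_diff n; move: (n.+2%:R^-1) h => q h.
set e := expR (- d * lnS n.+1).
have -> : expR (- d * lnS n) = e * expR (d * (lnS n.+1 - lnS n)).
  by rewrite -expRD; congr expR; ring.
have e0 : 0 < e by exact: expR_gt0.
have E1 := expR_ge1Dx (d * (lnS n.+1 - lnS n)).
have dV : 0 < d^-1 by rewrite invr_gt0.
have : e * q <= d^-1 * (e * expR (d * (lnS n.+1 - lnS n)) - e).
  rewrite -[in X in _ - X](mulr1 e) -mulrBr mulrCA ler_pM2l// ler_pdivlMl//.
  have : d * q <= d * (lnS n.+1 - lnS n) by rewrite ler_pM2l.
  by lra.
by lra.
Qed.

End AbsolutelySummable.

Section ArctanMajorant.
Variable R : realType.
Implicit Types (l y : R).

(* Up to the factor 3, [atan_weight l y] is the increment of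
   [n |-> atan (l * lnS n - y) / l], so it telescopes to O(1 / l). *)
Definition atan_weight l y (i : nat) : R := i.+1%:R^-1 / (1 + (l * lnS R i - y) ^+ 2).

Lemma oneDsqr_gt0 (x : R) : 0 < 1 + x ^+ 2.
Proof. by rewrite ltr_pwDl// sqr_ge0. Qed.

Lemma atan_weight_ge0 l y i : 0 <= atan_weight l y i.
Proof. by rewrite divr_ge0 ?invr_ge0// ltW// oneDsqr_gt0. Qed.

Lemma atan_weight_step l y n : 0 < l -> l <= n.+1%:R ->
  atan_weight l y n.+1 <=
    3 / l * (atan (l * lnS R n.+1 - y) - atan (l * lnS R n - y)).
Proof.
move=> l0 ln; rewrite /atan_weight.
have /andP[D1 D2] := lnS_diff R n.
set u := l * lnS R n - y; set v := l * lnS R n.+1 - y.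
have vuE : v - u = l * (lnS R n.+1 - lnS R n) by rewrite /u /v; ring.
have n2 : 0 < n.+2%:R^-1 :> R by rewrite invr_gt0.
have n1 : l * n.+1%:R^-1 <= 1 by rewrite ler_pdivrMr// mul1r.
move: (n.+2%:R^-1) (n.+1%:R^-1) D1 D2 n2 n1 => q1 q2 D1 D2 q10 q21.
have vu : u < v by rewrite -subr_gt0 vuE mulr_gt0//; lra.
have vu1 : v - u <= 1.
  by rewrite vuE (le_trans _ q21)// ler_pM2l.
have vul : l * q1 <= v - u by rewrite vuE ler_pM2l.
have [z /andP[uz zv] ->] := MVT_all (fun z => is_derive1_atan z) vu.
have z3 : 1 + z ^+ 2 <= 3 * (1 + v ^+ 2).
  have : z ^+ 2 <= 2 * v ^+ 2 + 2 * (v - z) ^+ 2.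
    by rewrite -subr_ge0 (_ : _ - _ = (2 * v - z) ^+ 2) ?sqr_ge0//; ring.
  have : (v - z) ^+ 2 <= 1 by rewrite expr_le1//; lra.
  by have := sqr_ge0 v; lra.
have v0 := oneDsqr_gt0 v; have z0 := oneDsqr_gt0 z.
apply: (@le_trans _ _ (3 * q1 / (1 + z ^+ 2))).
  rewrite ler_pdivrMr// mulrAC ler_pdivlMr// (mulrC 3) -mulrA.
  by rewrite ler_pM2l.
rewrite (_ : 3 * q1 / _ = 3 / l * ((1 + z ^+ 2)^-1 * (l * q1))); last first.
  by field; rewrite !gt_eqF.
by rewrite ler_wpM2l ?divr_ge0 ?(ltW l0)// ler_wpM2l// invr_ge0 ltW.
Qed.

Lemma atan_weight_sum l y (N0 N : nat) : 0 < l -> l <= N0.+1%:R ->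
  \sum_(N0.+1 <= i < N) atan_weight l y i <= 12 / l.
Proof.
move=> l0 lN.
suff H n : (N0 <= n)%N -> \sum_(N0.+1 <= i < n.+1) atan_weight l y i <=
    3 / l * (atan (l * lnS R n - y) - atan (l * lnS R N0 - y)).
  have [NN|NN] := leqP N N0.
    by rewrite big_geq ?(leq_trans NN)// divr_ge0// ltW.
  case: N NN => // N NN; apply: le_trans (H N NN) _.
  rewrite (_ : 12 / l = 3 / l * 4); last by field; rewrite gt_eqF.
  rewrite ler_wpM2l ?divr_ge0 ?(ltW l0)//.
  have := atan_ltpi2 (l * lnS R N - y).
  have := atan_gtNpi2 (l * lnS R N0 - y).
  by have := pi_lt4 R; lra.
elim: n => [|n IH] Nn.
  by move: Nn; rewrite leqn0 => /eqP ->; rewrite big_geq// subrr mulr0.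
have [Nn'|] := ltnP n N0.
  have -> : N0 = n.+1 by apply/eqP; rewrite eqn_leq Nn Nn'.
  by rewrite big_geq// subrr mulr0.
move=> Nn'; rewrite big_nat_recr//=.
apply: le_trans (lerD (IH Nn') (@atan_weight_step l y n l0 _)) _.
  by rewrite (le_trans lN)// ler_nat.
by rewrite -mulrDr addrC subrKA.
Qed.

Lemma atan_weight_summable l y : 0 < l -> abs_summable (atan_weight l y).
Proof.
move=> l0; pose N0 := Num.truncn l.
have lN : l <= N0.+1%:R by rewrite ltW// truncnS_gt.
exists (\sum_(0 <= i < N0.+1) atan_weight l y i + 12 / l) => N.
under eq_bigr do rewrite ger0_norm ?atan_weight_ge0//.
have [NN|NN] := leqP N N0.+1.
  rewrite [X in _ <= X + _](big_cat_nat (leq0n _) NN)//= -addrA lerDl.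
  by rewrite addr_ge0 ?divr_ge0 ?(ltW l0)// sumr_ge0// => *; exact: atan_weight_ge0.
by rewrite (big_cat_nat (leq0n _) (ltnW NN))//= lerD2l atan_weight_sum.
Qed.

End ArctanMajorant.

Section BoundaryLimit.
Variable R : realType.
Implicit Types (F : R -> R -> R) (f : R -> R).

(* [F d t] tends to [f t0] as [d] tends to 0 from the right and, simultaneously,
   [t] tends to [t0]. *)
Definition boundary_limit F f := forall t eps : R, 0 < eps ->
  exists2 r : R, 0 < r & forall t' d : R, `|t' - t| < r -> 0 < d < r ->
    `|F d t' - f t| <= eps.

Lemma boundary_limit_near F f : boundary_limit F f ->
  forall t eps : R, 0 < eps -> exists2 r : R, 0 < r & forall t' : R, `|t' - t| < r ->
    `|f t' - f t| <= eps.
Proof.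
move=> H t eps e0; have e2 : 0 < eps / 2 by rewrite divr_gt0.
have [r r0 rF] := H t _ e2; exists r => // t' t'r.
have [r' r'0 r'F] := H t' _ e2.
pose d := Num.min r r' / 2.
have m0 : 0 < Num.min r r' by rewrite lt_min r0 r'0.
have dm : 0 < d < Num.min r r' by rewrite divr_gt0//= ltr_pdivrMr// ltr_pMr// ltr1n.
move: dm; rewrite lt_min => /and3P[d0 dr dr'].
have h1 : `|F d t' - f t| <= eps / 2 by apply: rF => //; rewrite d0.
have h2 : `|F d t' - f t'| <= eps / 2.
  by apply: r'F; rewrite ?subrr ?normr0// d0.
rewrite -(subrKA (F d t')) (le_trans (ler_normD _ _))// (splitr eps) lerD//.
by rewrite distrC.
Qed.

Lemma boundary_limit_continuous F f : boundary_limit F f -> continuous f.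
Proof.
move=> /boundary_limit_near H t; apply/cvgrPdist_le => e e0.
have [r r0 rf] := H t e e0; near=> t'.
rewrite distrC; apply: rf; rewrite distrC; near: t'.
by apply/nbhs_ballP; exists r.
Unshelve. all: by end_near. Qed.

Lemma boundary_limit_uniform F f (a eps : R) : boundary_limit F f -> 0 < eps ->
  exists2 r : R, 0 < r & forall t d : R, 0 <= t <= a -> 0 < d < r ->
    `|F d t - f t| <= eps.
Proof.
move=> H e0; have e2 : 0 < eps / 2 by rewrite divr_gt0.
have /compact_near_coveringP cK := @segment_compact R 0 a.
have /= {}cK := cK R (0^'+) (fun d t => `|F d t - f t| <= eps).
have {cK} : \forall d \near 0^'+, `[0, a]%classic `<=` (fun t => `|F d t - f t| <= eps).
  apply: cK => t _; have [r r0 rF] := H t _ e2.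
  have [r' r'0 rf] := boundary_limit_near H t e2.
  near=> z d.
  have d0 : 0 < d by near: d; exact: nbhs_right_gt.
  have dr : d < r by near: d; exact: nbhs_right_lt.
  have zr : `|z - t| < Num.min r r'.
    rewrite distrC; near: z; apply: nbhsx_ballx.
    by rewrite lt_min r0 r'0.
  move: zr; rewrite lt_min => /andP[zr zr'].
  rewrite -(subrKA (f t)) (le_trans (ler_normD _ _))// (splitr eps) lerD//.
    by apply: rF => //; rewrite d0.
  by rewrite distrC rf.
move=> /nbhs_ballP[r /= r0 rP]; exists r => // t d ta /andP[d0 dr].
have bd : ball (0 : R) r d by rewrite /ball/= sub0r normrN gtr0_norm.
by have := rP d bd d0 t; apply; rewrite /= in_itv.
Unshelve. all: by end_near. Qed.

Lemma linear_growth f (a M eta : R) : continuous f -> 0 < eta ->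
  (forall u, 0 < u < eta -> `|f u| <= M * u) ->
  exists M', forall u, 0 < u <= a -> `|f u| <= M' * u.
Proof.
move=> cf eta0 fM.
have /compact_bounded[B [_ fB]] := continuous_compact
  (continuous_subspaceT cf) (@segment_compact R 0 a).
pose B' := `|B| + 1.
have {}fB u : 0 <= u <= a -> `|f u| <= B'.
  move=> ua; apply: (fB B'); first by rewrite (le_lt_trans (ler_norm _))// ltrDl.
  by exists u => //=; rewrite in_itv.
have B0 : 0 <= B' by rewrite addr_ge0.
exists (Num.max M (B' / eta)) => u /andP[u0 ua].
have [ue|eu] := ltP u eta.
  apply: le_trans (fM u _) _; first by rewrite u0.
  by rewrite ler_wpM2r ?(ltW u0)// le_max lexx.
apply: (@le_trans _ _ (B' / eta * u)); last first.
  by rewrite ler_wpM2r ?(ltW u0)// le_max lexx orbT.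
apply: le_trans (fB u _) _; first by rewrite ltW.
by rewrite mulrAC ler_pdivlMr// ler_wpM2l.
Qed.

End BoundaryLimit.

Section DominatedRemainder.
Variable R : realType.
Implicit Types (u v : R^nat).

Lemma lim_dist_le u (x K : R) (N : nat) : cvgn u ->
  (forall N', (N <= N')%N -> `|u N' - x| <= K) -> `|limn u - x| <= K.
Proof.
move=> cu H; rewrite ler_norml; apply/andP; split.
  rewrite lerBrDr; apply: limr_ge => //; exists N => // N' /= NN'.
  by have := H N' NN'; rewrite ler_norml => /andP[+ _]; rewrite lerBrDr.
rewrite lerBlDr; apply: limr_le => //; exists N => // N' /= NN'.
by have := H N' NN'; rewrite ler_norml => /andP[_]; rewrite lerBlDr.
Qed.

Lemma dominated_remainder v (eps : R) : abs_summable v -> 0 < eps ->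
  exists M : nat, forall u, (forall i, `|u i| <= `|v i|) ->
    forall N, (M <= N)%N -> `|limn (series u) - series u N| <= eps.
Proof.
move=> sv e0; have [M MP] := abs_summable_tail sv e0.
exists M => u uv N MN.
have cu := abs_summable_cvg (abs_summable_le uv sv).
apply: (lim_dist_le cu (N := N)) => N' NN'.
rewrite sub_series_geq//; apply: le_trans (ler_norm_sum _ _ _) _.
apply: le_trans (MP N' (leq_trans MN NN')).
rewrite [leRHS](big_cat_nat MN NN')//= -[leLHS]add0r lerD ?sumr_ge0//.
by apply: ler_sum => i _.
Qed.

Lemma eq_of_norm_le (x y : R) : (forall eps, 0 < eps -> `|x - y| <= eps) -> x = y.
Proof.
move=> H; apply/eqP; rewrite -subr_eq0 -normr_le0.
by apply/ler_addgt0Pr => e e0; rewrite add0r H.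
Qed.

End DominatedRemainder.

(** * A Tauberian theorem of Newman and Ingham type *)

Section TrigonometricDirichletSeries.
Variables (R : realType) (b : R^nat).

Definition dirichlet_term (d : R) n : R := b n * expR (- d * lnS R n).

Definition cos_series (d t : R) : R :=
  limn (series (fun n => dirichlet_term d n * cos (t * lnS R n))).

Definition sin_series (d t : R) : R :=
  limn (series (fun n => dirichlet_term d n * sin (t * lnS R n))).

Lemma dirichlet_term_summable C d : (forall n, `|b n| <= C / n.+1%:R) -> 0 < d ->
  abs_summable (dirichlet_term d).
Proof.
move=> bC d0; apply: abs_summable_le (abs_summableZ C (abs_summable_dirichlet d0)).
move=> i; rewrite /dirichlet_term mulrA !normrM ler_wpM2r//.
by rewrite (le_trans (bC i))// -normrM ler_norm.
Qed.

End TrigonometricDirichletSeries.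

Section Tauberian.
Variables (R : realType) (b : R^nat) (C : R).
Hypothesis bC : forall n, `|b n| <= C / n.+1%:R.
Variables (c0 s0 : R -> R).
Hypothesis c0_lim : boundary_limit (cos_series b) c0.
Hypothesis s0_lim : boundary_limit (sin_series b) s0.
Variables (M eta : R).
Hypothesis eta0 : 0 < eta.
Hypothesis c0_lin : forall u, 0 < u < eta -> `|c0 u| <= M * u.
Hypothesis s0_lin : forall u, 0 < u < eta -> `|s0 u| <= M * u.
Variables (k W : R -> R) (B : R).
Hypothesis rk : reg k.
Hypothesis Wk : forall x y, W y - W x =
  I01 (fun t => k t * ((sin (y * t) - sin (x * t)) / t)).
Hypothesis WB : forall u, `|W u - (0 <= u)%R%:R| <= B / (1 + u ^+ 2).
Variable l : R.
Hypothesis l0 : 0 < l.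

Local Notation ln_ := (lnS R).
Local Notation aw := (atan_weight l).

Lemma C_ge0 : 0 <= C.
Proof. by have := bC 0; rewrite invr1 mulr1; exact: le_trans. Qed.

Lemma B_ge0 : 0 <= B.
Proof. by have := WB 0; rewrite expr0n addr0 invr1 mulr1; exact: le_trans. Qed.

Let step_weight y n : `|b n * (W (y - l * ln_ n) - (0 <= y - l * ln_ n)%R%:R)|
  <= C * B * aw y n.
Proof.
rewrite normrM /atan_weight -[(_ - y) ^+ 2]sqrrN opprB.
rewrite [leRHS](_ : _ = (C / n.+1%:R) * (B / (1 + (y - l * ln_ n) ^+ 2))); last first.
  by rewrite mulrACA mulrA.
by rewrite ler_pM.
Qed.

Let aw_small y n a : 0 < a -> a <= `|l * ln_ n - y| -> aw y n <= a^-1.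
Proof.
move=> a0 az; apply: (@le_trans _ _ (1 + (l * ln_ n - y) ^+ 2)^-1).
  by rewrite /atan_weight ler_piMl ?invr_ge0 ?(ltW (oneDsqr_gt0 _))// invf_le1// ler1n.
rewrite lef_pV2 ?posrE ?oneDsqr_gt0//; apply: (le_trans az).
move: (l * _ - y) => z; have := sqr_ge0 (`|z| - 1).
by rewrite sqrrB1 real_normK ?num_real//; have := normr_ge0 z; lra.
Qed.

Let bW y n := b n * W (y - l * ln_ n).

Lemma ln_unbounded (A : R) : exists N0 : nat, forall N, (N0 <= N)%N -> A <= ln_ N.
Proof.
exists (Num.truncn (expR A)) => N NA.
rewrite -(expRK A) ler_ln ?posrE ?expR_gt0//.
by rewrite (le_trans (ltW (truncnS_gt _)))// ler_nat ltnS.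
Qed.

Let bW_eventually y : exists N0 : nat, forall n, (N0 <= n)%N ->
  `|bW y n| <= C * B * aw y n.
Proof.
have [N0 N0P] := ln_unbounded ((y + 1) / l); exists N0 => n /N0P.
rewrite ler_pdivrMr// mulrC => yn.
have yneg : (0 <= y - l * ln_ n)%R = false by apply/negbTE; rewrite -ltNge; lra.
by have := step_weight y n; rewrite yneg subr0.
Qed.

Lemma bW_summable y : abs_summable (bW y).
Proof.
have [N0 N0P] := bW_eventually y.
apply: (@abs_summable_eventually _ _ (fun n => C * B * aw y n) N0).
  by move=> i /N0P /le_trans; apply; exact: ler_norm.
exact/abs_summableZ/atan_weight_summable.
Qed.

Let T y := limn (series (bW y)).

Let kA y x t := k t * ((sin (y * t) - sin (x * t)) / t).
Let kB y x t := k t * ((cos (y * t) - cos (x * t)) / t).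

Let reg_kA y x : reg (kA y x).
Proof.
apply: regM => //.
have := regB (reg_sin_div y) (reg_sin_div x).
by apply: eq_reg => t _; rewrite mulrBl.
Qed.

Let reg_kB y x : reg (kB y x).
Proof.
apply: regM => //; apply: (@reg_div _ _ `|y - x|) => [t _|t t01].
  by apply: cvgB; exact: continuous_cosM.
rewrite (le_trans (cos_lipschitz _ _))// -mulrBl normrM ler_wpM2l//.
by rewrite ger0_norm// ltW// (itvP t01).
Qed.

Let V y x n := W (y - l * ln_ n) - W (x - l * ln_ n).
Let cN d N u := \sum_(0 <= n < N) dirichlet_term b d n * cos (u * ln_ n).
Let sN d N u := \sum_(0 <= n < N) dirichlet_term b d n * sin (u * ln_ n).

Let reg_scale_cos n : reg (fun t => cos (l * t * ln_ n)).
Proof. by apply: eq_reg (reg_cos (l * ln_ n)) => t _; rewrite mulrAC. Qed.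

Let reg_scale_sin n : reg (fun t => sin (l * t * ln_ n)).
Proof. by apply: eq_reg (reg_sin (l * ln_ n)) => t _; rewrite mulrAC. Qed.

Let reg_cN d N : reg (fun t => cN d N (l * t)).
Proof.
elim: N => [|N IH].
  by apply: eq_reg (reg_cst 0) => t _; rewrite /cN big_geq.
have := regD IH (regZ (dirichlet_term b d N) (reg_scale_cos N)).
by apply: eq_reg => t _; rewrite /cN big_nat_recr.
Qed.

Let reg_sN d N : reg (fun t => sN d N (l * t)).
Proof.
elim: N => [|N IH].
  by apply: eq_reg (reg_cst 0) => t _; rewrite /sN big_geq.
have := regD IH (regZ (dirichlet_term b d N) (reg_scale_sin N)).
by apply: eq_reg => t _; rewrite /sN big_nat_recr.
Qed.

Let reg_comb y x f g : reg f -> reg g ->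
  reg (fun t => kA y x t * f t - kB y x t * g t).
Proof. by move=> rf rg; apply: regB; apply: regM. Qed.

Lemma partial_sum_I01 y x d N :
  \sum_(0 <= n < N) dirichlet_term b d n * V y x n =
  I01 (fun t => kA y x t * cN d N (l * t) - kB y x t * sN d N (l * t)).
Proof.
elim: N => [|N IH].
  rewrite big_geq//; apply/esym; rewrite -(mul0r (I01 (kA y x))) -I01Z//.
  by apply: eq_I01 => t _; rewrite /cN /sN !big_geq// !mulr0 subrr mul0r.
rewrite big_nat_recr//= IH /V Wk -I01Z; last exact: reg_kA.
rewrite -I01D; [|exact: reg_comb|by apply: regZ; exact: reg_kA].
apply: eq_I01 => t _; rewrite /cN /sN !big_nat_recr//= /kA /kB.
have e z : (z - l * ln_ N) * t = z * t - l * t * ln_ N by ring.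
by rewrite !e !sinB; ring.
Qed.

Let reg_lin f : continuous f -> (forall u, 0 < u < eta -> `|f u| <= M * u) ->
  reg (fun t => f (l * t)) /\ reg (fun t => f (l * t) / t).
Proof.
move=> cf fM; have [D DP] := @linear_growth _ _ l _ _ cf eta0 fM.
have cfl : {in `]0, 1[, continuous (fun t => f (l * t))}.
  move=> t _; apply: (@continuous_comp _ _ _ (fun t => l * t) f).
    exact: mulrl_continuous.
  exact: cf.
have lt1 t : t \in `]0, 1[ -> 0 < l * t <= l.
  by rewrite in_itv/= => /andP[t0 t1]; rewrite mulr_gt0//= ger_pMr// ltW.
split; last first.
  apply: (@reg_div _ _ (D * l)) => // t t01.
  by rewrite -mulrA; exact: DP (lt1 t t01).
split=> //; exists (`|D| * l) => t /lt1 tl.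
rewrite (le_trans (DP _ tl))//; case/andP : tl => lt0 ltl.
apply: (@le_trans _ _ (`|D| * (l * t))); last by rewrite ler_wpM2l.
by rewrite ler_wpM2r ?ler_norm// ltW.
Qed.

Let rc0 := reg_lin (boundary_limit_continuous c0_lim) c0_lin.
Let rs0 := reg_lin (boundary_limit_continuous s0_lim) s0_lin.

Let limit_close y x eps : 0 < eps -> exists2 r, 0 < r & forall d, 0 < d < r ->
  exists N0 : nat, forall N, (N0 <= N)%N ->
  `|\sum_(0 <= n < N) dirichlet_term b d n * V y x n -
    I01 (fun t => kA y x t * c0 (l * t) - kB y x t * s0 (l * t))| <= eps.
Proof.
move=> eps0.
have [_ [MA kAM]] := reg_kA y x; have [_ [MB kBM]] := reg_kB y x.
pose Q := `|MA| + `|MB| + 1.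
have Q0 : 0 < Q by rewrite ltr_pwDr// addr_ge0.
pose e := eps / Q / 2.
have e0 : 0 < e by rewrite !divr_gt0.
have [r1 r10 c0r] := boundary_limit_uniform l c0_lim e0.
have [r2 r20 s0r] := boundary_limit_uniform l s0_lim e0.
exists (Num.min r1 r2); first by rewrite lt_min r10 r20.
move=> d /andP[d0]; rewrite lt_min => /andP[d1 d2].
have [N0 N0P] := dominated_remainder (dirichlet_term_summable bC d0) e0.
exists N0 => N N0N.
have lt1 t : t \in `]0, 1[ -> 0 <= l * t <= l.
  rewrite in_itv/= => /andP[t0 t1].
  by rewrite mulr_ge0 ?(ltW l0) ?(ltW t0)//= ger_pMr// ltW.
have cc t : t \in `]0, 1[ -> `|cN d N (l * t) - c0 (l * t)| <= 2 * e.
  move=> /lt1 tl; rewrite -(subrKA (cos_series b d (l * t))).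
  rewrite (le_trans (ler_normD _ _))// mulr_natl mulr2n lerD//.
    rewrite distrC; apply: N0P => // i.
    by rewrite normrM ler_piMr// cos_max.
  by apply: c0r => //; rewrite d0.
have ss t : t \in `]0, 1[ -> `|sN d N (l * t) - s0 (l * t)| <= 2 * e.
  move=> /lt1 tl; rewrite -(subrKA (sin_series b d (l * t))).
  rewrite (le_trans (ler_normD _ _))// mulr_natl mulr2n lerD//.
    rewrite distrC; apply: N0P => // i.
    by rewrite normrM ler_piMr// sin_max.
  by apply: s0r => //; rewrite d0.
rewrite partial_sum_I01 -I01B; last 2 first.
- exact: reg_comb.
- exact: reg_comb rc0.1 rs0.1.
apply: I01_le.
  by apply: regB; apply: reg_comb => //; [exact: rc0.1|exact: rs0.1].
move=> t t01.
have -> : kA y x t * cN d N (l * t) - kB y x t * sN d N (l * t) -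
   (kA y x t * c0 (l * t) - kB y x t * s0 (l * t)) =
   kA y x t * (cN d N (l * t) - c0 (l * t)) - kB y x t * (sN d N (l * t) - s0 (l * t)).
  by ring.
rewrite (le_trans (ler_normB _ _))// (normrM (kA y x t)) (normrM (kB y x t)).
apply: (@le_trans _ _ (`|MA| * (2 * e) + `|MB| * (2 * e))).
  apply: lerD; apply: ler_pM => //.
  - exact: le_trans (kAM t t01) (ler_norm _).
  - exact: cc.
  - exact: le_trans (kBM t t01) (ler_norm _).
  - exact: ss.
have -> : eps = Q * (2 * e) by rewrite /e; field; rewrite gt_eqF.
rewrite -mulrDl; apply: ler_wpM2r; last by rewrite /Q lerDl.
by rewrite mulr_ge0// ltW.
Qed.

(* The Fourier representation is first used with the convergence factor
   [expR (- d * lnS n)]; then [d] tends to 0, on the left-hand side by dominated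
   convergence and on the right-hand side by [boundary_limit_uniform]. *)
Let T_diff y x :
  T y - T x = I01 (fun t => kA y x t * c0 (l * t) - kB y x t * s0 (l * t)).
Proof.
apply: eq_of_norm_le => eps0' eps0; pose e := eps0' / 4.
have e0 : 0 < e by rewrite divr_gt0.
pose u n := b n * V y x n.
have uE n : u n = bW y n - bW x n by rewrite /u /V /bW mulrBr.
have su : abs_summable u.
  have := abs_summableD (bW_summable y) (abs_summableZ (-1) (bW_summable x)).
  by congr abs_summable; apply/funext => n; rewrite uE mulN1r.
have TE : T y - T x = limn (series u).
  have cy := abs_summable_cvg (bW_summable y).
  have cx := abs_summable_cvg (bW_summable x).
  rewrite (_ : series u = series (bW y) \- series (bW x)) ?limB//.
  apply/funext => N; rewrite /series/=.
  under eq_bigr do rewrite uE.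
  by rewrite sumrB.
rewrite TE.
have [M1 M1P] := abs_summable_tail su e0.
pose D := \sum_(0 <= n < M1) `|u n| * ln_ n + 1.
have D0 : 0 < D.
  by rewrite ltr_pwDr// sumr_ge0// => i _; rewrite mulr_ge0// lnS_ge0.
have [r r0 rP] := limit_close y x e0.
pose d := Num.min r (e / D) / 2.
have m0 : 0 < Num.min r (e / D) by rewrite lt_min r0 divr_gt0.
have : 0 < d < Num.min r (e / D).
  by rewrite divr_gt0//= ltr_pdivrMr// ltr_pMr// ltr1n.
rewrite lt_min => /and3P[d0 dr deD].
have [|N1 N1P] := rP d; first by rewrite d0.
have [N2 N2P] := abs_summable_remainder su e0.
pose N := maxn M1 (maxn N1 N2).
have NM1 : (M1 <= N)%N by exact: leq_maxl.
have NN1 : (N1 <= N)%N by rewrite (leq_trans (leq_maxl _ N2))// leq_maxr.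
have NN2 : (N2 <= N)%N by rewrite (leq_trans (leq_maxr N1 _))// leq_maxr.
have h1 := N1P N NN1; have h2 := N2P N NN2.
have ed n : 0 <= 1 - expR (- d * ln_ n) <= Num.min 1 (d * ln_ n).
  have ln0 := lnS_ge0 R n.
  have dl : 0 <= d * ln_ n by rewrite mulr_ge0// ltW.
  have x1 := expR_ge1Dx (- d * ln_ n); have x0 := expR_gt0 (- d * ln_ n).
  have x2 : expR (- d * ln_ n) <= 1 by rewrite -expR0 ler_expR mulNr oppr_le0.
  rewrite subr_ge0 x2 le_min /=; apply/andP; split; first by lra.
  by lra.
have h3 : `|series u N - \sum_(0 <= n < N) dirichlet_term b d n * V y x n| <= 2 * e.
  rewrite /series/= -sumrB.
  apply: (@le_trans _ _ (\sum_(0 <= n < N) `|u n| * Num.min 1 (d * ln_ n))).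
    apply: le_trans (ler_norm_sum _ _ _) _; apply: ler_sum => n _.
    have /andP[g1 g2] := ed n.
    rewrite /dirichlet_term (_ : _ - _ = u n * (1 - expR (- d * ln_ n))); last first.
      by rewrite /u; ring.
    by rewrite normrM ler_wpM2l// ger0_norm.
  rewrite (big_cat_nat (leq0n _) NM1)//= mulr_natl mulr2n; apply: lerD.
    apply: (@le_trans _ _ (d * D)); last first.
      by rewrite -ler_pdivlMr// ltW.
    rewrite /D mulrDr mulr1 -[leLHS]addr0 lerD ?(ltW d0)//.
    rewrite mulr_sumr; apply: ler_sum => n _.
    by rewrite mulrCA ler_wpM2l// ge_min lexx orbT.
  apply: le_trans (M1P N NM1); apply: ler_sum => n _.
  by rewrite ler_piMr// ge_min lexx.
move: h1 h2 h3; rewrite -/e; set X := I01 _; set Y := series u N; set Z := \sum_(0 <= n < N) _.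
move=> h1 h2 h3.
rewrite -(subrKA Y) -(subrKA Z Y (- X)).
have := ler_normD (limn (series u) - Y) (Y - Z + (Z - X)).
have := ler_normD (Y - Z) (Z - X).
have -> : eps0' = 4 * e by rewrite /e; field.
by lra.
Qed.

Let Phi y := I01 (fun t => k t * (c0 (l * t) / t) * sin (y * t))
  - I01 (fun t => k t * (s0 (l * t) / t) * cos (y * t)).

Let T_diff_Phi y x : T y - T x = Phi y - Phi x.
Proof.
have r1 z := regM (regM rk rc0.2) (reg_sin z).
have r2 z := regM (regM rk rs0.2) (reg_cos z).
rewrite T_diff /Phi.
rewrite opprD opprK addrACA -I01B// [- _ + _]addrC -I01B//.
rewrite -I01D; [|exact: regB|exact: regB].
by apply: eq_I01 => t _; rewrite /kA /kB; ring.
Qed.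

Let Phi_small eps : 0 < eps ->
  exists2 Y, 0 < Y & forall y, Y <= `|y| -> `|Phi y| <= eps.
Proof.
move=> e0; have e2 : 0 < eps / 2 by rewrite divr_gt0.
have [Y1 Y10 Y1P] := riemann_lebesgue_sin_cos (regM rk rc0.2) e2.
have [Y2 Y20 Y2P] := riemann_lebesgue_sin_cos (regM rk rs0.2) e2.
exists (Num.max Y1 Y2); first by rewrite lt_max Y10.
move=> y; rewrite ge_max => /andP[y1 y2].
rewrite (le_trans (ler_normB _ _))// (splitr eps) lerD//.
  exact: (Y1P y y1).1.
exact: (Y2P y y2).2.
Qed.

Let T_at_Ninfty eps : 0 < eps ->
  exists2 X, 0 < X & forall x, x <= - X -> `|T x| <= eps.
Proof.
move=> eps0; have e2 : 0 < eps / 2 by rewrite divr_gt0.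
have sw : abs_summable (fun n => C * B * aw 0 n).
  exact/abs_summableZ/atan_weight_summable.
have [M1 M1P] := abs_summable_tail sw e2.
have CB0 : 0 <= C * B by rewrite mulr_ge0 ?C_ge0 ?B_ge0.
pose Q := C * B * M1%:R + 1.
have Q0 : 0 < Q by rewrite ltr_pwDr// mulr_ge0.
exists (Q / (eps / 2)); first by rewrite divr_gt0.
move=> x xX.
have X0 : 0 < Q / (eps / 2) by rewrite divr_gt0.
have x0 : x < 0 by lra.
have bnd n : `|bW x n| <= C * B * aw x n.
  have ln0 := lnS_ge0 R n.
  have lln : 0 <= l * ln_ n by rewrite mulr_ge0// ltW.
  have yneg : (0 <= x - l * ln_ n)%R = false by apply/negbTE; rewrite -ltNge; lra.
  by have := step_weight x n; rewrite yneg subr0.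
have aw_mono n : aw x n <= aw 0 n.
  have ln0 := lnS_ge0 R n.
  have lln : 0 <= l * ln_ n by rewrite mulr_ge0// ltW.
  rewrite /atan_weight ler_wpM2l ?invr_ge0// lef_pV2 ?posrE ?oneDsqr_gt0//.
  by rewrite lerD2l lerXn2r ?nnegrE ?subr0//; lra.
have aws n : C * B * aw x n <= C * B * (eps / 2 / Q).
  have ln0 := lnS_ge0 R n.
  have lln : 0 <= l * ln_ n by rewrite mulr_ge0// ltW.
  rewrite ler_wpM2l// -invf_div; apply: aw_small => //.
  by rewrite ger0_norm; lra.
apply: abs_summable_lim_le; first exact: abs_summable_cvg (bW_summable x).
exists M1 => // N /= MN; rewrite /series/=.
apply: le_trans (ler_norm_sum _ _ _) _.
rewrite (big_cat_nat (leq0n _) MN)//= (splitr eps); apply: lerD; last first.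
  apply: le_trans (M1P N MN); apply: ler_sum => n _.
  rewrite (le_trans (bnd n))// (le_trans _ (ler_norm _))// ler_wpM2l//.
apply: (@le_trans _ _ (\sum_(0 <= n < M1) C * B * (eps / 2 / Q))).
  by apply: ler_sum => n _; exact: le_trans (bnd n) (aws n).
rewrite sumr_const_nat subn0 -[_ *+ M1]mulr_natr.
have -> : C * B * (eps / 2 / Q) * M1%:R = (C * B * M1%:R / Q) * (eps / 2) by ring.
by rewrite ler_piMl ?(ltW e2)// ler_pdivrMr// mul1r /Q lerDl.
Qed.

(* [T - Phi] is constant, and both terms vanish at -oo. *)
Lemma smoothed_eq y : T y = Phi y.
Proof.
apply: eq_of_norm_le => eps eps0.
have e2 : 0 < eps / 2 by rewrite divr_gt0.
have [X X0 XP] := T_at_Ninfty e2.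
have [Y Y0 YP] := Phi_small e2.
pose x := - Num.max X Y.
have xX : x <= - X by rewrite lerN2 le_max lexx.
have xY : Y <= `|x|.
  by rewrite normrN ger0_norm le_max ?lexx ?orbT// (ltW X0).
have -> : T y - Phi y = T x - Phi x.
  by have := T_diff_Phi y x; lra.
by rewrite (le_trans (ler_normB _ _))// (splitr eps) lerD ?XP ?YP.
Qed.

Lemma smoothed_small eps : 0 < eps -> exists Y, forall y, Y <= y -> `|T y| <= eps.
Proof.
move=> e0; have [Y Y0 YP] := Phi_small e0; exists Y => y yY.
by rewrite smoothed_eq YP// (le_trans yY)// ler_norm.
Qed.

Lemma partial_sum_smoothed eps : 0 < eps -> exists N1 : nat, forall N, (N1 <= N)%N ->
  `|series b N.+1| <= eps + 12 * C * B / l.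
Proof.
move=> eps0; have e2 : 0 < eps / 2 by rewrite divr_gt0.
have [Y YP] := smoothed_small e2.
have CB0 : 0 <= C * B by rewrite mulr_ge0 ?C_ge0 ?B_ge0.
pose N0 := Num.truncn l.
have lN0 : l <= N0.+1%:R by rewrite ltW// truncnS_gt.
pose Q := C * B * N0.+1%:R + 1.
have Q0 : 0 < Q by rewrite ltr_pwDr// mulr_ge0.
have [N1 N1P] := ln_unbounded ((Num.max Y (Q / (eps / 2) + l * ln_ N0)) / l).
exists N1 => N /N1P; rewrite ler_pdivrMr// [_ * l]mulrC ge_max => /andP[yY yQ].
set y := l * ln_ N in yY yQ.
pose u n := b n * (W (y - l * ln_ n) - (0 <= y - l * ln_ n)%R%:R).
have su : abs_summable u.
  apply: (@abs_summable_le _ _ (fun n => C * B * aw y n)).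
    by move=> i; exact: le_trans (step_weight y i) (ler_norm _).
  exact/abs_summableZ/atan_weight_summable.
have uE N' : (N < N')%N -> series (bW y) N' - series b N.+1 = series u N'.
  move=> NN'; rewrite /series/= [in RHS](big_cat_nat (leq0n _) NN')//=.
  rewrite [in LHS](big_cat_nat (leq0n _) NN')//= addrAC -sumrB; congr (_ + _).
    apply: eq_big_nat => i /andP[_ iN]; rewrite /u /bW subr_ge0 /y ler_pM2l//.
    by rewrite ler_ln ?posrE// ler_nat iN /=; ring.
  apply: eq_big_nat => i /andP[iN _]; rewrite /u /bW subr_ge0 /y ler_pM2l//.
  by rewrite ler_ln ?posrE// ler_nat leqNgt ltnS iN /= subr0.
have h : `|T y - series b N.+1| <= eps / 2 + 12 * C * B / l.
  apply: (lim_dist_le (abs_summable_cvg (bW_summable y)) (N := maxn N.+1 N0.+1)) => N'.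
  rewrite geq_max => /andP[NN' N0N']; rewrite uE// /series/=.
  apply: le_trans (ler_norm_sum _ _ _) _.
  rewrite (big_cat_nat (leq0n _) N0N')//=; apply: lerD.
    apply: (@le_trans _ _ (\sum_(0 <= n < N0.+1) C * B * (eps / 2 / Q))).
      rewrite !big_nat; apply: ler_sum => n /andP[_ nN0].
      apply: le_trans (step_weight y n) _; rewrite ler_wpM2l//.
      rewrite -invf_div; apply: aw_small; first by rewrite divr_gt0.
      have lnn : l * ln_ n <= l * ln_ N0.
        by rewrite ler_pM2l// ler_ln ?posrE// ler_nat.
      have Q1 : 0 < Q / (eps / 2) by rewrite divr_gt0.
      have h' : Q / (eps / 2) <= y - l * ln_ n.
        by rewrite lerBrDr (le_trans _ yQ)// lerD2l.
      by rewrite distrC ger0_norm// (le_trans _ h')// ltW.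
    rewrite sumr_const_nat subn0 -[_ *+ N0.+1]mulr_natr.
    have -> : C * B * (eps / 2 / Q) * N0.+1%:R = (C * B * N0.+1%:R / Q) * (eps / 2).
      by ring.
    by rewrite ler_piMl ?(ltW e2)// ler_pdivrMr// mul1r /Q lerDl.
  apply: (@le_trans _ _ (\sum_(N0.+1 <= n < N') C * B * aw y n)).
    by apply: ler_sum => n _; exact: step_weight.
  rewrite -mulr_sumr [leRHS](_ : _ = C * B * (12 / l)); last ring.
  by rewrite ler_wpM2l// atan_weight_sum.
have := YP y yY; have := ler_normB (T y) (T y - series b N.+1).
have -> : T y - (T y - series b N.+1) = series b N.+1 by ring.
by lra.
Qed.

End Tauberian.

Theorem real_tauberian (R : realType) (b : R^nat) (C : R) (c0 s0 : R -> R) (M eta : R) :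
  (forall n, `|b n| <= C / n.+1%:R) ->
  boundary_limit (cos_series b) c0 -> boundary_limit (sin_series b) s0 ->
  0 < eta -> (forall u, 0 < u < eta -> `|c0 u| <= M * u) ->
  (forall u, 0 < u < eta -> `|s0 u| <= M * u) ->
  series b n @[n --> \oo] --> (0 : R).
Proof.
move=> bC c0l s0l eta0 c0M s0M.
have [k [W [B [rk Wk WB]]]] := smoothed_step R.
apply/cvgrPdist_le => eps eps0; have e2 : 0 < eps / 2 by rewrite divr_gt0.
pose l := 12 * C * B / (eps / 2) + 1.
have C0 := C_ge0 bC; have B0 := B_ge0 WB.
have q0 : 0 <= 12 * C * B / (eps / 2) by rewrite divr_ge0 ?(ltW e2)// !mulr_ge0.
have l0 : 0 < l by rewrite ltr_pwDr.
have [N1 N1P] := partial_sum_smoothed bC c0l s0l eta0 c0M s0M rk Wk WB l0 e2.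
exists N1.+1 => // -[//|N] /= NN; rewrite sub0r normrN.
apply: le_trans (N1P N NN) _; rewrite [leRHS]splitr lerD2l ler_pdivrMr//.
by rewrite [_ * l]mulrC -ler_pdivrMr// /l lerDl.
Qed.

(** * Complex modulus, exponential and logarithm *)

Section ComplexModulus.
Variable R : realType.
Implicit Types (z w : R[i]) (x y : R).
Local Notation Re := (@complex.Re R).
Local Notation Im := (@complex.Im R).

Definition cabs z : R := ComplexField.Normc.normc z.

Lemma cabsE z : cabs z = Num.sqrt (Re z ^+ 2 + Im z ^+ 2).
Proof. by case: z. Qed.

Lemma normr_cabs z : `|z| = (cabs z)%:C.
Proof. by []. Qed.

Lemma cabs_ge0 z : 0 <= cabs z.
Proof. by rewrite cabsE sqrtr_ge0. Qed.

Lemma sqr_cabs z : cabs z ^+ 2 = Re z ^+ 2 + Im z ^+ 2.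
Proof. by rewrite cabsE sqr_sqrtr// addr_ge0 ?sqr_ge0. Qed.

Lemma cabsM z w : cabs (z * w) = cabs z * cabs w.
Proof. exact: ComplexField.Normc.normcM. Qed.

Lemma cabsV z : cabs z^-1 = (cabs z)^-1.
Proof. exact: ComplexField.Normc.normcV. Qed.

Lemma cabsD z w : cabs (z + w) <= cabs z + cabs w.
Proof. by rewrite -lecR -!normr_cabs rmorphD /= -!normr_cabs ler_normD. Qed.

Lemma cabsN z : cabs (- z) = cabs z.
Proof. by case: z => a b; rewrite !cabsE /= !sqrrN. Qed.

Lemma cabsB z w : cabs (z - w) <= cabs z + cabs w.
Proof. by rewrite -(cabsN w) cabsD. Qed.

Lemma cabsBC z w : cabs (z - w) = cabs (w - z).
Proof. by rewrite -cabsN opprB. Qed.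

Lemma cabs0 : cabs 0 = 0.
Proof. by rewrite cabsE /= expr0n addr0 sqrtr0. Qed.

Lemma cabs1 : cabs 1 = 1.
Proof. by rewrite cabsE /= expr0n addr0 expr1n sqrtr1. Qed.

Lemma cabs_eq0 z : (cabs z == 0) = (z == 0).
Proof. by rewrite -(normr_eq0 z) normr_cabs; apply/eqP/eqP => [->//|[]]. Qed.

Lemma cabs_gt0 z : (0 < cabs z) = (z != 0).
Proof. by rewrite lt_neqAle cabs_ge0 andbT eq_sym cabs_eq0. Qed.

Lemma cabs_real x : cabs x%:C = `|x|.
Proof. by rewrite cabsE /= expr0n addr0 sqrtr_sqr. Qed.

Lemma Re_le_cabs z : `|Re z| <= cabs z.
Proof. by rewrite cabsE -sqrtr_sqr ler_wsqrtr// lerDl sqr_ge0. Qed.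

Lemma Im_le_cabs z : `|Im z| <= cabs z.
Proof. by rewrite cabsE -sqrtr_sqr ler_wsqrtr// lerDr sqr_ge0. Qed.

Lemma cabs_le_ReIm z : cabs z <= `|Re z| + `|Im z|.
Proof.
rewrite -(ler_pXn2r (_ : 0 < 2)%N)// ?nnegrE ?cabs_ge0 ?addr_ge0//.
rewrite sqr_cabs sqrrD !real_normK ?num_real// addrAC lerDl.
by rewrite mulrn_wge0// mulr_ge0.
Qed.

Lemma ReCD z w : Re (z + w) = Re z + Re w. Proof. by case: z; case: w. Qed.
Lemma ImCD z w : Im (z + w) = Im z + Im w. Proof. by case: z; case: w. Qed.
Lemma ReCB z w : Re (z - w) = Re z - Re w. Proof. by case: z; case: w. Qed.
Lemma ImCB z w : Im (z - w) = Im z - Im w. Proof. by case: z; case: w. Qed.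
Lemma ReCN z : Re (- z) = - Re z. Proof. by case: z. Qed.
Lemma ImCN z : Im (- z) = - Im z. Proof. by case: z. Qed.
Lemma ReCM z w : Re (z * w) = Re z * Re w - Im z * Im w.
Proof. by case: z; case: w. Qed.
Lemma ImCM z w : Im (z * w) = Re z * Im w + Im z * Re w.
Proof. by case: z => a b; case: w => c d /=; ring. Qed.
Lemma ReCMr z x : Re (z * x%:C) = Re z * x. Proof. by rewrite ReCM /= mulr0 subr0. Qed.
Lemma ImCMr z x : Im (z * x%:C) = Im z * x. Proof. by rewrite ImCM /= mulr0 add0r. Qed.

Lemma complex_ext z w : Re z = Re w -> Im z = Im w -> z = w.
Proof. by case: z => a b; case: w => c d /= -> ->. Qed.

Lemma Re_sum (I : Type) (s : seq I) (P : pred I) (F : I -> R[i]) :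
  Re (\sum_(i <- s | P i) F i) = \sum_(i <- s | P i) Re (F i).
Proof. by elim/big_ind2: _ => // z a w b <- <-; exact: ReCD. Qed.

Lemma Im_sum (I : Type) (s : seq I) (P : pred I) (F : I -> R[i]) :
  Im (\sum_(i <- s | P i) F i) = \sum_(i <- s | P i) Im (F i).
Proof. by elim/big_ind2: _ => // z a w b <- <-; exact: ImCD. Qed.

Lemma cabs_sum (I : Type) (s : seq I) (P : pred I) (F : I -> R[i]) :
  cabs (\sum_(i <- s | P i) F i) <= \sum_(i <- s | P i) cabs (F i).
Proof.
elim/big_ind2: _ => [|z a w b za wb|//]; first by rewrite cabs0.
exact: le_trans (cabsD _ _) (lerD za wb).
Qed.

Lemma cabs_inv1D w : cabs w <= 1 / 2 -> cabs (1 + w)^-1 <= 2.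
Proof.
move=> w2; rewrite cabsV -[2]invrK.
have : 2^-1 <= cabs (1 + w).
  have := cabsB (1 + w) w; rewrite addrK cabs1; lra.
by move=> h; rewrite lef_pV2// posrE//; lra.
Qed.

End ComplexModulus.

Section ComplexExp.
Variable R : realType.
Implicit Types (z w : R[i]) (x y : R).
Local Notation Re := (@complex.Re R).
Local Notation Im := (@complex.Im R).

Lemma Re_expC z : Re (expC z) = expR (Re z) * cos (Im z).
Proof. by rewrite /expC ReCM /= mul0r subr0. Qed.

Lemma Im_expC z : Im (expC z) = expR (Re z) * sin (Im z).
Proof. by rewrite /expC ImCM /= mul0r addr0. Qed.

Lemma expCD z w : expC (z + w) = expC z * expC w.
Proof.
apply: complex_ext.
  by rewrite Re_expC ReCM !Re_expC !Im_expC ReCD ImCD expRD cosD; ring.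
by rewrite Im_expC ImCM !Re_expC !Im_expC ReCD ImCD expRD sinD; ring.
Qed.

Lemma expC0 : expC (0 : R[i]) = 1.
Proof.
by apply: complex_ext; rewrite ?Re_expC ?Im_expC /= expR0 ?cos0 ?sin0 ?mulr1 ?mulr0.
Qed.

Lemma cabs_expC z : cabs (expC z) = expR (Re z).
Proof.
rewrite cabsE Re_expC Im_expC !exprMn -mulrDr cos2Dsin2 mulr1 sqrtr_sqr.
by rewrite ger0_norm// expR_ge0.
Qed.

Lemma expC_neq0 z : expC z != 0.
Proof. by rewrite -cabs_gt0 cabs_expC expR_gt0. Qed.

Lemma expCN z : expC (- z) = (expC z)^-1.
Proof.
by apply: (mulIf (expC_neq0 z)); rewrite -expCD addNr expC0 mulVf// expC_neq0.
Qed.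

Lemma expCB z w : expC (z - w) = expC z / expC w.
Proof. by rewrite expCD expCN. Qed.

Lemma expC_sum (I : Type) (s : seq I) (P : pred I) (F : I -> R[i]) :
  expC (\sum_(i <- s | P i) F i) = \prod_(i <- s | P i) expC (F i).
Proof. by elim/big_rec2: _ => [|i z w _ <-]; rewrite ?expC0// expCD. Qed.

Lemma expC_eq z w : expC z = expC w -> `|Im z - Im w| < 2 * pi -> z = w.
Proof.
move=> zw im; have e1 : expC (z - w) = 1 by rewrite expCB zw divff// expC_neq0.
have re0 : Re (z - w) = 0.
  have := cabs_expC (z - w); rewrite e1 cabs1 => /esym/eqP.
  by rewrite -expR0 (inj_eq (@expR_inj R)) => /eqP.
have c1 : cos (Im (z - w)) = 1.
  by have := Re_expC (z - w); rewrite e1 re0 expR0 mul1r /= => <-.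
have im0 : Im (z - w) = 0.
  rewrite -ImCB in im; move: (Im _) c1 im => x c1 im.
  apply/eqP; case: eqP => // /eqP x0; exfalso.
  have := @cos_mulr2n R (`|x| / 2).
  have -> : `|x| / 2 *+ 2 = `|x| by rewrite -mulr_natr divfK.
  rewrite cos_norm c1 => h.
  have s2 : sin (`|x| / 2) ^+ 2 = 0 by rewrite sin2cos2; lra.
  have : 0 < sin (`|x| / 2).
    apply: sin_gt0_pi; rewrite divr_gt0 ?normr_gt0//= ltr_pdivrMr// mulrC//.
  by move/eqP : s2; rewrite sqrf_eq0 => /eqP ->; rewrite ltxx.
by apply/eqP; rewrite -subr_eq0; apply/eqP/complex_ext.
Qed.

Lemma expR_lipschitz x y c : x <= c -> y <= c -> `|expR x - expR y| <= expR c * `|x - y|.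
Proof.
suff H u v : v <= c -> u < v -> `|expR v - expR u| <= expR c * `|v - u|.
  move=> xc yc; have [xy|yx|->] := ltgtP x y; last by rewrite !subrr normr0 mulr0.
    by rewrite distrC (distrC x) H.
  exact: H.
move=> vc uv; have [t /andP[_ tv] ->] := MVT_all (fun t => is_derive_expR t) uv.
rewrite normrM ler_wpM2r// ger0_norm ?expR_ge0// ler_expR.
by rewrite ltW// (lt_le_trans tv).
Qed.

Lemma expC_lipschitz z w c : Re z <= c -> Re w <= c ->
  cabs (expC z - expC w) <= 4 * expR c * cabs (z - w).
Proof.
move=> zc wc; apply: le_trans (cabs_le_ReIm _) _.
have re : `|Re z - Re w| <= cabs (z - w) by rewrite -ReCB Re_le_cabs.
have im : `|Im z - Im w| <= cabs (z - w) by rewrite -ImCB Im_le_cabs.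
have e0 := expR_gt0 c.
have key (f : R -> R) : (forall x, `|f x| <= 1) ->
    (forall x y, `|f x - f y| <= `|x - y|) ->
    `|expR (Re z) * f (Im z) - expR (Re w) * f (Im w)| <= 2 * expR c * cabs (z - w).
  move=> f1 fl.
  have -> : expR (Re z) * f (Im z) - expR (Re w) * f (Im w) =
    (expR (Re z) - expR (Re w)) * f (Im z) + expR (Re w) * (f (Im z) - f (Im w)) by ring.
  rewrite (le_trans (ler_normD _ _))// !normrM.
  rewrite (_ : 2 * _ * _ = expR c * cabs (z - w) * 1 + expR c * cabs (z - w)); last ring.
  apply: lerD; apply: ler_pM => //.
  - by rewrite (le_trans (expR_lipschitz zc wc))// ler_wpM2l// ltW.
  - by rewrite ger0_norm ?expR_ge0// ler_expR.
  - exact: le_trans (fl _ _) im.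
rewrite ReCB ImCB !Re_expC !Im_expC.
have := key _ (@cos_max R) (@cos_lipschitz R).
have := key _ (@sin_max R) (@sin_lipschitz R).
by lra.
Qed.

End ComplexExp.

Section ComplexLog.
Variable R : realType.
Implicit Types (z w : R[i]) (x y : R).
Local Notation Re := (@complex.Re R).
Local Notation Im := (@complex.Im R).

Definition logC w : R[i] := ln (cabs w) +i* atan (Im w / Re w).

Lemma logCK w : 0 < Re w -> expC (logC w) = w.
Proof.
move=> w0; have wn : w != 0.
  by apply: contraTneq w0 => ->; rewrite ltxx.
have c0 : 0 < cabs w by rewrite cabs_gt0.
have rn : Re w != 0 by rewrite gt_eqF.
have cE : cos (atan (Im w / Re w)) = Re w / cabs w.
  rewrite cos_atan (_ : 1 + _ = (cabs w / Re w) ^+ 2); last first.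
    by rewrite [RHS]expr_div_n sqr_cabs; field.
  by rewrite sqrtr_sqr ger0_norm ?invf_div// divr_ge0 ?cabs_ge0 ?(ltW w0).
have sE : sin (atan (Im w / Re w)) = Im w / cabs w.
  have ct : cos (atan (Im w / Re w)) != 0.
    by rewrite cE mulf_neq0// invr_neq0 ?gt_eqF.
  have := atanK (Im w / Re w); rewrite /tan => /(canRL (mulfVK ct)) ->.
  by rewrite cE; field; rewrite rn gt_eqF.
apply: complex_ext; rewrite ?Re_expC ?Im_expC /= lnK ?posrE// ?cE ?sE.
  by rewrite mulrC divfK ?gt_eqF.
by rewrite mulrC divfK ?gt_eqF.
Qed.

Lemma Im_logC w : `|Im (logC w)| < pi / 2.
Proof. by rewrite /= ltr_norml atan_gtNpi2 atan_ltpi2. Qed.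

Lemma atan_sub_le x : `|atan x - x| <= x ^+ 2.
Proof.
suff H y : 0 < y -> `|atan y - y| <= y ^+ 2.
  have [x0|x0|->] := ltgtP x 0; last by rewrite atan0 subrr normr0 expr0n.
    by have := H (- x); rewrite oppr_gt0 atanN -opprD normrN sqrrN; exact.
  exact: H.
move=> y0; pose f t : R := atan t - t.
have df t : is_derive t (1 : R) f ((1 + t ^+ 2)^-1 - 1).
  exact: (derB (is_derive1_atan t) (der_id t)).
have [z /andP[z0 zy]] := MVT_all df y0.
rewrite /f atan0 !subr0 => ->; rewrite normrM (gtr0_norm y0) expr2 ler_wpM2r ?(ltW y0)//.
have z2 : 0 < 1 + z ^+ 2 by rewrite ltr_pwDl// sqr_ge0.
rewrite (_ : _ - 1 = - (z ^+ 2 / (1 + z ^+ 2))); last by field; rewrite gt_eqF.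
rewrite normrN ger0_norm ?divr_ge0 ?sqr_ge0 ?(ltW z2)// ler_pdivrMr//.
apply: (@le_trans _ _ (z * (1 + z ^+ 2))); last by rewrite ler_wpM2r ?ltW.
have : 0 <= z * (z - 1 / 2) ^+ 2 by rewrite mulr_ge0 ?sqr_ge0// ltW.
by nra.
Qed.

Lemma ln_sub_le (v : R) : - (3 / 4) <= v -> `|ln (1 + v) - v| <= 4 * v ^+ 2.
Proof.
move=> v0; have v1 : 0 < 1 + v by lra.
have h1 : ln (1 + v) <= v by apply: le_ln1Dx; lra.
have h2 : v / (1 + v) <= ln (1 + v).
  have := @le_ln1Dx R (- (v / (1 + v))).
  have e : 1 + - (v / (1 + v)) = (1 + v)^-1 by field; rewrite gt_eqF.
  rewrite e lnV ?posrE// lerN2; apply.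
  by rewrite -(ltrD2l 1) e subrr invr_gt0.
have h3 : v / (1 + v) = v - v ^+ 2 / (1 + v) by field; rewrite gt_eqF.
have h4 : v ^+ 2 / (1 + v) <= 4 * v ^+ 2.
  by rewrite ler_pdivrMr//; have := sqr_ge0 v; nra.
by rewrite ler0_norm; lra.
Qed.

Lemma logC1D_le w : cabs w <= 1 / 2 -> cabs (logC (1 + w) - w) <= 19 * cabs w ^+ 2.
Proof.
move=> w2; set m := cabs w in w2 *; set x := Re w; set y := Im w.
have m0 : 0 <= m by exact: cabs_ge0.
have xm : `|x| <= m by exact: Re_le_cabs.
have ym : `|y| <= m by exact: Im_le_cabs.
have m2 : m ^+ 2 = x ^+ 2 + y ^+ 2 by exact: sqr_cabs.
have x1 : 1 / 2 <= 1 + x by move: xm; rewrite ler_norml => /andP[]; lra.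
have re : `|Re (logC (1 + w) - w)| <= 13 * m ^+ 2.
  rewrite ReCB /= -/x.
  pose v := 2 * x + m ^+ 2.
  have cE : cabs (1 + w) ^+ 2 = 1 + v.
    by rewrite sqr_cabs ReCD ImCD /= add0r -/x -/y /v m2; ring.
  have v34 : - (3 / 4) <= v.
    have : (1 / 2) ^+ 2 <= (1 + x) ^+ 2 by rewrite lerXn2r ?nnegrE//; lra.
    by have := sqr_ge0 y; rewrite /v m2; nra.
  have v1 : 0 < 1 + v by lra.
  have c0 : 0 < cabs (1 + w).
    rewrite lt_neqAle cabs_ge0 andbT eq_sym; apply: contraTneq v1.
    by rewrite -cE => ->; rewrite expr0n ltxx.
  have lE : ln (1 + v) = 2 * ln (cabs (1 + w)).
    by rewrite -cE lnXn// mulr_natl.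
  have vm : v ^+ 2 <= 25 / 4 * m ^+ 2.
    have : `|v| <= 5 / 2 * m.
      rewrite (le_trans (ler_normD _ _))// (normrM 2 x) (ger0_norm (sqr_ge0 m)) ger0_norm//.
      by nra.
    rewrite -[v ^+ 2]real_normK ?num_real// => h.
    have -> : 25 / 4 * m ^+ 2 = (5 / 2 * m) ^+ 2 by field.
    by rewrite lerXn2r ?nnegrE//; lra.
  have := ln_sub_le v34; rewrite lE.
  have -> : ln (cabs (1 + w)) - x =
    (2 * ln (cabs (1 + w)) - v) / 2 + m ^+ 2 / 2 by rewrite /v; field.
  move=> h; rewrite (le_trans (ler_normD _ _))// (normrM (_ - _)) (normrM (m ^+ 2)).
  by rewrite (ger0_norm (sqr_ge0 m)) (@ger0_norm _ (2^-1))//; lra.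
have im : `|Im (logC (1 + w) - w)| <= 6 * m ^+ 2.
  rewrite ImCB /= ReCD ImCD /= add0r -/x -/y.
  have x0 : 0 < 1 + x by lra.
  pose q := y / (1 + x).
  have qm : `|q| <= 2 * m.
    by rewrite normrM normfV (gtr0_norm x0) ler_pdivrMr//; nra.
  have q2 : q ^+ 2 <= 4 * m ^+ 2.
    rewrite -[q ^+ 2]real_normK ?num_real//.
    have -> : 4 * m ^+ 2 = (2 * m) ^+ 2 by ring.
    by rewrite lerXn2r ?nnegrE// mulr_ge0.
  have qy : `|q - y| <= 2 * m ^+ 2.
    have -> : q - y = - (q * x) by rewrite /q; field; rewrite gt_eqF.
    rewrite normrN normrM expr2 mulrA.
    by apply: ler_pM.
  rewrite -(subrKA q) (le_trans (ler_normD _ _))//.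
  by have := atan_sub_le q; rewrite -/q; lra.
apply: le_trans (cabs_le_ReIm _) _; lra.
Qed.

Lemma logC1D_le20 w : cabs w <= 1 / 2 -> cabs (logC (1 + w)) <= 20 * cabs w.
Proof.
move=> w2; rewrite -(subrK w (logC (1 + w))) (le_trans (cabsD _ _))//.
have := logC1D_le w2; have := cabs_ge0 w; nra.
Qed.

Lemma Re1D_gt0 w : cabs w <= 1 / 2 -> 0 < Re (1 + w).
Proof.
move=> w2; rewrite ReCD /=; have := Re_le_cabs w.
by rewrite ler_norml => /andP[]; lra.
Qed.

Lemma logC_ratio (u v : R[i]) : cabs u <= 1 / 2 -> cabs v <= 1 / 2 -> cabs (u - v) <= 1 / 4 ->
  logC (1 + u) - logC (1 + v) = logC (1 + (u - v) / (1 + v)).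
Proof.
move=> u2 v2 uv.
have v0 : 1 + v != 0.
  by apply: contraTneq (Re1D_gt0 v2) => ->; rewrite ltxx.
have z2 : cabs ((u - v) / (1 + v)) <= 1 / 2.
  rewrite cabsM (_ : 1 / 2 = 1 / 4 * 2); last by field.
  by rewrite ler_pM ?cabs_ge0 ?cabs_inv1D.
apply: expC_eq.
  rewrite expCB !logCK ?Re1D_gt0//.
  by field.
rewrite ImCB.
have := Im_logC (1 + u); have := Im_logC (1 + v).
have := Im_logC (1 + (u - v) / (1 + v)).
have := @pi_gt0 R.
rewrite !ltr_norml => p0 /andP[a1 a2] /andP[b1 b2] /andP[c1 c2].
by apply/andP; split; lra.
Qed.

Definition logC_rem z : R[i] := - logC (1 - z) - z.

Lemma logC_rem_le z : cabs z <= 1 / 2 -> cabs (logC_rem z) <= 19 * cabs z ^+ 2.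
Proof.
move=> z2; rewrite /logC_rem -cabsN opprD !opprK -(cabsN z) -[X in _ + X]opprK.
by apply: logC1D_le; rewrite cabsN.
Qed.

Lemma logC_rem_lipschitz z w (m : R) : m <= 1 / 2 -> cabs z <= m -> cabs w <= m ->
  cabs (logC_rem z - logC_rem w) <= 154 * m * cabs (z - w).
Proof.
move=> m2 zm wm; have m0 : 0 <= m by exact: le_trans (cabs_ge0 z) zm.
have zw0 := cabs_ge0 (z - w).
have z2 := le_trans zm m2; have w2 := le_trans wm m2.
have [small|big] := leP (cabs (z - w)) (1 / 4); last first.
  have sq u : cabs u <= m -> cabs (logC_rem u) <= 19 * m ^+ 2.
    move=> um; apply: le_trans (logC_rem_le (le_trans um m2)) _.
    by rewrite ler_wpM2l// lerXn2r ?nnegrE ?cabs_ge0.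
  apply: le_trans (cabsB _ _) _.
  have := sq z zm; have := sq w wm.
  have : m * (1 / 4) <= m * cabs (z - w) by rewrite ler_wpM2l// ltW.
  by nra.
have wN0 : 1 - w != 0.
  by apply: contraTneq (Re1D_gt0 (_ : cabs (- w) <= 1 / 2)) => [->|]; rewrite ?ltxx ?cabsN.
pose ze := (w - z) / (1 - w).
have zeE : - z - - w = w - z by ring.
have zem : cabs ze <= 2 * cabs (z - w).
  rewrite cabsM cabsBC mulrC ler_wpM2r//.
  by apply: cabs_inv1D; rewrite cabsN.
have ze2 : cabs ze <= 1 / 2 by lra.
have rat := @logC_ratio (- z) (- w); rewrite !cabsN zeE in rat.
have {}rat := rat z2 w2 _; rewrite cabsBC in rat; have {}rat := rat small.
have -> : logC_rem z - logC_rem w = - (logC (1 + ze) - ze) + (z - w) * (w / (1 - w)).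
  rewrite /ze -rat /logC_rem; field; exact: wN0.
apply: le_trans (cabsD _ _) _; rewrite cabsN.
have h1 := logC1D_le ze2.
have h2 : cabs ((z - w) * (w / (1 - w))) <= cabs (z - w) * (m * 2).
  rewrite !cabsM ler_wpM2l// ler_pM ?cabs_ge0//.
  by apply: cabs_inv1D; rewrite cabsN.
have h3 : cabs ze ^+ 2 <= (2 * cabs (z - w)) ^+ 2.
  by rewrite lerXn2r ?nnegrE ?cabs_ge0// mulr_ge0.
have h4 : cabs (z - w) <= 2 * m.
  by apply: le_trans (cabsB _ _) _; lra.
have h5 : cabs (z - w) ^+ 2 <= cabs (z - w) * (2 * m) by rewrite expr2 ler_wpM2l.
by lra.
Qed.

End ComplexLog.

Section ComplexSeries.
Variable R : realType.
Implicit Types (u v : nat -> R[i]).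
Local Notation Re := (@complex.Re R).
Local Notation Im := (@complex.Im R).

Definition csummable u := abs_summable (fun n => cabs (u n)).

Definition csum u : R[i] :=
  limn (series (fun n => Re (u n))) +i* limn (series (fun n => Im (u n))).

Lemma csummable_le u (w : R^nat) : (forall n, cabs (u n) <= w n) -> abs_summable w ->
  csummable u.
Proof.
move=> uw sw; apply: abs_summable_le sw => i.
by rewrite ger0_norm ?cabs_ge0// (le_trans (uw i))// ler_norm.
Qed.

Lemma csummable_Re u : csummable u -> abs_summable (fun n => Re (u n)).
Proof. by apply: abs_summable_le => i; rewrite (le_trans (Re_le_cabs _))// ler_norm. Qed.

Lemma csummable_Im u : csummable u -> abs_summable (fun n => Im (u n)).
Proof. by apply: abs_summable_le => i; rewrite (le_trans (Im_le_cabs _))// ler_norm. Qed.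

Lemma csummableD u v : csummable u -> csummable v -> csummable (fun n => u n + v n).
Proof.
move=> su sv; apply: csummable_le (abs_summableD su sv) => n.
exact: cabsD.
Qed.

Lemma lim_abs_summableD (p q : R^nat) : abs_summable p -> abs_summable q ->
  limn (series (fun n => p n + q n)) = limn (series p) + limn (series q).
Proof.
move=> sp sq; have cp := abs_summable_cvg sp; have cq := abs_summable_cvg sq.
rewrite (_ : series _ = series p \+ series q) ?limD//.
by apply/funext => N; rewrite /series/= big_split.
Qed.

Lemma csumD u v : csummable u -> csummable v ->
  csum (fun n => u n + v n) = csum u + csum v.
Proof.
move=> su sv; apply: complex_ext => /=.
  under eq_fun do rewrite ReCD.
  by rewrite lim_abs_summableD//; exact: csummable_Re.
under eq_fun do rewrite ImCD.
by rewrite lim_abs_summableD//; exact: csummable_Im.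
Qed.

Lemma csum_finite u N : (forall n, (N <= n)%N -> u n = 0) ->
  csum u = \sum_(0 <= n < N) u n.
Proof.
move=> u0; apply: complex_ext; rewrite ?Re_sum ?Im_sum /=.
  apply: lim_near_cst => //; exists N => // N' /= NN'.
  rewrite /series/= (big_cat_nat (leq0n _) NN')//= [X in _ + X]big_nat.
  by rewrite [X in _ + X]big1 ?addr0// => i /andP[/u0 ->].
apply: lim_near_cst => //; exists N => // N' /= NN'.
rewrite /series/= (big_cat_nat (leq0n _) NN')//= [X in _ + X]big_nat.
by rewrite [X in _ + X]big1 ?addr0// => i /andP[/u0 ->].
Qed.

Lemma csumB_le u v B : csummable u -> csummable v ->
  (forall N, \sum_(0 <= n < N) cabs (u n - v n) <= B) ->
  cabs (csum u - csum v) <= 2 * B.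
Proof.
move=> su sv uvB; apply: le_trans (cabs_le_ReIm _) _.
rewrite ReCB ImCB /= mulr_natl mulr2n; apply: lerD.
  apply: lim_seriesB_le (csummable_Re su) (csummable_Re sv) _ => N.
  apply: le_trans (uvB N); apply: ler_sum => i _.
  by rewrite -ReCB Re_le_cabs.
apply: lim_seriesB_le (csummable_Im su) (csummable_Im sv) _ => N.
apply: le_trans (uvB N); apply: ler_sum => i _.
by rewrite -ImCB Im_le_cabs.
Qed.

Lemma csum_remainder u (eps : R) : csummable u -> 0 < eps ->
  exists M : nat, forall N, (M <= N)%N ->
    cabs (csum u - \sum_(0 <= n < N) u n) <= eps.
Proof.
move=> su e0; have e2 : 0 < eps / 2 by rewrite divr_gt0.
have [M1 M1P] := abs_summable_remainder (csummable_Re su) e2.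
have [M2 M2P] := abs_summable_remainder (csummable_Im su) e2.
exists (maxn M1 M2) => N; rewrite geq_max => /andP[N1 N2].
apply: le_trans (cabs_le_ReIm _) _; rewrite ReCB ImCB Re_sum Im_sum (splitr eps).
by apply: lerD; [exact: M1P|exact: M2P].
Qed.

End ComplexSeries.

(** * The complex Tauberian theorem *)

Section ComplexTauberian.
Variable R : realType.
Local Notation Re := (@complex.Re R).
Local Notation Im := (@complex.Im R).

Lemma boundary_limit_eq (F F' : R -> R -> R) f :
  (forall d t, 0 < d -> F d t = F' d t) -> boundary_limit F f -> boundary_limit F' f.
Proof.
move=> FF' H t eps e0; have [r r0 rF] := H t eps e0; exists r => // t' d tr dr.
by rewrite -FF'; [exact: rF|case/andP : dr].
Qed.

Lemma boundary_limit_sym (F : R -> R -> R) f (a b : R) : boundary_limit F f ->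
  boundary_limit (fun d t => a * F d t + b * F d (- t)) (fun t => a * f t + b * f (- t)).
Proof.
move=> H t eps e0; pose Q := `|a| + `|b| + 1.
have Q0 : 0 < Q by rewrite ltr_pwDr// addr_ge0.
have eQ : 0 < eps / Q by rewrite divr_gt0.
have [r1 r10 r1F] := H t _ eQ; have [r2 r20 r2F] := H (- t) _ eQ.
exists (Num.min r1 r2); first by rewrite lt_min r10 r20.
move=> t' d; rewrite !lt_min => /andP[t1 t2] /andP[d0 /andP[d1 d2]].
have h1 : `|F d t' - f t| <= eps / Q by apply: r1F => //; rewrite d0.
have h2 : `|F d (- t') - f (- t)| <= eps / Q.
  by apply: r2F; rewrite ?d0// -opprD normrN.
have -> : a * F d t' + b * F d (- t') - (a * f t + b * f (- t)) =
   a * (F d t' - f t) + b * (F d (- t') - f (- t)) by ring.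
rewrite (le_trans (ler_normD _ _))// !normrM.
apply: (@le_trans _ _ (`|a| * (eps / Q) + `|b| * (eps / Q))).
  by apply: lerD; rewrite ler_wpM2l.
rewrite -mulrDl mulrCA ger_pMr// ler_pdivrMr// mul1r /Q lerDl//.
Qed.

Variables (b : nat -> R[i]) (C : R) (h : R -> R[i]) (M eta : R).
Hypothesis bC : forall n, cabs (b n) <= C / n.+1%:R.

(* The real and imaginary parts of [G d t] and [G d (- t)] determine the cosine
   and sine series of the real sequences [be] and [ga]. *)
Let G (d t : R) := csum (fun n => b n * expC (- ((d +i* t) * (lnS R n)%:C))).
Let be n := Re (b n).
Let ga n := Im (b n).

Let beC n : `|be n| <= C / n.+1%:R.
Proof. exact: le_trans (Re_le_cabs _) (bC n). Qed.

Let gaC n : `|ga n| <= C / n.+1%:R.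
Proof. exact: le_trans (Im_le_cabs _) (bC n). Qed.

Let termE d t n : b n * expC (- ((d +i* t) * (lnS R n)%:C)) =
  (dirichlet_term be d n * cos (t * lnS R n) + dirichlet_term ga d n * sin (t * lnS R n))
  +i* (dirichlet_term ga d n * cos (t * lnS R n) - dirichlet_term be d n * sin (t * lnS R n)).
Proof.
have re : Re (- ((d +i* t) * (lnS R n)%:C)) = - d * lnS R n.
  by rewrite ReCN ReCMr mulNr.
have im : Im (- ((d +i* t) * (lnS R n)%:C)) = - (t * lnS R n).
  by rewrite ImCN ImCMr.
apply: complex_ext.
  by rewrite ReCM Re_expC Im_expC re im cosN sinN /= /dirichlet_term /be /ga; ring.
by rewrite ImCM Re_expC Im_expC re im cosN sinN /= /dirichlet_term /be /ga; ring.
Qed.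

Let cos_summable (c : R^nat) d t : (forall n, `|c n| <= C / n.+1%:R) -> 0 < d ->
  abs_summable (fun n => dirichlet_term c d n * cos (t * lnS R n)).
Proof.
move=> cC d0; apply: abs_summable_le (dirichlet_term_summable cC d0) => n.
by rewrite normrM ler_piMr// cos_max.
Qed.

Let sin_summable (c : R^nat) d t : (forall n, `|c n| <= C / n.+1%:R) -> 0 < d ->
  abs_summable (fun n => dirichlet_term c d n * sin (t * lnS R n)).
Proof.
move=> cC d0; apply: abs_summable_le (dirichlet_term_summable cC d0) => n.
by rewrite normrM ler_piMr// sin_max.
Qed.

Let ReG d t : 0 < d -> Re (G d t) = cos_series be d t + sin_series ga d t.
Proof.
move=> d0; rewrite /G /=; under eq_fun do rewrite termE /=.
by rewrite lim_abs_summableD//; [exact: cos_summable|exact: sin_summable].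
Qed.

Let sin_seriesN (c : R^nat) d t : (forall n, `|c n| <= C / n.+1%:R) -> 0 < d ->
  limn (series (fun n => - (dirichlet_term c d n * sin (t * lnS R n)))) = - sin_series c d t.
Proof.
move=> cC d0; have cs := abs_summable_cvg (sin_summable t cC d0).
rewrite /sin_series -limN//; congr (limn _).
by apply/funext => N; rewrite /series/= sumrN.
Qed.

Let ImG d t : 0 < d -> Im (G d t) = cos_series ga d t - sin_series be d t.
Proof.
move=> d0; rewrite /G /=; under eq_fun do rewrite termE /=.
rewrite lim_abs_summableD ?sin_seriesN//; first exact: cos_summable.
by apply: abs_summable_le (sin_summable t beC d0) => n; rewrite normrN.
Qed.

Let cos_seriesE (c : R^nat) d t : cos_series c d (- t) = cos_series c d t.
Proof. by rewrite /cos_series; under eq_fun do rewrite mulNr cosN. Qed.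

Let sin_seriesE (c : R^nat) d t : (forall n, `|c n| <= C / n.+1%:R) -> 0 < d ->
  sin_series c d (- t) = - sin_series c d t.
Proof.
move=> cC d0; rewrite -sin_seriesN// /sin_series.
by under eq_fun do rewrite mulNr sinN mulrN.
Qed.

Hypothesis Gh : forall t eps : R, 0 < eps -> exists2 r : R, 0 < r &
  forall t' d : R, `|t' - t| < r -> 0 < d < r -> cabs (G d t' - h t) <= eps.
Hypothesis eta0 : 0 < eta.
Hypothesis h_lin : forall u, `|u| < eta -> cabs (h u) <= M * `|u|.

Let ReGh : boundary_limit (fun d t => Re (G d t)) (fun t => Re (h t)).
Proof.
move=> t eps e0; have [r r0 rG] := Gh t e0; exists r => // t' d tr dr.
by rewrite -ReCB (le_trans (Re_le_cabs _))// rG.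
Qed.

Let ImGh : boundary_limit (fun d t => Im (G d t)) (fun t => Im (h t)).
Proof.
move=> t eps e0; have [r r0 rG] := Gh t e0; exists r => // t' d tr dr.
by rewrite -ImCB (le_trans (Im_le_cabs _))// rG.
Qed.

Let half_lin (f : R[i] -> R) (s1 s2 u : R) : (forall z, `|f z| <= cabs z) ->
  `|s1| = 2^-1 -> `|s2| = 2^-1 -> 0 < u < eta ->
  `|s1 * f (h u) + s2 * f (h (- u))| <= M * u.
Proof.
move=> fc s1h s2h /andP[u0 ue].
rewrite (le_trans (ler_normD _ _))// !normrM s1h s2h.
have un : `|u| < eta by rewrite gtr0_norm.
have unN : `|- u| < eta by rewrite normrN.
have := le_trans (fc _) (h_lin un); have := le_trans (fc _) (h_lin unN).
by rewrite normrN (gtr0_norm u0); lra.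
Qed.

Let half_norm : `|2^-1 : R| = 2^-1.
Proof. by rewrite ger0_norm. Qed.

Let half_normN : `|- 2^-1 : R| = 2^-1.
Proof. by rewrite normrN half_norm. Qed.

Lemma complex_tauberian (eps : R) : 0 < eps -> exists N0 : nat, forall N, (N0 <= N)%N ->
  cabs (\sum_(0 <= n < N) b n) <= eps.
Proof.
move=> e0; have e2 : 0 < eps / 2 by rewrite divr_gt0.
have re : series be n @[n --> \oo] --> (0 : R).
  apply: (real_tauberian beC _ _ eta0 (c0 := fun t => 2^-1 * Re (h t) + 2^-1 * Re (h (- t)))
    (s0 := fun t => - 2^-1 * Im (h t) + 2^-1 * Im (h (- t))) (M := M)).
  - apply: boundary_limit_eq (boundary_limit_sym 2^-1 2^-1 ReGh) => d t d0.
    by rewrite !ReG// cos_seriesE sin_seriesE//; field.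
  - apply: boundary_limit_eq (boundary_limit_sym (- 2^-1) 2^-1 ImGh) => d t d0.
    by rewrite !ImG// cos_seriesE sin_seriesE//; field.
  - by move=> u; apply: half_lin => //; exact: Re_le_cabs.
  - by move=> u; apply: half_lin => //; exact: Im_le_cabs.
have im : series ga n @[n --> \oo] --> (0 : R).
  apply: (real_tauberian gaC _ _ eta0 (c0 := fun t => 2^-1 * Im (h t) + 2^-1 * Im (h (- t)))
    (s0 := fun t => 2^-1 * Re (h t) + - 2^-1 * Re (h (- t))) (M := M)).
  - apply: boundary_limit_eq (boundary_limit_sym 2^-1 2^-1 ImGh) => d t d0.
    by rewrite !ImG// cos_seriesE sin_seriesE//; field.
  - apply: boundary_limit_eq (boundary_limit_sym 2^-1 (- 2^-1) ReGh) => d t d0.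
    by rewrite !ReG// cos_seriesE sin_seriesE//; field.
  - by move=> u; apply: half_lin => //; exact: Im_le_cabs.
  - by move=> u; apply: half_lin => //; exact: Re_le_cabs.
move/cvgrPdist_le/(_ _ e2) : re => [N1 _ N1P].
move/cvgrPdist_le/(_ _ e2) : im => [N2 _ N2P].
exists (maxn N1 N2) => N; rewrite geq_max => /andP[h1 h2].
apply: le_trans (cabs_le_ReIm _) _; rewrite Re_sum Im_sum (splitr eps).
have := N1P N h1; have := N2P N h2; rewrite !sub0r !normrN => g1 g2.
exact: lerD.
Qed.

End ComplexTauberian.

(** * Euler products up to the boundary line *)

Section GroupedEulerProduct.
Variable R : realType.
Local Notation Re := (@complex.Re R).
Local Notation Im := (@complex.Im R).
Local Notation ln_ := (lnS R).
Implicit Types (s z : R[i]).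

Lemma lnS0 : ln_ 0 = 0.
Proof. by rewrite /lnS ln1. Qed.

Lemma mulx_expRN_le (c x : R) : 0 < c -> x * expR (- c * x) <= 2 / c * expR (- (c / 2) * x).
Proof.
move=> c0; have -> : expR (- c * x) = expR (- (c / 2) * x) * expR (- (c / 2) * x).
  by rewrite -expRD; congr expR; field.
rewrite mulrA ler_wpM2r ?expR_ge0// mulNr expRN ler_pdivrMr ?expR_gt0//.
have c2 : 0 < 2 / c by rewrite divr_gt0.
have h : 2 / c * (1 + c / 2 * x) <= 2 / c * expR (c / 2 * x).
  by rewrite ler_pM2l// expR_ge1Dx.
have e : 2 / c * (1 + c / 2 * x) = 2 / c + x by field; rewrite gt_eqF.
by lra.
Qed.

Definition pw (n : nat) s : R[i] := expC (- (s * (ln_ n)%:C)).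

Lemma cabs_pw n s : cabs (pw n s) = expR (- Re s * ln_ n).
Proof. by rewrite /pw cabs_expC ReCN ReCMr mulNr. Qed.

Lemma pwD n s z : pw n (s + z) = pw n s * expC (- (z * (ln_ n)%:C)).
Proof. by rewrite /pw mulrDl opprD expCD. Qed.

Lemma expRN_lnS n : expR (- ln_ n) = n.+1%:R^-1.
Proof. by rewrite expRN expR_lnS. Qed.

Lemma cabs_pw_le n s : 1 <= Re s -> cabs (pw n s) <= n.+1%:R^-1.
Proof.
move=> s1; rewrite cabs_pw -(expRN_lnS n) ler_expR mulNr lerN2.
by rewrite ler_peMl// lnS_ge0.
Qed.

Lemma pw_lipschitz n s z (c : R) : c <= Re s -> c <= Re z ->
  cabs (pw n s - pw n z) <= 4 * cabs (s - z) * (ln_ n * expR (- c * ln_ n)).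
Proof.
move=> cs cz; have l0 := lnS_ge0 R n.
have bnd u : c <= Re u -> Re (- (u * (ln_ n)%:C)) <= - c * ln_ n.
  by move=> cu; rewrite ReCN ReCMr mulNr lerN2 ler_wpM2r.
rewrite (le_trans (expC_lipschitz (bnd s cs) (bnd z cz)))//.
have -> : - (s * (ln_ n)%:C) - - (z * (ln_ n)%:C) = - ((s - z) * (ln_ n)%:C) by ring.
rewrite cabsN cabsM cabs_real ger0_norm// le_eqVlt; apply/orP; left; apply/eqP.
by ring.
Qed.

(* [A n] lists the coefficients alpha of all the primes of norm [n + 1]. *)
Variables (A : nat -> seq R[i]) (D : R).
Hypothesis A0 : A 0%N = [::].
Hypothesis A1 : forall n a, a \in A n -> cabs a <= 1.
Hypothesis AD : forall n, (size (A n))%:R <= D.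

Lemma D_ge0 : 0 <= D.
Proof. exact: le_trans (ler0n _ _) (AD 0). Qed.

Lemma sumA_le n (F : R[i] -> R[i]) (B : R) : 0 <= B ->
  (forall a, a \in A n -> cabs (F a) <= B) -> cabs (\sum_(a <- A n) F a) <= D * B.
Proof.
move=> B0 FB; apply: le_trans (cabs_sum _ _ _) _.
apply: (@le_trans _ _ (\sum_(a <- A n) B)).
  by rewrite big_seq [leRHS]big_seq; apply: ler_sum => a; exact: FB.
by rewrite big_const_seq count_predT iter_addr_0 -mulr_natl ler_wpM2r.
Qed.

Definition coef n : R[i] := \sum_(a <- A n) a.
Definition eterm n s : R[i] := \sum_(a <- A n) - logC (1 - a * pw n s).
Definition rterm n s : R[i] := \sum_(a <- A n) logC_rem (a * pw n s).

Lemma etermE n s : eterm n s = coef n * pw n s + rterm n s.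
Proof.
rewrite /eterm /rterm /coef mulr_suml -big_split; apply: eq_bigr => a _.
by rewrite /logC_rem /=; ring.
Qed.

Lemma coef_le n : cabs (coef n) <= D.
Proof. by rewrite -[leRHS]mulr1; apply: sumA_le => // a /A1. Qed.

Lemma a_pw_le n s a : 1 <= Re s -> a \in A n -> cabs (a * pw n s) <= n.+1%:R^-1.
Proof.
move=> s1 /A1 a1; rewrite cabsM -[leRHS]mul1r.
by rewrite ler_pM ?cabs_ge0// cabs_pw_le.
Qed.

Lemma invn_le_half n a : a \in A n -> n.+1%:R^-1 <= 1 / 2 :> R.
Proof.
case: n => [|n] aA; first by rewrite A0 in aA.
by rewrite mul1r lef_pV2 ?posrE// ler_nat.
Qed.

Lemma a_pw_half n s a : 1 <= Re s -> a \in A n -> cabs (a * pw n s) <= 1 / 2.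
Proof. by move=> s1 aA; exact: le_trans (a_pw_le s1 aA) (invn_le_half aA). Qed.

Definition wt (c : R) n : R := n.+1%:R^-1 * expR (- c * ln_ n).

Lemma wt_ge0 c n : 0 <= wt c n.
Proof. by rewrite mulr_ge0 ?invr_ge0 ?expR_ge0. Qed.

Lemma invn_sqr_le n : n.+1%:R^-1 ^+ 2 <= wt (1 / 2) n.
Proof.
rewrite expr2 /wt ler_wpM2l ?invr_ge0// -(expRN_lnS n) ler_expR mulNr lerN2.
by rewrite ler_piMl ?lnS_ge0//; lra.
Qed.

Lemma rterm_le n s : 1 <= Re s -> cabs (rterm n s) <= D * (19 * wt (1 / 2) n).
Proof.
move=> s1; apply: sumA_le => [|a aA]; first by rewrite mulr_ge0// wt_ge0.
apply: le_trans (logC_rem_le (a_pw_half s1 aA)) _; rewrite ler_wpM2l//.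
apply: le_trans (invn_sqr_le n).
by rewrite lerXn2r ?nnegrE ?cabs_ge0 ?invr_ge0// a_pw_le.
Qed.

Lemma rterm_lipschitz n s z : 1 <= Re s -> 1 <= Re z ->
  cabs (rterm n s - rterm n z) <= D * (154 * 8 * cabs (s - z) * wt (1 / 2) n).
Proof.
move=> s1 z1; rewrite /rterm -sumrB.
have zs0 := cabs_ge0 (s - z).
apply: sumA_le => [|a aA].
  apply: mulr_ge0; last exact: wt_ge0.
  by apply: mulr_ge0 => //; apply: mulr_ge0; exact: ler0n.
have h := logC_rem_lipschitz (invn_le_half aA) (a_pw_le s1 aA) (a_pw_le z1 aA).
apply: (le_trans h); rewrite -mulrBr cabsM.
have a1 := A1 aA; have a0 := cabs_ge0 a.
have h1 : cabs a * cabs (pw n s - pw n z) <=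
    4 * cabs (s - z) * (2 * expR (- (1 / 2) * ln_ n)).
  rewrite -[leRHS]mul1r ler_pM ?cabs_ge0//.
  apply: le_trans (pw_lipschitz n s1 z1) _; rewrite ler_wpM2l ?mulr_ge0//.
  by have := mulx_expRN_le (ln_ n) (@ltr01 R); rewrite divr1.
have n0 : 0 <= n.+1%:R^-1 :> R by rewrite invr_ge0.
rewrite /wt; move: (n.+1%:R^-1) n0 h1 => q q0 h1.
apply: (@le_trans _ _ (154 * q * (4 * cabs (s - z) * (2 * expR (- (1 / 2) * ln_ n))))).
  by rewrite ler_wpM2l// mulr_ge0.
by rewrite le_eqVlt; apply/orP; left; apply/eqP; ring.
Qed.

Definition remSum s : R[i] := csum (fun n => rterm n s).

Lemma rterm_summable s : 1 <= Re s -> csummable (fun n => rterm n s).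
Proof.
move=> s1; apply: csummable_le (fun n => rterm_le n s1) _.
exact/abs_summableZ/abs_summableZ/abs_summable_dirichlet.
Qed.

Lemma wt_bounded c : 0 < c -> exists2 B : R, 0 <= B & forall N, \sum_(0 <= n < N) wt c n <= B.
Proof.
move=> c0; have [B HB] := abs_summable_dirichlet c0; exists B.
  by have := HB 0; rewrite big_geq.
move=> N; apply: le_trans (HB N); apply: ler_sum => i _; exact: ler_norm.
Qed.

Lemma remSum_lipschitz : exists2 K : R, 0 <= K & forall s z, 1 <= Re s -> 1 <= Re z ->
  cabs (remSum s - remSum z) <= K * cabs (s - z).
Proof.
have [B B0 HB] := @wt_bounded (1 / 2) (divr_gt0 ltr01 (ltr0n _ 2)).
have k0 : 0 <= 154 * 8 :> R by apply: mulr_ge0; exact: ler0n.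
exists (2 * (D * (154 * 8) * B)).
  by apply: mulr_ge0 => //; apply: mulr_ge0 => //; apply: mulr_ge0; first exact: D_ge0.
move=> s z s1 z1; rewrite -mulrA.
apply: csumB_le (rterm_summable s1) (rterm_summable z1) _ => N.
apply: (@le_trans _ _ (\sum_(0 <= n < N) D * (154 * 8 * cabs (s - z) * wt (1 / 2) n))).
  by apply: ler_sum => n _; exact: rterm_lipschitz.
rewrite -mulr_sumr -mulr_sumr mulrA.
rewrite (_ : D * (154 * 8) * B * _ = D * (154 * 8 * cabs (s - z)) * B).
  apply: ler_wpM2l => //; apply: mulr_ge0; first exact: D_ge0.
  by apply: mulr_ge0 => //; exact: cabs_ge0.
by ring.
Qed.

Definition coefSum s : R[i] := csum (fun n => coef n * pw n s).
Definition logSum s : R[i] := csum (fun n => eterm n s).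

Lemma cabs_pw_wt n s : cabs (pw n s) = wt (Re s - 1) n.
Proof.
rewrite cabs_pw /wt -(expRN_lnS n) -expRD; congr expR; ring.
Qed.

Lemma coef_summable s : 1 < Re s -> csummable (fun n => coef n * pw n s).
Proof.
move=> s1; apply: (@csummable_le _ _ (fun n => D * wt (Re s - 1) n)).
  by move=> n; rewrite cabsM -cabs_pw_wt ler_wpM2r ?cabs_ge0// coef_le.
by apply/abs_summableZ/abs_summable_dirichlet; rewrite subr_gt0.
Qed.

Lemma eterm_summable s : 1 < Re s -> csummable (fun n => eterm n s).
Proof.
move=> s1; have := csummableD (coef_summable s1) (rterm_summable (ltW s1)).
by congr csummable; apply/funext => n; rewrite etermE.
Qed.

Lemma logSumE s : 1 < Re s -> logSum s = coefSum s + remSum s.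
Proof.
move=> s1; rewrite /logSum; under eq_fun do rewrite etermE.
by rewrite csumD//; [exact: coef_summable|exact/rterm_summable/ltW].
Qed.

Lemma logSum_lipschitz (e : R) : 0 < e -> exists2 K : R, 0 <= K &
  forall s z, 1 + e <= Re s -> 1 + e <= Re z ->
  cabs (logSum s - logSum z) <= K * cabs (s - z).
Proof.
move=> e0; have e2 : 0 < e / 2 by rewrite divr_gt0.
have [B B0 HB] := wt_bounded e2; have [K K0 KP] := remSum_lipschitz.
exists (2 * (D * (8 / e) * B) + K).
  by rewrite addr_ge0// !mulr_ge0 ?D_ge0 ?invr_ge0// ltW.
move=> s z s1 z1.
have s1' : 1 < Re s by lra.
have z1' : 1 < Re z by lra.
rewrite !logSumE//.
have -> : coefSum s + remSum s - (coefSum z + remSum z) =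
  (coefSum s - coefSum z) + (remSum s - remSum z) by ring.
apply: le_trans (cabsD _ _) _; rewrite mulrDl; apply: lerD; last by apply: KP; exact: ltW.
rewrite -mulrA; apply: csumB_le (coef_summable s1') (coef_summable z1') _ => N.
apply: (@le_trans _ _ (\sum_(0 <= n < N) D * (8 / e) * cabs (s - z) * wt (e / 2) n)).
  apply: ler_sum => n _; rewrite -mulrBr cabsM.
  rewrite -!mulrA; apply: ler_pM; rewrite ?cabs_ge0 ?coef_le//.
  apply: le_trans (pw_lipschitz n s1 z1) _.
  have E : expR (- (1 + e) * ln_ n) = n.+1%:R^-1 * expR (- e * ln_ n).
    by rewrite -(expRN_lnS n) -expRD; congr expR; ring.
  have h := mulx_expRN_le (ln_ n) e0.
  rewrite E /wt; have n0 : 0 <= n.+1%:R^-1 :> R by rewrite invr_ge0.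
  move: (n.+1%:R^-1) n0 => q q0.
  rewrite (_ : 4 * _ * _ = 4 * cabs (s - z) * q * (ln_ n * expR (- e * ln_ n))); last ring.
  apply: (@le_trans _ _ (4 * cabs (s - z) * q * (2 / e * expR (- (e / 2) * ln_ n)))).
    by rewrite ler_wpM2l// !mulr_ge0// cabs_ge0.
  rewrite le_eqVlt; apply/orP; left; apply/eqP; ring.
rewrite -mulr_sumr [leRHS](_ : _ = D * (8 / e) * cabs (s - z) * B); last ring.
by rewrite ler_wpM2l// !mulr_ge0 ?D_ge0 ?invr_ge0 ?cabs_ge0// ltW.
Qed.

Lemma expC_eterm n s : 1 <= Re s ->
  expC (eterm n s) = \prod_(a <- A n) (1 - a * pw n s)^-1.
Proof.
move=> s1; rewrite /eterm expC_sum big_seq [RHS]big_seq; apply: eq_bigr => a aA.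
rewrite expCN logCK// Re1D_gt0// cabsN.
exact: a_pw_half.
Qed.

End GroupedEulerProduct.

Section BoundaryValues.
Variable R : realType.
Local Notation Re := (@complex.Re R).
Local Notation Im := (@complex.Im R).
Local Notation ln_ := (lnS R).
Implicit Types (s z p : R[i]).

Variables (A : nat -> seq R[i]) (D : R).
Hypothesis A0 : A 0%N = [::].
Hypothesis A1 : forall n a, a \in A n -> cabs a <= 1.
Hypothesis AD : forall n, (size (A n))%:R <= D.
Variable L : R[i] -> R[i].
Hypothesis L_exp : forall s, 1 < Re s -> L s = expC (logSum A s).

(* The function [logSum s - logC (L s / L p)] is a logarithm of the constant
   [L p].  Along small enough steps its imaginary part moves by less than 2 pi,
   because that of [logC] stays within pi / 2, so the function is constant. *)
Lemma log_branch p (r : R) : Re p = 1 -> 0 < r -> L p != 0 ->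
  (forall s, cabs (s - p) < r -> 1 < Re s -> cabs (L s / L p - 1) <= 1 / 2) ->
  exists2 g, expC g = L p & forall s, cabs (s - p) < r -> 1 < Re s ->
    logSum A s = g + logC (L s / L p).
Proof.
move=> p1 r0 Lp0 Lr.
pose phi s := logSum A s - logC (L s / L p).
have expphi s : cabs (s - p) < r -> 1 < Re s -> expC (phi s) = L p.
  move=> sr s1; rewrite expCB -L_exp//.
  rewrite -(subrKC 1 (L s / L p)) logCK; last exact/Re1D_gt0/Lr.
  rewrite subrKC invf_div mulrCA mulfV ?mulr1// L_exp//.
  exact: expC_neq0.
have const s z : cabs (s - p) < r -> 1 < Re s -> cabs (z - p) < r -> 1 < Re z ->
    phi z = phi s.
  move=> sr s1 zr z1.
  pose e := Num.min (Re s - 1) (Re z - 1).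
  have e0 : 0 < e by rewrite lt_min !subr_gt0 s1 z1.
  have es : 1 + e <= Re s by rewrite -lerBrDl ge_min lexx.
  have ez : 1 + e <= Re z by rewrite -lerBrDl ge_min lexx orbT.
  have [K K0 KP] := logSum_lipschitz A0 A1 AD e0.
  pose N := (Num.truncn (K * cabs (z - s))).+1.
  have N0 : 0 < N%:R :> R by rewrite ltr0n.
  have KN : K * cabs (z - s) <= N%:R by rewrite ltW// truncnS_gt.
  pose tau (j : nat) : R := j%:R / N%:R.
  have tau01 j : (j <= N)%N -> 0 <= tau j <= 1.
    by move=> jN; rewrite divr_ge0//= ler_pdivrMr// mul1r ler_nat.
  pose pt j := s + (z - s) * (tau j)%:C.
  have ptRe j : (j <= N)%N -> 1 + e <= Re (pt j).
    move=> /tau01/andP[t0 t1]; rewrite /pt ReCD ReCMr ReCB.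
    move: (tau j) t0 t1 => t t0 t1.
    have h1 : 0 <= (1 - t) * (Re s - (1 + e)) by rewrite mulr_ge0 ?subr_ge0.
    have h2 : 0 <= t * (Re z - (1 + e)) by rewrite mulr_ge0 ?subr_ge0.
    by lra.
  have ptRe1 j : (j <= N)%N -> 1 < Re (pt j).
    by move=> /ptRe; lra.
  have ptr j : (j <= N)%N -> cabs (pt j - p) < r.
    move=> /tau01/andP[t0 t1]; rewrite /pt.
    move: (tau j) t0 t1 => t t0 t1.
    have -> : s + (z - s) * t%:C - p = (s - p) * (1 - t)%:C + (z - p) * t%:C.
      by rewrite rmorphB rmorph1; ring.
    apply: le_lt_trans (cabsD _ _) _; rewrite !cabsM !cabs_real !ger0_norm ?subr_ge0//.
    have [->|t0'] := eqVneq t 0; first by rewrite subr0 mulr1 mulr0 addr0.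
    have tp : 0 < t by rewrite lt_neqAle eq_sym t0'.
    have h1 : cabs (z - p) * t < r * t by rewrite ltr_pM2r.
    have h2 : cabs (s - p) * (1 - t) <= r * (1 - t) by rewrite ler_wpM2r ?subr_ge0 ?(ltW sr).
    by lra.
  have step j : (j < N)%N -> phi (pt j.+1) = phi (pt j).
    move=> jN; apply: expC_eq.
      by rewrite !expphi ?ptr ?ptRe1// ltnW.
    have -> : Im (phi (pt j.+1)) - Im (phi (pt j)) =
       Im (logSum A (pt j.+1) - logSum A (pt j)) -
       (Im (logC (L (pt j.+1) / L p)) - Im (logC (L (pt j) / L p))).
      by rewrite /phi !ImCB; ring.
    have a1 := Im_logC (L (pt j.+1) / L p); have a2 := Im_logC (L (pt j) / L p).
    have a3 : `|Im (logSum A (pt j.+1) - logSum A (pt j))| <= 1.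
      apply: le_trans (Im_le_cabs _) _.
      apply: (le_trans (KP _ _ (ptRe _ jN) (ptRe _ (ltnW jN)))).
      have -> : pt j.+1 - pt j = (z - s) * (N%:R^-1)%:C.
        have -> : pt j.+1 = pt j + (z - s) * (N%:R^-1)%:C.
          rewrite /pt (_ : tau j.+1 = tau j + N%:R^-1); last first.
            by rewrite /tau -[j.+1%:R]natr1 mulrDl mul1r.
          by rewrite rmorphD /=; ring.
        by ring.
      rewrite cabsM cabs_real ger0_norm ?invr_ge0// mulrA.
      by rewrite ler_pdivrMr// mul1r.
    have p2 := @pi_ge2 R.
    move: a1 a2 a3; rewrite !ltr_norml ler_norml => /andP[? ?] /andP[? ?] /andP[? ?].
    by apply/andP; split; lra.
  have all j : (j <= N)%N -> phi (pt j) = phi (pt 0).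
    by elim: j => [//|j IH] jN; rewrite step// IH// ltnW.
  have pt0 : pt 0 = s by rewrite /pt /tau mul0r mulr0 addr0.
  have ptN : pt N = z by rewrite /pt /tau divff ?gt_eqF// mulr1 subrKC.
  by have := all N (leqnn N); rewrite pt0 ptN.
pose s0 := p + (r / 2)%:C.
have s0r : cabs (s0 - p) < r.
  rewrite /s0 addrAC subrr add0r cabs_real ger0_norm ?ltW ?divr_gt0//.
  by rewrite ltr_pdivrMr// ltr_pMr// ltr1n.
have s01 : 1 < Re s0 by rewrite /s0 ReCD /= p1 ltrDl divr_gt0.
exists (phi s0); first exact: expphi.
by move=> s sr s1; rewrite (const s s0)// /phi subrK.
Qed.

Hypothesis L_neq0 : forall p, Re p = 1 -> L p != 0.
Hypothesis L_lip : forall p, Re p = 1 -> exists2 r : R, 0 < r & exists M : R,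
  forall s, cabs (s - p) < r -> cabs (L s - L p) <= M * cabs (s - p).

Definition bpt (t : R) : R[i] := 1 +i* t.

Lemma logSum_boundary p : Re p = 1 -> exists2 g, expC g = L p &
  exists2 r : R, 0 < r & exists2 M : R, 0 <= M &
  forall s, cabs (s - p) < r -> 1 < Re s -> cabs (logSum A s - g) <= M * cabs (s - p).
Proof.
move=> p1; have Lp0 := L_neq0 p1; have [r r0 [M MP]] := L_lip p1.
have lp : 0 < cabs (L p) by rewrite cabs_gt0.
pose M' := `|M| / cabs (L p) + 1.
have M'0 : 0 < M' by rewrite ltr_pwDr// divr_ge0// ltW.
pose r' := Num.min r (1 / 2 / M').
have r'0 : 0 < r' by rewrite lt_min r0 !divr_gt0.
have quot s : cabs (s - p) < r' -> cabs (L s / L p - 1) <= M' * cabs (s - p).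
  rewrite lt_min => /andP[sr _].
  have -> : L s / L p - 1 = (L s - L p) / L p by field.
  rewrite cabsM cabsV ler_pdivrMr//; apply: le_trans (MP s sr) _.
  rewrite mulrAC; apply: ler_wpM2r; first exact: cabs_ge0.
  rewrite /M' mulrDl divfK ?gt_eqF// mul1r.
  by apply: le_trans (ler_norm _) _; rewrite lerDl ltW.
have half s : cabs (s - p) < r' -> cabs (L s / L p - 1) <= 1 / 2.
  move=> sr; apply: le_trans (quot s sr) _.
  move: sr; rewrite lt_min => /andP[_]; rewrite ltr_pdivlMr// mulrC => /ltW.
  by [].
have [g gE gP] := log_branch p1 r'0 Lp0 (fun s sr _ => half s sr).
exists g => //; exists r' => //; exists (20 * M').
  by rewrite mulr_ge0// ltW.
move=> s sr s1; rewrite gP// addrAC subrr add0r.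
rewrite -(subrKC 1 (L s / L p)); apply: le_trans (logC1D_le20 (half s sr)) _.
by rewrite -mulrA ler_wpM2l// quot.
Qed.

Lemma boundary_function : exists g : R -> R[i], forall t,
  [/\ expC (g t) = L (bpt t) , exists2 r : R, 0 < r & exists2 M : R, 0 <= M &
    forall s, cabs (s - bpt t) < r -> 1 < Re s ->
      cabs (logSum A s - g t) <= M * cabs (s - bpt t)
    & exists2 r : R, 0 < r & exists2 M : R, 0 <= M &
    forall t', `|t' - t| < r -> cabs (g t' - g t) <= M * `|t' - t| ].
Proof.
have /choice[g gP] : forall t, exists g, expC g = L (bpt t) /\
    exists2 r : R, 0 < r & exists2 M : R, 0 <= M &
    forall s, cabs (s - bpt t) < r -> 1 < Re s ->
      cabs (logSum A s - g) <= M * cabs (s - bpt t).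
  move=> t; have [//|g gE gr] := @logSum_boundary (bpt t).
  by exists g.
exists g => t; have [gE [r r0 [M M0 MP]]] := gP t; split => //.
  by exists r => //; exists M.
exists r => //; exists M => // t' t'r.
have [_ [r' r'0 [M' M'0 MP']]] := gP t'.
apply/ler_addgt0Pr => eps e0.
pose Q := M + M' + 1.
have Q0 : 0 < Q by rewrite ltr_pwDr// addr_ge0.
pose d := Num.min (Num.min r' (r - `|t' - t|)) (eps / Q) / 2.
have m0 : 0 < Num.min (Num.min r' (r - `|t' - t|)) (eps / Q).
  by rewrite !lt_min r'0 subr_gt0 t'r divr_gt0.
have : 0 < d < Num.min (Num.min r' (r - `|t' - t|)) (eps / Q).
  by rewrite divr_gt0//= ltr_pdivrMr// ltr_pMr// ltr1n.
rewrite !lt_min => /andP[d0 /andP[/andP[d1 d2] d3]].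
pose s := bpt t' + d%:C.
have s1 : 1 < Re s by rewrite /s ReCD /= ltrDl.
have st' : cabs (s - bpt t') = d.
  by rewrite /s addrAC subrr add0r cabs_real gtr0_norm.
have st : cabs (s - bpt t) <= `|t' - t| + d.
  have -> : s - bpt t = (s - bpt t') + (bpt t' - bpt t) by ring.
  apply: le_trans (cabsD _ _) _; rewrite st' addrC lerD2r.
  by rewrite (le_trans (cabs_le_ReIm _))// /bpt ReCB ImCB /= subrr normr0 add0r.
have h1 : cabs (logSum A s - g t) <= M * (`|t' - t| + d).
  apply: le_trans (MP s _ s1) _; last by rewrite ler_wpM2l.
  by apply: le_lt_trans st _; rewrite -ltrBrDl.
have h2 : cabs (logSum A s - g t') <= M' * d.
  by rewrite -[X in M' * X]st' MP'// st'.
have -> : g t' - g t = (logSum A s - g t) - (logSum A s - g t') by ring.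
apply: le_trans (cabsB _ _) _.
have h3 : Q * d <= eps by rewrite mulrC -ler_pdivlMr// ltW.
by rewrite /Q in h3; lra.
Qed.

Lemma euler_boundary_cvg p (eps : R) : Re p = 1 -> 0 < eps -> exists N0 : nat,
  forall N, (N0 <= N)%N ->
  cabs (\prod_(0 <= n < N) \prod_(a <- A n) (1 - a * pw n p)^-1 - L p) <= eps.
Proof.
move=> p1; have [g gP] := boundary_function.
have pE : p = bpt (Im p) by apply: complex_ext.
pose tau := Im p.
have [K K0 KP] := remSum_lipschitz A0 A1 AD.
have Re_bpt t : Re (bpt t) = 1 by [].
pose f t := g t - remSum A (bpt t).
pose h t := f (tau + t) - f tau.
pose b n := coef A n * pw n p - (if n == 0%N then f tau else 0).
pose C := D + cabs (f tau).
have D0 := D_ge0 AD.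
have bpt_dist t t' : cabs (bpt t' - bpt t) <= `|t' - t|.
  by rewrite (le_trans (cabs_le_ReIm _))// /bpt ReCB ImCB /= subrr normr0 add0r.
have bC n : cabs (b n) <= C / n.+1%:R.
  rewrite /b; case: eqP => [->|_].
    rewrite invr1 mulr1 (le_trans (cabsB _ _))// lerD2r cabsM -[D]mulr1.
    rewrite ler_pM ?cabs_ge0//; first exact: coef_le.
    by rewrite cabs_pw lnS0 mulr0 expR0.
  rewrite subr0 cabsM ler_pM ?cabs_ge0//.
    by rewrite (le_trans (coef_le A1 AD n))// /C lerDl cabs_ge0.
  by rewrite cabs_pw_le// p1.
have GE d t : 0 < d -> csum (fun n => b n * expC (- ((d +i* t) * (ln_ n)%:C))) =
    coefSum A (p + (d +i* t)) - f tau.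
  move=> d0; have pd : 1 < Re (p + (d +i* t)) by rewrite ReCD p1 /= ltrDl.
  pose v n : R[i] := if n == 0%N then - f tau else 0.
  have vs : csummable v.
    exists (cabs (f tau)) => -[|N]; first by rewrite big_geq// cabs_ge0.
    rewrite big_nat_recl// big1 => [|i _]; last first.
      by rewrite (_ : v i.+1 = 0)// cabs0 normr0.
    by rewrite addr0 (_ : v 0%N = - f tau)// ger0_norm ?cabs_ge0// cabsN.
  have -> : - f tau = csum v.
    by rewrite (@csum_finite _ _ 1) ?big_nat1// => -[].
  rewrite /coefSum -csumD//; last exact: coef_summable.
  congr csum; apply/funext => n; rewrite /b /v pwD mulrBl mulrA; congr (_ + _).
  case: eqP => [->|_]; last by rewrite mul0r oppr0.
  by rewrite lnS0 mulr0 oppr0 expC0 mulr1.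
have Gh t (e : R) : 0 < e -> exists2 r : R, 0 < r & forall t' d : R,
    `|t' - t| < r -> 0 < d < r ->
    cabs (csum (fun n => b n * expC (- ((d +i* t') * (ln_ n)%:C))) - h t) <= e.
  move=> e0; have [_ [r r0 [M M0 MP]] _] := gP (tau + t).
  pose Q := M + K + 1.
  have Q0 : 0 < Q by rewrite ltr_pwDr// addr_ge0.
  have eQ : 0 < e / Q by rewrite divr_gt0.
  exists (Num.min r (e / Q) / 2); first by rewrite divr_gt0// lt_min r0 eQ.
  move=> t' d tt' /andP[d0 dm]; rewrite GE//.
  set s := p + (d +i* t').
  have s1 : 1 < Re s by rewrite ReCD p1 /= ltrDl.
  have sd : cabs (s - bpt (tau + t)) <= d + `|t' - t|.
    rewrite (le_trans (cabs_le_ReIm _))// /s /bpt ReCB ImCB ReCD ImCD /= p1 /tau.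
    rewrite (_ : 1 + d - 1 = d); last ring.
    rewrite (_ : Im p + t' - _ = t' - t); last ring.
    by rewrite gtr0_norm.
  have sm : cabs (s - bpt (tau + t)) < Num.min r (e / Q).
    by apply: le_lt_trans sd _; rewrite [ltRHS]splitr ltrD.
  move: sm; rewrite lt_min => /andP[sr sQ].
  have -> : coefSum A s - f tau - h t = (logSum A s - g (tau + t)) -
      (remSum A s - remSum A (bpt (tau + t))).
    by rewrite (logSumE A0 A1 AD s1) /h /f; ring.
  apply: le_trans (cabsB _ _) _.
  have h1 := MP s sr s1.
  have h2 := KP s (bpt (tau + t)) (ltW s1) (lexx _).
  have h3 : Q * cabs (s - bpt (tau + t)) <= e by rewrite mulrC -ler_pdivlMr// ltW.
  have := cabs_ge0 (s - bpt (tau + t)); rewrite /Q in h3; lra.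
have [gL _ [eta eta0 [M M0 MP]]] := gP tau.
have h_lin u : `|u| < eta -> cabs (h u) <= (M + K) * `|u|.
  move=> ue; have -> : h u = (g (tau + u) - g tau) -
     (remSum A (bpt (tau + u)) - remSum A (bpt tau)) by rewrite /h /f; ring.
  apply: le_trans (cabsB _ _) _; rewrite mulrDl.
  have e1 : tau + u - tau = u by ring.
  apply: lerD; first by have := MP (tau + u); rewrite e1; apply.
  have le11 t : 1 <= Re (bpt t) by rewrite Re_bpt.
  apply: le_trans (KP _ _ (le11 _) (le11 _)) _.
  by rewrite ler_wpM2l// (le_trans (bpt_dist _ _))// e1.
move=> eps0.
have tau_L : expC (g tau) = L p by rewrite gL -pE.
have key (e : R) : 0 < e -> exists N0 : nat, forall N, (N0 <= N)%N ->
    cabs (\sum_(0 <= n < N) eterm A n p - g tau) <= e.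
  move=> e0; have e2 : 0 < e / 2 by rewrite divr_gt0.
  have [N1 N1P] := complex_tauberian bC Gh eta0 h_lin e2.
  have p1' : 1 <= Re p by rewrite p1.
  have [N2 N2P] := csum_remainder (rterm_summable A0 A1 AD p1') e2.
  exists (maxn 1 (maxn N1 N2)) => N; rewrite !geq_max => /and3P[N10 NN1 NN2].
  have -> : \sum_(0 <= n < N) eterm A n p - g tau = \sum_(0 <= n < N) b n -
     (csum (fun n => rterm A n p) - \sum_(0 <= n < N) rterm A n p).
    have -> : \sum_(0 <= n < N) b n = \sum_(0 <= n < N) coef A n * pw n p - f tau.
      rewrite /b sumrB; congr (_ - _).
      case: N N10 {NN1 NN2} => // N _; rewrite big_nat_recl//= big1 ?addr0//.
    rewrite (_ : \sum_(0 <= n < N) eterm A n p =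
      \sum_(0 <= n < N) coef A n * pw n p + \sum_(0 <= n < N) rterm A n p).
      by rewrite /f -pE -/(remSum A p); ring.
    by rewrite -big_split; apply: eq_bigr => n _; rewrite etermE.
  apply: le_trans (cabsB _ _) _; rewrite (splitr e).
  by apply: lerD; [exact: N1P|exact: N2P].
pose c := Re (g tau) + 1.
pose e := Num.min 1 (eps / (4 * expR c)).
have e0 : 0 < e by rewrite lt_min ltr01 divr_gt0// mulr_gt0// expR_gt0.
have [N0 N0P] := key e e0; exists N0 => N /N0P.
have -> : \prod_(0 <= n < N) \prod_(a <- A n) (1 - a * pw n p)^-1 =
    expC (\sum_(0 <= n < N) eterm A n p).
  by rewrite expC_sum; apply: eq_bigr => n _; rewrite (expC_eterm A0 A1)// p1.
rewrite -tau_L; move: (\sum_(0 <= n < N) _) => z.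
rewrite le_min => /andP[z1 z2].
apply: (le_trans (@expC_lipschitz _ z (g tau) c _ _)).
- have := le_trans (Re_le_cabs _) z1; rewrite ReCB ler_norml => /andP[_].
  by rewrite /c; lra.
- by rewrite /c lerDl.
by rewrite mulrC -ler_pdivlMr// mulr_gt0// expR_gt0.
Qed.

End BoundaryValues.

(** * Prime ideals of a given norm *)

Section ClassesModInteger.
Local Open Scope nat_scope.

Lemma bernoulli_nat (a k : nat) : (a + k) * a ^ k <= a * a.+1 ^ k.
Proof.
elim: k => [|k IH]; first by rewrite addn0 !expn0.
rewrite !expnS.
have : (a + k) * a ^ k * a.+1 <= a * a.+1 ^ k * a.+1 by rewrite leq_mul2r IH orbT.
have : a * a ^ k <= (a + k) * a ^ k by rewrite leq_mul2r leq_addr orbT.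
move: (a ^ k) (a.+1 ^ k) => u v; nia.
Qed.

Lemma growth_le (a M C : nat) : 0 < a -> (forall k, M ^ k <= C * a ^ k) -> M <= a.
Proof.
move=> a0 H; rewrite leqNgt; apply/negP => aM.
have := H (a * C); have := bernoulli_nat a (a * C).
have : a.+1 ^ (a * C) <= M ^ (a * C).
  by case: (posnP (a * C)) => [->|h]; rewrite ?expn0// leq_exp2r.
have : 0 < a ^ (a * C) by rewrite expn_gt0 a0.
move: (a ^ (a * C)) (a.+1 ^ (a * C)) (M ^ (a * C)) => u v w; nia.
Qed.

Local Open Scope ring_scope.
Variable K : fieldExtType rat.
Local Notation O := (integers K).
Local Notation m := (\dim {:K}).

Lemma common_denominator (I : finType) (c : I -> rat) :
  exists2 q : int, q != 0 & exists z : I -> int, forall i, q%:~R * c i = (z i)%:~R.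
Proof.
exists (\prod_i denq (c i)); first by apply/prodf_neq0 => i _; exact: denq_neq0.
exists (fun i => (\prod_(j | j != i) denq (c j)) * numq (c i)) => i.
have h : (denq (c i))%:~R * c i = (numq (c i))%:~R.
  by rewrite mulrC -{1}(divq_num_den (c i)) divfK// intr_eq0 denq_neq0.
rewrite (bigD1 i)//=; move: (\prod_(j | j != i) _) => P.
by rewrite !intrM -h mulrA [P%:~R * _]mulrC.
Qed.

Lemma val_mulrn_inj n (x y : O) : (0 < n)%N -> x *+ n = y *+ n -> x = y.
Proof.
move=> n0 /(congr1 val); rewrite !raddfMn /= => xy; apply: val_inj => /=.
have nn : n%:R != 0 :> rat by rewrite pnatr_eq0 -lt0n.
by apply: (scalerI nn); rewrite !scaler_nat.
Qed.

Section Words.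
Variables (T : finType) (x : T -> O) (n : nat).
Hypothesis n2 : (2 <= n)%N.
Hypothesis xn : forall a b, (exists z, x a - x b = z *+ n) -> a = b.

Definition word_val (w : seq T) : O := foldr (fun a acc => x a + acc *+ n) 0 w.

Lemma word_val_inj w w' : size w = size w' -> word_val w = word_val w' -> w = w'.
Proof.
elim: w w' => [|a w IH] [|a' w']//= [sw] e.
have aa : a = a'.
  apply: xn; exists (word_val w' - word_val w); rewrite mulrnBl.
  by apply/eqP; rewrite subr_eq addrAC eq_sym subr_eq addrC e addrC.
rewrite aa in e *; congr (_ :: _); apply: IH => //.
apply: (@val_mulrn_inj n); first by rewrite (leq_trans _ n2).
exact: addrI e.
Qed.

(* Words of length k over T, read as base-n expansions with digits x, have
   pairwise distinct values, whose m rational coordinates have a common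
   denominator and size O(n ^ k).  So #|T| ^ k = O(n ^ (m k)) for all k; no
   integral basis is needed. *)
Lemma card_classes_le : (#|T| <= n ^ m)%N.
Proof.
pose e := vbasis {:K}.
have [q q0 [z zP]] := common_denominator
  (fun p : T * 'I_m => coord e p.2 (val (x p.1))).
pose B := (\sum_p `|z p|)%N.
have zB p : (`|z p| <= B)%N by rewrite /B (bigD1 p)//= leq_addr.
pose zval i (w : seq T) : int := foldr (fun a acc => z (a, i) + acc * n%:Z) 0 w.
have zvalE i w : q%:~R * coord e i (val (word_val w)) = (zval i w)%:~R.
  elim: w => [|a w IH]; first by rewrite /= linear0 mulr0.
  have -> : val (word_val (a :: w)) = val (x a) + val (word_val w) *+ n :> K.
    by rewrite -rmorphMn -rmorphD.
  have -> : zval i (a :: w) = z (a, i) + zval i w * n%:Z by [].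
  rewrite linearD linearMn /= mulrDr (zP (a, i)) intrD intrM -IH.
  by rewrite mulrnAr -mulr_natr.
have abszD (a b : int) : (absz (a + b)%R <= absz a + absz b)%N by lia.
have zval_le i w : (`|zval i w| + B <= B * n ^ size w)%N.
  elim: w => [|a w IH]; first by rewrite /= expn0 muln1.
  have /= h := abszD (z (a, i)) (zval i w * n%:Z).
  rewrite abszM absz_nat in h.
  have := zB (a, i); move: IH h; rewrite expnS.
  move: (`|zval i w|)%N (n ^ size w)%N (`|z (a, i)|)%N (absz _) => u p v t; nia.
apply: (@growth_le _ _ ((2 * B + 1) ^ m)) => [|k]; first by rewrite expn_gt0 (leq_trans _ n2).
pose N := (2 * (B * n ^ k))%N.
pose F (w : k.-tuple T) : {ffun 'I_m -> 'I_N.+1} :=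
  [ffun i => inord (absz (zval i w + (B * n ^ k)%N%:Z))].
have Finj : injective F.
  move=> w w' /ffunP FF; apply/val_inj/word_val_inj; first by rewrite !size_tuple.
  apply: val_inj; have ew (u : O) : val u = \sum_i coord e i (val u) *: e`_i.
    by apply: coord_vbasis; exact: memvf.
  rewrite (ew (word_val w)) (ew (word_val w')); apply: eq_bigr => i _; congr (_ *: _).
  have qn : q%:~R != 0 :> rat by rewrite intr_eq0.
  apply: (mulfI qn); rewrite !zvalE; congr _%:~R.
  have := FF i; rewrite !ffunE => /(congr1 val) /=.
  have h1 := zval_le i w; have h2 := zval_le i w'.
  rewrite !size_tuple in h1 h2.
  rewrite !inordK /N; move: (B * n ^ k)%N h1 h2 => Q h1 h2; lia.
have := leq_card F Finj; rewrite card_tuple card_ffun !card_ord => h.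
apply: (leq_trans h); rewrite -expnM (mulnC m) expnM -expnMn.
have [->|m0] := posnP m; first by rewrite !expn0.
rewrite leq_exp2r// /N.
have : (0 < n ^ k)%N by rewrite expn_gt0 (leq_trans _ n2).
by move: (n ^ k)%N => p; nia.
Qed.

End Words.
End ClassesModInteger.

Section PrimeIdeals.
Variable K : fieldExtType rat.
Local Notation O := (integers K).
Local Notation m := (\dim {:K}).
Implicit Types (P : set O) (x y : O).

Lemma int_multiple (p : {poly int}) x : p != 0 -> x != 0 ->
  (map_poly (intr : int -> O) p).[x] = 0 -> exists y (c : int), c != 0 /\ c%:~R = y * x.
Proof.
elim/poly_ind: p => [|p c IH]; first by rewrite eqxx.
move=> pn0 x0; rewrite rmorphD rmorphM /= map_polyX map_polyC /= hornerMXaddC => h.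
have [c0|c0] := eqVneq c 0; last first.
  exists (- (map_poly (intr : int -> O) p).[x]), c; split => //.
  by apply/eqP; rewrite mulNr -addr_eq0 addrC h.
rewrite c0 rmorph0 addr0 in h; apply: IH => //.
  by apply: contraNneq pn0 => ->; rewrite c0 mul0r add0r polyC0.
apply: val_inj; move/(congr1 val): h; rewrite rmorphM /= => /eqP.
rewrite mulf_eq0 => /orP[/eqP //|/eqP xv]; case/eqP: x0.
exact: val_inj.
Qed.

Lemma exists_int_multiple x : x != 0 -> exists y (c : int), c != 0 /\ c%:~R = y * x.
Proof.
move=> x0; have /asboolP[p pm /rootP pr] := valP x.
apply: (@int_multiple p) => //; first exact: monic_neq0.
have hm : (map_poly (val : O -> K) (map_poly (intr : int -> O) p)).[val x] =
    val (map_poly (intr : int -> O) p).[x] by exact: horner_map.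
apply: val_inj; rewrite -hm -map_poly_comp rmorph0 -[RHS]pr.
by congr _.[_]; apply: eq_map_poly => c; exact: rmorph_int.
Qed.

Section OneIdeal.
Variable P : set O.
Hypothesis PK : nonzeroPrimes K P.

Lemma ideal0 : P 0.
Proof. by case: PK => -[/set_mem]. Qed.

Lemma ideal1 : ~ P 1.
Proof. by case: PK => -[_ /negP h _] _ _ p1; apply: h; exact/mem_set. Qed.

Lemma idealMD a x y : P x -> P y -> P (a * x + y).
Proof.
by case: PK => -[_ _ h] _ _ px py; apply/set_mem/h; exact/mem_set.
Qed.

Lemma idealM a x : P x -> P (a * x).
Proof. by move=> px; rewrite -[_ * _]addr0; apply: idealMD => //; exact: ideal0. Qed.

Lemma idealD x y : P x -> P y -> P (x + y).
Proof. by move=> px py; rewrite -(mul1r x); exact: idealMD. Qed.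

Lemma idealN x : P x -> P (- x).
Proof. by move=> px; rewrite -mulN1r; exact: idealM. Qed.

Lemma idealB x y : P x -> P y -> P (x - y).
Proof. by move=> px py; apply: idealD => //; exact: idealN. Qed.

Lemma idealBC x y : P (x - y) -> P (y - x).
Proof. by move=> /idealN; rewrite opprB. Qed.

Lemma idealB_trans x y z : P (x - y) -> P (y - z) -> P (x - z).
Proof. by move=> xy yz; rewrite -(subrKA y); exact: idealD. Qed.

Lemma ideal_sum (I : finType) (F : I -> O) : (forall i, P (F i)) -> P (\sum_i F i).
Proof. by move=> PF; elim/big_ind: _ => //; [exact: ideal0|exact: idealD]. Qed.

Lemma ideal_prime x y : P (x * y) -> P x \/ P y.
Proof.
case: PK => _ h _ pxy; have : x * y \in mem P by exact/mem_set.
by move=> /h /orP[] /set_mem; [left|right].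
Qed.

Lemma ideal_nat : exists2 n : nat, (2 <= n)%N & P n%:R.
Proof.
have [x [px x0]] : exists x, P x /\ x != 0.
  case: PK => _ _ /eqP Pn0; apply/not_existsP => H; apply: Pn0.
  apply/seteqP; split=> [x px|x ->]; last exact: ideal0.
  by have := H x; case: (eqVneq x 0) => [//|x0] []; split.
have [y [c [c0 cE]]] := exists_int_multiple x0.
have pc : P (c%:~R) by rewrite cE; exact: idealM.
have pn : P (absz c)%:R.
  have [c1|c1] := leP 0 c.
    by have := pc; rewrite -{1}(gez0_abs c1).
  by have := idealN pc; rewrite -mulrNz -(ltz0_abs c1).
exists (absz c) => //; case E : (absz c) pn => [|[|n]]//.
  by move/eqP : E; rewrite absz_eq0 (negPf c0).
by move=> /ideal1.
Qed.

Lemma idealCoset_eq x y : idealCoset P x = idealCoset P y <-> P (x - y).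
Proof.
split=> [xy|pxy].
  have : idealCoset P x x by exists 0; [exact: ideal0|rewrite addr0].
  by rewrite xy => -[z pz <-]; rewrite addrAC subrr add0r.
apply/seteqP; split=> _ [z pz <-].
  exists (x - y + z); first exact: idealD.
  by rewrite addrA subrKC.
exists (y - x + z); first by apply: idealD => //; exact: idealBC.
by rewrite addrA subrKC.
Qed.

Lemma finite_cosets : finite_set (range (idealCoset P)).
Proof.
have [n n2 pn] := ideal_nat; apply: contrapT => /(infinite_set_fset (n ^ m).+1)[B BS].
rewrite ltnNge => /negP; apply; rewrite cardfE.
have /choice[r rP] : forall b : B, exists x, idealCoset P x = val b.
  by move=> b; have [x _ xb] := BS (val b) (valP b); exists x.
apply: (@card_classes_le _ _ r n n2) => a b [z zE]; apply: val_inj.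
rewrite -!rP; apply/idealCoset_eq.
by rewrite zE -mulr_natr; exact: idealM.
Qed.

Lemma representatives : exists r : 'I_(absNorm P) -> O,
  (forall i j, P (r i - r j) -> i = j) /\ forall x, exists i, P (x - r i).
Proof.
pose F := fset_set (range (idealCoset P)).
have cF : #|{: F}| = absNorm P by rewrite -cardfE.
have FP c : c \in F -> exists x, idealCoset P x = c.
  by rewrite in_fset_set; [move=> /set_mem[x _ <-]; exists x|exact: finite_cosets].
have /choice[r rP] : forall b : F, exists x, idealCoset P x = val b.
  by move=> b; exact: FP (valP b).
exists (fun i => r (enum_val (cast_ord (esym cF) i))); split=> [i j /idealCoset_eq|x].
  by rewrite !rP => /val_inj/enum_val_inj/cast_ord_inj.
have xF : idealCoset P x \in F.
  by rewrite in_fset_set; [apply/mem_set; exists x|exact: finite_cosets].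
exists (cast_ord cF (enum_rank [` xF]%fset)).
by rewrite cast_ordK enum_rankK; apply/idealCoset_eq; rewrite rP.
Qed.

Lemma absNorm_ge2 : (2 <= absNorm P)%N.
Proof.
have [r [rinj rsurj]] := representatives.
have [i0 p0] := rsurj 0; have [i1 p1] := rsurj 1.
have i01 : i0 != i1.
  apply/eqP => i01; rewrite i01 in p0; apply: ideal1.
  by have := idealB_trans p1 (idealBC p0); rewrite subr0.
move: i0 i1 i01 {p0 p1 rinj rsurj r}; case: (absNorm P) => [|[|n]] // [i hi] [j hj].
- by exfalso; lia.
- by move=> /eqP ij; exfalso; apply: ij; apply: val_inj => /=; lia.
Qed.

(* Translation by 1 permutes the cosets; compare the sums of representatives. *)
Lemma absNorm_in : P (absNorm P)%:R.
Proof.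
have [r [rinj rsurj]] := representatives.
have /choice[s sP] : forall i, exists j, P (r i + 1 - r j) by move=> i; exact: rsurj.
have sinj : injective s.
  move=> i j ij; apply: rinj; have h1 := sP i; have := sP j; rewrite -ij => h2.
  by have := idealB h1 h2; rewrite (_ : _ - _ = r i - r j)//; ring.
have := ideal_sum sP; rewrite sumrB big_split /=.
rewrite -(reindex_inj (P := xpredT) (F := r) sinj) /=.
by rewrite addrAC subrr add0r sumr_const card_ord.
Qed.

Lemma inverse_mod x : ~ P x -> exists y, P (x * y - 1).
Proof.
move=> px; have [r [rinj rsurj]] := representatives.
have /choice[s sP] : forall i, exists j, P (x * r i - r j) by move=> i; exact: rsurj.
have sinj : injective s.
  move=> i j ij; apply: rinj; have h1 := sP i; have := sP j; rewrite -ij => h2.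
  have := idealB h1 h2; rewrite (_ : _ - _ = x * (r i - r j)); last by ring.
  by move=> /ideal_prime[].
have [k kP] := rsurj 1.
have [t ts st] : bijective s by exact: injF_bij.
exists (r (t k)); apply: (@idealB_trans _ (r k)); last exact: idealBC.
by rewrite -{2}(st k).
Qed.

End OneIdeal.

Lemma separating P Q : nonzeroPrimes K P -> nonzeroPrimes K Q -> P <> Q ->
  exists u, Q u /\ P (u - 1).
Proof.
move=> hP hQ PQ.
have [x [qx px]] : exists x, Q x /\ ~ P x.
  apply: contrapT => /forallNP H.
  have QP : Q `<=` P by move=> x qx; apply: contrapT => px; exact: (H x).
  have [x [px qx]] : exists x, P x /\ ~ Q x.
    apply: contrapT => /forallNP H'; apply: PQ; apply/seteqP; split => // x px.
    by apply: contrapT => qx; exact: (H' x).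
  have [y pxy] := inverse_mod hQ qx.
  apply: (ideal1 hP).
  have h1 := QP _ pxy; have h2 : P (x * y) by rewrite mulrC; exact: (idealM hP).
  by have := idealB hP h2 h1; rewrite opprB subrKC.
have [y pxy] := inverse_mod hP px.
by exists (x * y); split => //; rewrite mulrC; exact: (idealM hQ).
Qed.

(* By the Chinese remainder theorem the primes Ps provide N ^ g classes mod N. *)
Lemma card_primes_norm (g N : nat) (Ps : 'I_g -> set O) : injective Ps ->
  (forall i, nonzeroPrimes K (Ps i)) -> (forall i, absNorm (Ps i) = N) -> (g <= m)%N.
Proof.
move=> Pinj hP PN; case: g => [//|g] in Ps Pinj hP PN *.
have N2 : (2 <= N)%N by rewrite -(PN ord0); exact: absNorm_ge2.
have Nin i : Ps i N%:R by rewrite -(PN i); exact: absNorm_in.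
have /choice[u uP] : forall ij : 'I_g.+1 * 'I_g.+1, exists u,
    ij.1 != ij.2 -> Ps ij.2 u /\ Ps ij.1 (u - 1).
  move=> [i j] /=; have [->|ij] := eqVneq i j; first by exists 0.
  have [] := separating (hP i) (hP j); first by move/Pinj/eqP; rewrite (negPf ij).
  by move=> u uP; exists u.
pose e i : O := \prod_(j | i != j) u (i, j).
have e0 i k : i != k -> Ps k (e i).
  move=> ik; rewrite /e (bigD1 k)//= mulrC; apply: (idealM (hP k)).
  by case: (uP (i, k) ik).
have e1 i : Ps i (e i - 1).
  rewrite /e; elim/big_ind: _ => [|a b ha hb|j ij].
  - by rewrite subrr; exact: ideal0.
  - have -> : a * b - 1 = a * (b - 1) + (a - 1) by ring.
    exact: (idealMD (hP i)).
  - by case: (uP (i, j) ij).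
have /choice[r rP] : forall i, exists r : 'I_N -> O, forall a b, Ps i (r a - r b) -> a = b.
  move=> i; have [r [rinj _]] := representatives (hP i).
  exists (fun a => r (cast_ord (esym (PN i)) a)) => a b /rinj.
  exact: cast_ord_inj.
pose F (f : {ffun 'I_g.+1 -> 'I_N}) : O := \sum_i e i * r i (f i).
have := @card_classes_le K _ F N N2 _; rewrite card_ffun !card_ord.
rewrite leq_exp2l//; apply=> f f' [z zE]; apply/ffunP => k; apply: (rP k).
have h : Ps k (F f - F f').
  by rewrite zE -mulr_natr; exact: (idealM (hP k)).
have {}h : Ps k (e k * (r k (f k) - r k (f' k))).
  move: h; rewrite /F -sumrB (bigD1 k)//=; set S := \sum_(i | _) _ => h.
  have hS : Ps k S.
    rewrite /S; elim/big_ind: _ => [||i ik]; [exact: ideal0|exact: idealD|].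
    by rewrite -mulrBr mulrC; apply: (idealM (hP k)); exact: e0.
  have := idealB (hP k) h hS; rewrite addrK.
  by rewrite mulrBr.
have h' := idealM (hP k) (r k (f k) - r k (f' k)) (e1 k).
have := idealB (hP k) h h'.
by rewrite (_ : _ - _ = r k (f k) - r k (f' k))//; ring.
Qed.

End PrimeIdeals.

(** * Euler products over prime ideals *)

Section PrimesByNorm.
Variable K : fieldExtType rat.
Local Notation I := (nonzeroPrimes K).
Local Notation m := (\dim {:K}).

Definition primeNorm (P : I) : nat := absNorm (val P).

Lemma nonzeroPrimes_val (P : I) : nonzeroPrimes K (val P).
Proof. exact: set_valP. Qed.

Lemma primeNorm_ge2 P : (2 <= primeNorm P)%N.
Proof. exact/absNorm_ge2/nonzeroPrimes_val. Qed.

Lemma card_fset_primeNorm (B : {fset I}) n : (forall P, P \in B -> primeNorm P = n) ->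
  (#|` B| <= m)%N.
Proof.
move=> Bn; rewrite cardfE.
pose Ps (i : 'I_#|{: B}|) : set (integers K) := val (val (enum_val i)).
apply: (@card_primes_norm K _ n Ps).
- by move=> i j /val_inj/val_inj/enum_val_inj.
- by move=> i; exact: nonzeroPrimes_val.
- by move=> i; apply: Bn; exact: valP.
Qed.

Lemma finite_primeNorm n : finite_set [set P : I | primeNorm P = n].
Proof.
apply: contrapT => /(infinite_set_fset m.+1)[B BS]; rewrite ltnNge => /negP; apply.
by apply: (@card_fset_primeNorm _ n) => P PB; exact: BS.
Qed.

Lemma finite_primeNorm_le N : finite_set [set P : I | (primeNorm P <= N)%N].
Proof.
apply: (@sub_finite_set _ _ (\bigcup_(n in `I_N.+1) [set P : I | primeNorm P = n])).
  by move=> P /= PN; exists (primeNorm P).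
apply: bigcup_finite => // n _; exact: finite_primeNorm.
Qed.

Definition normPrimes n : {fset I} := fset_set [set P : I | primeNorm P = n].
Definition primesUpTo N : {fset I} := fset_set [set P : I | (primeNorm P <= N)%N].

Lemma in_normPrimes n P : (P \in normPrimes n) = (primeNorm P == n).
Proof.
rewrite in_fset_set; last exact: finite_primeNorm.
by apply/idP/eqP => [/set_mem|pn]; [|exact/mem_set].
Qed.

Lemma in_primesUpTo N P : (P \in primesUpTo N) = (primeNorm P <= N)%N.
Proof.
rewrite in_fset_set; last exact: finite_primeNorm_le.
by apply/idP/idP => [/set_mem|pn]; [|exact/mem_set].
Qed.

Lemma big_primesUpTo (T : Type) (idx : T) (op : Monoid.com_law idx) (F : I -> T) N :
  \big[op/idx]_(P <- primesUpTo N) F P =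
  \big[op/idx]_(0 <= n < N) \big[op/idx]_(P <- normPrimes n.+1) F P.
Proof.
elim: N => [|N IH].
  rewrite [RHS]big_geq// big_seq big1// => P; rewrite in_primesUpTo leqNgt.
  by rewrite (leq_trans _ (primeNorm_ge2 P)).
rewrite big_nat_recr//= -IH -big_cat; apply: perm_big; apply: uniq_perm.
- exact: fset_uniq.
- rewrite cat_uniq !fset_uniq/= andbT; apply/hasPn => P.
  by rewrite in_normPrimes in_primesUpTo => /eqP ->; rewrite ltnn.
- by move=> P; rewrite mem_cat !in_primesUpTo in_normPrimes leq_eqVlt ltnS orbC.
Qed.

Lemma sum_by_norm (R : realType) (g : nat -> R) (B : {fset I}) N : (forall n, 0 <= g n) ->
  exists M : nat, \sum_(P <- B | (N < primeNorm P)%N) g (primeNorm P).-1 <=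
    \sum_(N <= n < M) m%:R * g n.
Proof.
move=> g0; pose M := (\max_(P <- B) primeNorm P)%N; exists M.+1.
pose p (P : I) : 'I_M.+1 := inord (primeNorm P).-1.
have pE P : P \in B -> p P = (primeNorm P).-1 :> nat.
  move=> PB; rewrite inordK// ltnS (leq_trans (leq_pred _))//.
  by rewrite /M (big_fsetD1 P)//= leq_maxl.
rewrite big_seq_cond (partition_big p (fun n : 'I_M.+1 => N <= n)%N) /=; last first.
  by move=> P /andP[PB NP]; rewrite pE//; case: (primeNorm P) NP.
rewrite big_geq_mkord; apply: ler_sum => n Nn.
apply: (@le_trans _ _ (\sum_(P <- B | primeNorm P == n.+1) g n)).
  rewrite big_mkcond [leRHS]big_mkcond; apply: ler_sum => P _.
  case: ifP => [/andP[/andP[PB NP] /eqP pn]|_]; last by case: ifP.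
  have pn' : (primeNorm P).-1 = n by rewrite -pE// pn.
  by rewrite -pn' prednK ?eqxx//; case: (primeNorm P) NP.
rewrite big_fset_condE big_const_seq count_predT iter_addr_0.
rewrite -[leLHS]mulr_natl ler_wpM2r// ler_nat.
apply: (@card_fset_primeNorm [fset P in B | primeNorm P == n.+1]%fset n.+1) => P.
by rewrite !inE => /andP[_ /eqP].
Qed.

End PrimesByNorm.

#[local] Existing Instance totally_filter.

Section EulerProductGlue.
Variables (R : realType) (K : fieldExtType rat) (d : nat).
Variable alpha : nonzeroPrimes K -> 'I_d -> R[i].
Hypothesis alpha_le1 : forall P j, `|alpha P j| <= 1.
Local Notation Re := (@complex.Re R).
Local Notation I := (nonzeroPrimes K).
Local Notation m := (\dim {:K}).

Lemma cabs_alpha P j : cabs (alpha P j) <= 1.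
Proof. by have := alpha_le1 P j; rewrite normr_cabs -(rmorph1 (real_complex R)) lecR. Qed.

Definition alphas n : seq R[i] :=
  [seq alpha P j | P <- normPrimes K n.+1, j <- enum 'I_d].

Definition alphaBound : R := (m * d)%:R.

Lemma alphas0 : alphas 0 = [::].
Proof.
rewrite /alphas (_ : enum_fset (normPrimes K 1) = [::])//.
case E : (enum_fset _) => [//|P s].
have PE : P \in enum_fset (normPrimes K 1) by rewrite E mem_head.
have : P \in normPrimes K 1 := PE.
by rewrite in_normPrimes => /eqP PN; have := primeNorm_ge2 P; rewrite PN.
Qed.

Lemma alphas_le1 n a : a \in alphas n -> cabs a <= 1.
Proof. by move=> /allpairsP[[P j] [_ _ ->]]; exact: cabs_alpha. Qed.

Lemma size_alphas n : (size (alphas n))%:R <= alphaBound.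
Proof.
rewrite size_allpairs size_enum_ord ler_nat leq_mul2r; apply/orP; right.
apply: (@card_fset_primeNorm _ _ n.+1) => P.
by rewrite in_normPrimes => /eqP.
Qed.

Lemma natpowCE n (s : R[i]) : natpowC n.+1 (- s) = pw n s.
Proof. by rewrite /natpowC /pw mulNr. Qed.

Lemma prod_alphas n (s : R[i]) : \prod_(a <- alphas n) (1 - a * pw n s)^-1 =
  \prod_(P <- normPrimes K n.+1) eulerFactor alpha s P.
Proof.
rewrite big_allpairs_dep /= big_seq [RHS]big_seq; apply: eq_bigr => P.
rewrite in_normPrimes => /eqP PN; rewrite /eulerFactor -prodfV big_enum /=.
by apply: eq_bigr => j _; rewrite -natpowCE -PN.
Qed.

Lemma partialEulerProductE (s : R[i]) (x : R) : 0 <= x -> partialEulerProduct alpha s x =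
  \prod_(0 <= n < Num.truncn x) \prod_(a <- alphas n) (1 - a * pw n s)^-1.
Proof.
move=> x0; rewrite /partialEulerProduct.
have -> : [set P : I | (absNorm (val P))%:R <= x] =
    [set P : I | (primeNorm P <= Num.truncn x)%N].
  by apply/seteqP; split=> P /=; rewrite truncn_ge_nat.
rewrite -/(primesUpTo K _) big_primesUpTo; apply: eq_bigr => n _.
by rewrite prod_alphas.
Qed.

Definition primeTerm (s : R[i]) (P : I) : R[i] :=
  \sum_(j < d) - logC (1 - alpha P j * pw (primeNorm P).-1 s).

Lemma alpha_pw_le (s : R[i]) P j : 1 <= Re s ->
  cabs (alpha P j * pw (primeNorm P).-1 s) <= 1 / 2.
Proof.
move=> s1; rewrite cabsM mul1r -[leRHS]mul1r ler_pM ?cabs_ge0 ?cabs_alpha//.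
apply: le_trans (cabs_pw_le _ s1) _.
by rewrite lef_pV2 ?posrE// ler_nat prednK ?primeNorm_ge2// (leq_trans _ (primeNorm_ge2 P)).
Qed.

Lemma expC_primeTerm (s : R[i]) P : 1 <= Re s -> expC (primeTerm s P) = eulerFactor alpha s P.
Proof.
move=> s1; rewrite /primeTerm expC_sum /eulerFactor -prodfV; apply: eq_bigr => j _.
rewrite expCN logCK; last by rewrite Re1D_gt0// cabsN; exact: alpha_pw_le.
rewrite -natpowCE prednK// (leq_trans _ (primeNorm_ge2 P))//.
Qed.

Lemma cabs_primeTerm (s : R[i]) P : 1 <= Re s ->
  cabs (primeTerm s P) <= (20 * d)%:R * wt (Re s - 1) (primeNorm P).-1.
Proof.
move=> s1; apply: le_trans (cabs_sum _ _ _) _.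
apply: (@le_trans _ _ (\sum_(j < d) 20 * wt (Re s - 1) (primeNorm P).-1)).
  apply: ler_sum => j _; rewrite cabsN -cabs_pw_wt.
  have h := logC1D_le20 (_ : cabs (- (alpha P j * pw (primeNorm P).-1 s)) <= 1 / 2).
  rewrite (le_trans (h _)) ?cabsN ?alpha_pw_le//.
  by rewrite ler_wpM2l// cabsM ler_piMl ?cabs_ge0 ?cabs_alpha.
by rewrite sumr_const card_ord -[leLHS]mulr_natl natrM mulrCA mulrA.
Qed.

Lemma sum_eterm (s : R[i]) N :
  \sum_(0 <= n < N) eterm alphas n s = \sum_(P <- primesUpTo K N) primeTerm s P.
Proof.
rewrite big_primesUpTo; apply: eq_bigr => n _.
rewrite /eterm big_allpairs_dep /= big_seq [RHS]big_seq; apply: eq_bigr => P.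
rewrite in_normPrimes => /eqP PN; rewrite big_enum /= /primeTerm PN.
by apply: eq_bigr.
Qed.

Lemma primeTerm_sum_near (s : R[i]) (eps : R) : 1 < Re s -> 0 < eps ->
  exists B : {fset I}, forall C : {fset I}, (B `<=` C)%fset ->
  cabs (\sum_(P <- C) primeTerm s P - logSum alphas s) <= eps.
Proof.
move=> s1 e0; have e2 : 0 < eps / 2 by rewrite divr_gt0.
have s1' : 0 < Re s - 1 by rewrite subr_gt0.
pose g n : R := (20 * d)%:R * wt (Re s - 1) n.
have g0 n : 0 <= g n by rewrite mulr_ge0// wt_ge0.
have sg : abs_summable (fun n => m%:R * g n).
  exact/abs_summableZ/abs_summableZ/abs_summable_dirichlet.
have [N1 N1P] := abs_summable_tail sg e2.
have [N2 N2P] := csum_remainder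
  (eterm_summable alphas0 alphas_le1 size_alphas s1) e2.
pose N := maxn N1 N2.
exists (primesUpTo K N) => C /fsubsetP BC.
rewrite (bigID (fun P => primeNorm P <= N)%N) /=.
have -> : \sum_(P <- C | (primeNorm P <= N)%N) primeTerm s P =
    \sum_(0 <= n < N) eterm alphas n s.
  rewrite sum_eterm -big_filter; apply: perm_big; apply: uniq_perm.
  - exact/filter_uniq/fset_uniq.
  - exact: fset_uniq.
  - move=> P; rewrite mem_filter in_primesUpTo; apply/andP/idP => [[]//|PN].
    by split => //; apply: BC; rewrite in_primesUpTo.
rewrite addrAC addrC; apply: le_trans (cabsD _ _) _; rewrite (splitr eps) lerD//; last first.
  by rewrite cabsBC; apply: N2P; rewrite leq_maxr.
apply: le_trans (cabs_sum _ _ _) _.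
apply: (@le_trans _ _ (\sum_(P <- C | (N < primeNorm P)%N) g (primeNorm P).-1)).
  under eq_bigl do rewrite -ltnNge.
  by apply: ler_sum => P _; exact/cabs_primeTerm/ltW.
have [M MP] := sum_by_norm C N g0; apply: (le_trans MP).
have [MN|NM] := leqP M N; first by rewrite big_geq// ltW.
apply: le_trans (N1P M (leq_trans (leq_maxl _ _) (ltnW NM))).
rewrite [leRHS](big_cat_nat (leq_maxl N1 N2) (ltnW NM))//= -[leLHS]add0r lerD ?sumr_ge0//.
by apply: ler_sum => n _; exact: ler_norm.
Qed.

Lemma eulerProductE (s : R[i]) : 1 < Re s -> eulerProduct alpha s = expC (logSum alphas s).
Proof.
move=> s1; apply: cvg_lim; first exact: norm_hausdorff.
apply/cvgrPdist_le => e e0.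
have eE : e = (Re e)%:C.
  by rewrite RRe_real// ger0_real// ltW.
have e0' : 0 < Re e by move: e0; rewrite {1}eE ltcR.
set w := logSum alphas s.
pose c := Re w + 1.
pose e' := Num.min 1 (Re e / (4 * expR c)).
have e'0 : 0 < e' by rewrite lt_min ltr01 divr_gt0// mulr_gt0// expR_gt0.
have [B BP] := primeTerm_sum_near s1 e'0.
exists B => // C /= /BP; rewrite -/w le_min => /andP[z1 z2].
rewrite normr_cabs eE lecR cabsBC.
have -> : \prod_(P <- C) eulerFactor alpha s P = expC (\sum_(P <- C) primeTerm s P).
  by rewrite expC_sum; apply: eq_bigr => P _; rewrite expC_primeTerm// ltW.
apply: (le_trans (@expC_lipschitz _ _ w c _ _)).
- have := le_trans (Re_le_cabs _) z1; rewrite ReCB ler_norml => /andP[_].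
  by rewrite /c; lra.
- by rewrite /c lerDl.
by rewrite mulrC -ler_pdivlMr// mulr_gt0// expR_gt0.
Qed.

End EulerProductGlue.

Lemma derivable_lipschitz_at (R : realType) (f : R[i] -> R[i]) (p : R[i]) : derivable f p 1 ->
  exists2 r : R, 0 < r & exists M : R,
  forall s, cabs (s - p) < r -> cabs (f s - f p) <= M * cabs (s - p).
Proof.
move=> /cvg_ex[/= l].
move=> /cvgrPdist_le/(_ 1 ltr01).
rewrite /= => /nbhs_ballP[e /= e0 H].
have eE : e = (complex.Re e)%:C by rewrite RRe_real// ger0_real// ltW.
have e0' : 0 < complex.Re e by move: e0; rewrite {1}eE ltcR.
exists (complex.Re e) => //; exists (cabs l + 1) => s sp.
have [->|sn] := eqVneq s p; first by rewrite !subrr !cabs0 mulr0.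
have hn : s - p != 0 by rewrite subr_eq0.
have bs : ball (0 : R[i]) e (s - p).
  by rewrite /ball/= sub0r normrN normr_cabs eE ltcR.
have := H (s - p) bs hn.
rewrite normr_cabs -(rmorph1 (real_complex R)) lecR.
have -> : (s - p) *: (1 : R[i]) + p = s by rewrite /GRing.scale/= mulr1 subrK.
rewrite /GRing.scale/= => h.
have : cabs ((s - p)^-1 * (f s - f p)) <= cabs l + 1.
  have := cabsB l (l - (s - p)^-1 * (f s - f p)).
  rewrite opprB subrKC => h'; lra.
rewrite cabsM cabsV mulrC ler_pdivrMr// cabs_gt0//.
Qed.

Theorem theoremA1 (R : realType) (K : fieldExtType rat) (d : nat)
    (d_ge1 : (1 <= d)%N)
    (alpha : nonzeroPrimes K -> 'I_d -> R[i])
    (alpha_le1 : forall P j, `|alpha P j| <= 1)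
    (L : R[i] -> R[i])
    (L_euler : forall s : R[i], 1 < complex.Re s -> L s = eulerProduct alpha s)
    (L_analytic : analyticOn [set s : R[i] | 1 <= complex.Re s] L)
    (L_neq0 : forall s : R[i], complex.Re s = 1 -> L s != 0) :
  forall s : R[i], complex.Re s = 1 ->
    partialEulerProduct alpha s x @[x --> +oo] --> L s.
Proof.
move=> s s1; have [U [_ DU] dU] := L_analytic.
have L_lip p : complex.Re p = 1 -> exists2 r : R, 0 < r & exists M : R,
    forall s, cabs (s - p) < r -> cabs (L s - L p) <= M * cabs (s - p).
  by move=> p1; apply/derivable_lipschitz_at/dU/DU; rewrite /= p1.
have L_exp z : 1 < complex.Re z -> L z = expC (logSum (alphas alpha) z).
  by move=> z1; rewrite L_euler// eulerProductE.
apply/cvgrPdist_le => e e0.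
have eE : e = (complex.Re e)%:C by rewrite RRe_real// ger0_real// ltW.
have e0' : 0 < complex.Re e by move: e0; rewrite {1}eE ltcR.
have [N0 N0P] := euler_boundary_cvg (alphas0 alpha) (alphas_le1 alpha_le1)
  (size_alphas alpha) L_exp L_neq0 L_lip s1 e0'.
near=> x.
have xN : N0%:R <= x by near: x; apply: nbhs_pinfty_ge; exact: num_real.
have x0 : 0 <= x by exact: le_trans (ler0n _ _) xN.
rewrite normr_cabs eE lecR cabsBC partialEulerProductE//.
by apply: N0P; rewrite truncn_ge_nat.
Unshelve. all: by end_near. Qed.
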